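(* Let $P\in\mathbb{C}[x,y]$ have no zeros in $\mathbb{H}^2$, satisfy $P(0,0)=0$, and have no common factors with $\bar P$. Let $[P]$ be as described in the context. Then $$\dim\bigl(\mathcal{I}^2_P/([P],\overline{[P]})\bigr)=\tfrac12\dim\bigl(\mathbb{C}\{x,y\}/(P,\bar P)\bigr).$$
   Context: $\mathbb{H}=\{z\in\mathbb{C}:\operatorname{Im} z>0\}$, $\mathbb{H}^2=\mathbb{H}\times\mathbb{H}$. For a polynomial or power series $P$, $\bar P(x,y)=\overline{P(\bar x,\bar y)}$. $\mathbb{C}\{x,y\}$ is the ring of convergent power series at $(0,0)$; $(F,G)$ denotes the ideal generated by $F,G$ in $\mathbb{C}\{x,y\}$. $f\in L^{\mathfrak{p}}_{loc}$ means $f$ is in $L^{\mathfrak{p}}(U)$ (Lebesgue measure) for some neighborhood $U$ of $(0,0)$ in $\mathbb{R}^2$; $\mathcal{I}^{\mathfrak{p}}_P=\{Q\in\mathbb{C}\{x,y\}:Q/P\in L^{\mathfrak{p}}_{loc}\}$. By a theorem of Bickel–Knese–Pascoe–Sola, for such $P$ vanishing to order $M$ at $(0,0)$ there exist $L_1,\dots,L_M\in\mathbb{N}$ and $q_1,\dots,q_M\in\mathbb{R}[x]$ with $q_j(0)=0$, $q_j'(0)>0$, $\deg q_j<2L_j$, such that $[P](x,y)=\prod_{j=1}^M(y+q_j(x)+ix^{2L_j})$ satisfies: $P/[P]$ and $[P]/P$ are bounded on a punctured neighborhood of $(0,0)$ in $\mathbb{R}^2$. *)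

(* Defs.v *)
From HB Require Import structures.
From mathcomp Require Import all_boot all_order all_algebra.
From mathcomp Require Import all_classical all_reals all_analysis.
From mathcomp Require Import complex.

Set Implicit Arguments.
Unset Strict Implicit.
Unset Printing Implicit Defensive.

Import Order.TTheory GRing.Theory Num.Theory.
Import numFieldTopology.Exports numFieldNormedType.Exports.
Local Open Scope ring_scope.
Local Open Scope classical_set_scope.
Local Open Scope complex_scope.

(* Bivariate polynomials C[x,y]: {poly {poly C}}, the OUTER variable   *)
(* is y and the coefficients are polynomials in x.                      *)

Section Defs.
Variable R : realType.
Local Notation C := R[i].

Definition csq (z : C) : R := complex.Re z ^+ 2 + complex.Im z ^+ 2.
Definition cnorm (z : C) : R := Num.sqrt (csq z).

Definition pcoef (P : {poly {poly C}}) (i j : nat) : C := (P`_j)`_i.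

Definition peval (P : {poly {poly C}}) (x y : C) : C :=
  (map_poly (fun p : {poly C} => p.[x]) P).[y].

(* \bar P(x,y) = conj (P (conj x, conj y)) : conjugate all coefficients *)
Definition pconj (P : {poly {poly C}}) : {poly {poly C}} :=
  map_poly (map_poly (fun c : C => conjc c)) P.

Definition no_common_factor (P Q : {poly {poly C}}) : Prop :=
  forall D E1 E2 : {poly {poly C}}, P = D * E1 -> Q = D * E2 ->
    exists c : C, c != 0 /\ D = (c%:P)%:P.

Definition vanishing_order (P : {poly {poly C}}) (M : nat) : Prop :=
  (exists i j, (i + j = M)%N /\ pcoef P i j != 0) /\
  (forall i j, (i + j < M)%N -> pcoef P i j = 0).

(* Formal power series in x, y: coefficient arrays (i,j) |-> coef of    *)
(* x^i y^j.  C{x,y} = those with a positive radius of convergence.     *)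

Definition pseries := nat -> nat -> C.

Definition ps_add (a b : pseries) : pseries := fun i j => a i j + b i j.
Definition ps_scale (c : C) (a : pseries) : pseries := fun i j => c * a i j.
Definition ps_zero : pseries := fun _ _ => 0.
Definition ps_mul (a b : pseries) : pseries := fun i j =>
  \sum_(k < i.+1) \sum_(l < j.+1) a k l * b (i - k)%N (j - l)%N.
Definition ps_of_poly (P : {poly {poly C}}) : pseries := pcoef P.

Definition ps_bounded_at (a : pseries) (r : R) : Prop :=
  exists B : R, forall i j, cnorm (a i j) * r ^+ (i + j) <= B.

Definition convergent (a : pseries) : Prop :=
  exists r : R, 0 < r /\ ps_bounded_at a r.

Definition ps_partial (a : pseries) (x y : C) (n : nat) : C :=
  \sum_(i < n) \sum_(j < n) a i j * x ^+ i * y ^+ j.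
Definition ps_eval (a : pseries) (x y : C) : C :=
  (limn (fun n => complex.Re (ps_partial a x y n)))
  +i* (limn (fun n => complex.Im (ps_partial a x y n))).

Definition leb2 := ((@lebesgue_measure R) \x (@lebesgue_measure R))%E.

Definition square (e : R) : set (R * R) :=
  [set z | `|z.1| < e /\ `|z.2| < e].

(* Q / P in L^2_loc : Q/P is in L^2(U) for some neighbourhood U of (0,0)
   in R^2; we take U an open square on which the series Q converges.   *)
Definition L2loc_quot (Q : pseries) (P : {poly {poly C}}) : Prop :=
  exists e : R, 0 < e /\ ps_bounded_at Q e /\
    leb2.-integrable (square e)
      (fun z => (csq (ps_eval Q z.1%:C z.2%:C / peval P z.1%:C z.2%:C))%:E).

Definition I2 (P : {poly {poly C}}) : set pseries :=
  [set Q | convergent Q /\ L2loc_quot Q P].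

Definition ideal2 (F G : pseries) : set pseries :=
  [set H | exists A B, convergent A /\ convergent B /\
            H = ps_add (ps_mul A F) (ps_mul B G)].

Definition Cxy : set pseries := [set a | convergent a].

Definition ps_comb (n : nat) (c : 'I_n -> C) (v : 'I_n -> pseries) : pseries :=
  fun i j => \sum_(k < n) c k * v k i j.

Definition quot_dim (U W : set pseries) (n : nat) : Prop :=
  exists v : 'I_n -> pseries,
    (forall k, U (v k)) /\
    (forall c : 'I_n -> C, W (ps_comb c v) -> forall k, c k = 0) /\
    (forall u, U u -> exists c : 'I_n -> C,
        W (ps_add u (ps_scale (-1) (ps_comb c v)))).

Definition bkps_factor (q : {poly R}) (L : nat) : {poly {poly C}} :=
  'X + (map_poly (fun r : R => r%:C) q + 'i *: 'X^(2 * L))%:P.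

Definition bkps (M : nat) (q : 'I_M -> {poly R}) (L : 'I_M -> nat)
  : {poly {poly C}} := \prod_(j < M) bkps_factor (q j) (L j).

Definition comparable_near0 (P Q : {poly {poly C}}) : Prop :=
  exists e K : R, 0 < e /\ forall x y : R, (x, y) != (0, 0) ->
    `|x| < e -> `|y| < e ->
    cnorm (peval P x%:C y%:C / peval Q x%:C y%:C) <= K /\
    cnorm (peval Q x%:C y%:C / peval P x%:C y%:C) <= K.

End Defs.

(* Main.v *)
(** Write [B] for [[P] = prod_j (y - b_j(x))], [b_j = - q_j - i x^(2 L_j)].

    Both sides of the equality are compared with
    [N = ord_x prod_(j, k) (b_j - conj b_k)], which is even because conjugation
    exchanges the factors [(j, k)] and [(k, j)] and [b_j - conj b_j = - 2 i x^(2 L_j)].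

    - All the ideals contain [x^T] and [y^T] for large [T], so the quotients can be
      computed with polynomials.  For a polynomial [W], monic in [y], the quotient by
      [(W, conj W)] is the cokernel of multiplication by [conj W] on [C[x][y] / W];
      its dimension is the order at [x = 0] of the determinant, i.e. of the resultant.
    - Hensel lifting gives [P = W U + O(x^T)] with [W(0, y) = y^M] and [U(0, 0) <> 0],
      whence [(P, conj P) = (W, conj W)].  For real [x], both [W(x, y)] and [B(x, y)]
      have their zeros in the lower half plane and are comparable for real [y], hence
      also for [y] in the upper half plane.  Evaluating at conjugates of zeros, the two
      resultants are comparable, so [dim C{x,y} / (P, conj P) = N], and the same holds
      for [B].
    - [Q / P] is locally square integrable iff [Q / B] is.  Splitting off the linear
      factors [y - b_j] one at a time shows that the space of these [Q] has codimension
      [sum_k (L_k + sum_(j < k) ord (b_k - conj b_j)) = N / 2]. *)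

From HB Require Import structures.
From mathcomp Require Import all_boot all_order all_algebra.
From mathcomp Require Import all_classical all_reals all_analysis.
From mathcomp Require Import measurable_realfun complex ring lra.
Require Import Defs.

Set Implicit Arguments.
Unset Strict Implicit.
Unset Printing Implicit Defensive.

Import Order.TTheory GRing.Theory Num.Theory.
Import numFieldTopology.Exports numFieldNormedType.Exports.
Local Open Scope ring_scope.

(** * Dimensions of quotients *)

Section QuotientDimension.
Variables (K : fieldType) (V : lmodType {poly K}).
Implicit Types (U W : V -> Prop).

(** The obstacle is that square integrability and the comparability of [P] with [B] are known at
    real points only, whereas dimensions are algebraic. The bridge: a polynomial in [x] whose
    modulus lies between two positive multiples of [x^n] on some interval [(0, d)] has order exactly
    [n] at zero. Orders are read off in this way, without Puiseux series. Passing from real to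
    complex [y] is possible because all zeros lie on one side of the real axis. Since only
    polynomials are used, the factorisation of [P] is exact only up to a power of [x]. The error is
    harmless twice: at real points it is small against [prodB_lower], and algebraically it lies in
    the ideal. The one half arises factor by factor: adjoining [y - b] adds [L + k] to the
    codimension of the square integrable numerators and [2 (L + k)] to the order of the resultant,
    where [k] is the order at [y = b] of the conjugate of the other factors. At real points [B] and
    its conjugate have equal modulus, so the ideal lies in the space of numerators and the dimension
    is the difference [2 n - n]. *)

Definition lcomb n (c : 'rV[K]_n) (v : 'I_n -> V) : V :=
  \sum_k (c 0 k)%:P *: v k.

(** The ambient module is over [{poly K}] and scalars of [K] act as constant polynomials, so row
    vectors over [K[x]] and bivariate polynomials are treated alike. With [fun=> True] for [U] this
    is the codimension of [W]. *)
Definition qdim U W (n : nat) : Prop :=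
  exists v : 'I_n -> V, [/\ forall k, U (v k),
    forall c, W (lcomb c v) -> c = 0 &
    forall u, U u -> exists c, W (u - lcomb c v)].

Definition kclosed W : Prop :=
  W 0 /\ forall (a : K) u v, W u -> W v -> W (a%:P *: u + v).

Lemma kclosedD W u v : kclosed W -> W u -> W v -> W (u + v).
Proof. by move=> [_ WD] Wu Wv; have := WD 1 u v Wu Wv; rewrite scale1r. Qed.

Lemma kclosedZ W a u : kclosed W -> W u -> W (a%:P *: u).
Proof. by move=> [W0 WD] Wu; have := WD a u 0 Wu W0; rewrite addr0. Qed.

Lemma kclosedN W u : kclosed W -> W u -> W (- u).
Proof.
by move=> cW /(kclosedZ (-1) cW); rewrite polyCN scaleNr scale1r.
Qed.

Lemma kclosedB W u v : kclosed W -> W u -> W v -> W (u - v).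
Proof. by move=> cW Wu Wv; apply: kclosedD => //; apply: kclosedN. Qed.

Lemma kclosed_sum W (I : Type) (r : seq I) (F : I -> V) :
  kclosed W -> (forall i, W (F i)) -> W (\sum_(i <- r) F i).
Proof.
move=> cW WF; elim: r => [|i r IH]; first by rewrite big_nil; case: cW.
by rewrite big_cons; apply: kclosedD.
Qed.

Lemma kclosed_lcomb W n (c : 'rV[K]_n) v :
  kclosed W -> (forall k, W (v k)) -> W (lcomb c v).
Proof. by move=> cW Wv; apply: kclosed_sum => // i; apply: kclosedZ. Qed.

Lemma lcombD n (c d : 'rV[K]_n) v : lcomb (c + d) v = lcomb c v + lcomb d v.
Proof.
rewrite /lcomb -big_split /=; apply: eq_bigr => k _.
by rewrite mxE polyCD scalerDl.
Qed.

Lemma lcombZ n a (c : 'rV[K]_n) v : lcomb (a *: c) v = a%:P *: lcomb c v.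
Proof.
by rewrite /lcomb scaler_sumr; apply: eq_bigr => k _; rewrite mxE polyCM scalerA.
Qed.

Lemma lcombN n (c : 'rV[K]_n) v : lcomb (- c) v = - lcomb c v.
Proof. by rewrite -[- c]scaleN1r lcombZ polyCN scaleNr scale1r. Qed.

Lemma lcombB n (c d : 'rV[K]_n) v : lcomb (c - d) v = lcomb c v - lcomb d v.
Proof. by rewrite lcombD lcombN. Qed.

Lemma lcomb_mul m n (c : 'rV[K]_m) (H : 'M[K]_(m, n)) v :
  lcomb (c *m H) v = lcomb c (fun k => lcomb (row k H) v).
Proof.
rewrite /lcomb; under [RHS]eq_bigr do rewrite scaler_sumr.
rewrite exchange_big /=; apply: eq_bigr => l _.
rewrite mxE rmorph_sum /= scaler_suml; apply: eq_bigr => k _.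
by rewrite mxE polyCM scalerA.
Qed.

Lemma lcomb_congr W n (c : 'rV[K]_n) v w : kclosed W ->
  (forall k, W (v k - w k)) -> W (lcomb c v - lcomb c w).
Proof.
move=> cW Wvw; rewrite /lcomb -sumrB; apply: kclosed_sum => // k.
by rewrite -scalerBr; apply: kclosedZ.
Qed.

(* With [H] the matrix of [V/J -> V/I], the quotient [I/J] is [ker H]. *)
Lemma qdim_sub (I J : V -> Prop) N n : kclosed I -> kclosed J ->
  (forall u, J u -> I u) -> qdim (fun=> True) J N -> qdim (fun=> True) I n ->
  qdim I J (N - n).
Proof.
move=> cI cJ JI [v [_ vfree vspan]] [w [_ wfree wspan]].
have /choice[H_ HP] k : exists c, I (v k - lcomb c w) by exact: wspan.
have /choice[G_ GP] k : exists c, J (w k - lcomb c v) by exact: vspan.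
pose H := \matrix_k H_ k; pose G := \matrix_k G_ k.
have vH (c : 'rV[K]_N) : I (lcomb c v - lcomb (c *m H) w).
  rewrite lcomb_mul; apply: lcomb_congr => // k.
  by rewrite rowK; exact: HP.
have wG (c : 'rV[K]_n) : J (lcomb c w - lcomb (c *m G) v).
  rewrite lcomb_mul; apply: lcomb_congr => // k.
  by rewrite rowK; exact: GP.
have kerP (c : 'rV[K]_N) : I (lcomb c v) <-> c *m H = 0.
  split=> [Ic|cH0].
    apply: wfree; rewrite -[lcomb _ w](subKr (lcomb c v)).
    exact: kclosedB.
  have := vH c; rewrite cH0.
  by rewrite [lcomb 0 w]/lcomb big1 ?subr0 // => k _; rewrite mxE scale0r.
(* As [J] lies in [I], lifting the basis [w] of [V/I] to [V/J] and projecting back is the identity;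
   so [H] has rank [n]. *)
have GH1 : G *m H = 1%:M.
  apply/row_matrixP => i; rewrite !rowE; apply/eqP; rewrite -subr_eq0; apply/eqP.
  apply: wfree; rewrite lcombB !mulmx1 mulmxA.
  have := kclosedD cI (JI _ (wG (delta_mx 0 i))) (vH (delta_mx 0 i *m G)).
  by rewrite addrA subrK => /(kclosedN cI); rewrite opprB.
have rkH : \rank H = n.
  apply/eqP; rewrite eqn_leq rank_leq_col /=.
  by rewrite -{1}(mxrank1 K n) -GH1 mxrankM_maxr.
have rkker : \rank (kermx H) = (N - n)%N by rewrite mxrank_ker rkH.
pose B : 'M[K]_(N - n, N) := castmx (rkker, erefl N) (row_base (kermx H)).
have Bfree : row_free B.
  by rewrite /B row_free_castmx row_base_free.
have Bker : (B :=: kermx H)%MS.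
  apply: eqmx_trans (eq_row_base _).
  by rewrite /B; exact: eqmx_cast.
exists (fun k => lcomb (row k B) v); split.
- move=> k; apply/kerP; apply/sub_kermxP.
  by rewrite -Bker; apply: row_sub.
- move=> c; rewrite -lcomb_mul => /vfree /eqP.
  by rewrite -[0](mul0mx 1 B) => /eqP /(row_free_inj Bfree).
- move=> u Iu; have [c Jc] := vspan u Logic.I.
  have : I (lcomb c v).
    have := kclosedB cI Iu (JI _ Jc); rewrite opprB addrC subrK //.
  move=> /kerP /sub_kermxP; rewrite -Bker => /submxP[d cd].
  by exists d; rewrite -lcomb_mul -cd.
Qed.

Lemma qdim_trans (U I J : V -> Prop) m n : kclosed I ->
  (forall u, J u -> I u) -> (forall u, I u -> U u) ->
  qdim U I m -> qdim I J n -> qdim U J (m + n).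
Proof.
move=> cI JI IU [v [Uv vfree vspan]] [w [Iw wfree wspan]].
pose z (k : 'I_(m + n)) := match fintype.split k with inl i => v i | inr i => w i end.
have zE (c : 'rV[K]_(m + n)) :
    lcomb c z = lcomb (lsubmx c) v + lcomb (rsubmx c) w.
  rewrite /lcomb big_split_ord /=; congr (_ + _); apply: eq_bigr => i _.
    by rewrite /z (unsplitK (inl i)) mxE.
  by rewrite /z (unsplitK (inr i)) mxE.
have lcomb0 k (f : 'I_k -> V) : lcomb 0 f = 0.
  by rewrite /lcomb big1 // => i _; rewrite mxE scale0r.
exists z; split.
- by move=> k; rewrite /z; case: fintype.split => i //; apply: IU.
- move=> c; rewrite zE => Jc.
  have c1 : lsubmx c = 0.
    apply: vfree; rewrite -[lcomb _ v](addrK (lcomb (rsubmx c) w)).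
    by apply: kclosedB => //; [exact: JI|exact: kclosed_lcomb].
  move: Jc; rewrite c1 lcomb0 add0r => /wfree c2.
  by rewrite -[c]hsubmxK c1 c2 row_mx0.
- move=> u Uu; have [c /wspan[d Jd]] := vspan u Uu.
  by exists (row_mx c d); rewrite zE row_mxKl row_mxKr opprD addrA.
Qed.

End QuotientDimension.

(** * Cokernels of square matrices over [K[x]] near [x = 0] *)

Section Lattice.
Variables (K : fieldType) (m : nat).
Implicit Types A : 'M[{poly K}]_m.

(* The row lattice of [A] after localising [K[x]] at [x = 0]. *)
Definition lattice A (v : 'rV[{poly K}]_m) : Prop :=
  exists2 u : {poly K}, u.[0] != 0 & exists s, u *: v = s *m A.

Lemma lattice_kclosed A : kclosed (lattice A).
Proof.
split; first by exists 1; [rewrite hornerC oner_neq0|exists 0; rewrite scaler0 mul0mx].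
move=> a v w [u u0 [s us]] [u' u'0 [s' us']].
exists (u * u'); first by rewrite hornerM mulf_neq0.
exists ((a%:P * u') *: s + u *: s').
rewrite mulmxDl -!scalemxAl -us -us' scalerDr !scalerA; congr (_ *: _ + _ *: _).
by rewrite mulrC mulrCA mulrC.
Qed.

Lemma lattice_unitmx E A : E \in unitmx -> forall v,
  lattice (E *m A) v <-> lattice A v.
Proof.
move=> uE v; split=> -[u u0 [s us]]; exists u => //.
  by exists (s *m E); rewrite us mulmxA.
by exists (s *m invmx E); rewrite us !mulmxA mulmxKV.
Qed.

Lemma lattice_eq A B : (forall v, lattice A v <-> lattice B v) ->
  forall n, qdim (fun=> True) (lattice A) n -> qdim (fun=> True) (lattice B) n.
Proof.
move=> AB n [v [h1 h2 h3]]; exists v; split=> //.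
  by move=> c /AB /h2.
by move=> u _; have [c /AB hc] := h3 u Logic.I; exists c.
Qed.

Lemma det_mulmx_inj A (s t : 'rV[{poly K}]_m) :
  \det A != 0 -> s *m A = t *m A -> s = t.
Proof.
move=> dA /(congr1 (mulmxr (\adj A))) /=; rewrite -!mulmxA mul_mx_adj.
rewrite !mul_mx_scalar => /matrixP E; apply/matrixP => i j.
by have := E i j; rewrite !mxE => /(mulfI dA).
Qed.

End Lattice.

Lemma horner0_dvd (K : fieldType) (p : {poly K}) : p.[0] = 0 ->
  exists q, p = 'X * q.
Proof.
move=> p0; have /factor_theorem[q ->] : root p 0 by apply/rootP.
by exists q; rewrite subr0 mulrC.
Qed.

Section LatticeDim.
Variables (K : fieldType).

(** A substitute for the Smith normal form. If the determinant vanishes at [0], a constant row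
    operation makes the last row divisible by [x]; dividing that row by [x] enlarges the lattice by
    exactly one dimension and lowers the order of the determinant by one. *)
Lemma qdim_lattice m (A : 'M[{poly K}]_m) N (u : {poly K}) : u.[0] != 0 ->
  \det A = 'X^N * u -> qdim (fun=> True) (lattice A) N.
Proof.
elim: N A u => [|N IH] A u u0 dA.
  exists (fun i => 0); split=> //.
    by move=> c _; apply/matrixP => i [].
  move=> v _; exists 0; rewrite /lcomb big_ord0 subr0.
  exists u => //; exists (v *m \adj A).
  by rewrite -mulmxA mul_adj_mx dA mul1r mul_mx_scalar.
have dA_neq0 : \det A != 0.
  rewrite dA mulf_neq0 ?expf_neq0 ?polyX_eq0 //.
  by apply: contraNneq u0 => ->; rewrite horner0.
case: m A dA dA_neq0 IH => [|m] A dA dA_neq0 IH.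
  by move: dA => /(congr1 (horner^~ 0)) /eqP;
     rewrite det_mx00 !hornerE exprS !mul0r oner_eq0.
pose A0 := map_mx (horner_eval (0 : K)) A.
have dA0 : \det A0 = 0.
  by rewrite det_map_mx dA /= horner_evalE !hornerE exprS mul0r mul0r.
have rA0 : (\rank A0 < m.+1)%N.
  rewrite ltn_neqAle rank_leq_row andbT; apply/negP => rA0.
  have : A0 \in unitmx by rewrite -row_full_unit /row_full.
  by rewrite unitmxE dA0 unitr0.
(* [A0] is [col_ebase], times a partial identity of rank below [m.+1], times [row_ebase]; removing
   the first factor leaves a last row that is zero at [x = 0]. *)
pose E0 := invmx (col_ebase A0).
have uE0 : E0 \in unitmx by rewrite unitmx_inv col_ebase_unit.
pose E : 'M[{poly K}]_m.+1 := map_mx polyC E0.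
have uE : E \in unitmx by rewrite map_unitmx.
have zrow j : (E *m A) ord_max j = 'X * ((E *m A) ord_max j %/ 'X).
  have [q qE] : exists q, (E *m A) ord_max j = 'X * q.
    apply: horner0_dvd; rewrite -horner_evalE.
    have -> : horner_eval 0 ((E *m A) ord_max j)
            = (map_mx (horner_eval 0) (E *m A)) ord_max j by rewrite [RHS]mxE.
    rewrite map_mxM -/A0.
    have -> : map_mx (horner_eval 0) E = E0.
      by apply/matrixP => i k; rewrite !mxE horner_evalE hornerC.
    rewrite -[A0]mulmx_ebase mulmxA mulmxA mulVmx ?col_ebase_unit // mul1mx.
    rewrite mxE big1 // => k _; rewrite mxE.
    by rewrite [(_ < \rank _)%N]ltnNge -ltnS rA0 andbF mul0r.
  by rewrite qE mulKp ?polyX_eq0.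
pose A' := \matrix_(i, j) if i == ord_max then ((E *m A) ord_max j %/ 'X)
                         else (E *m A) i j.
pose d : 'rV[{poly K}]_m.+1 := \row_i if i == ord_max then 'X else 1.
have EA : E *m A = diag_mx d *m A'.
  apply/matrixP => i j; rewrite mul_diag_mx [in RHS]mxE.
  rewrite [d _ _]mxE [A' _ _]mxE; case: eqP => [->|_]; last by rewrite mul1r.
  by rewrite {1}zrow.
have dd : \det (diag_mx d) = 'X.
  rewrite det_diag (bigD1 ord_max) //= mxE eqxx big1 ?mulr1 // => i /negPf ni.
  by rewrite mxE ni.
have dE : \det E = (\det E0)%:P by rewrite det_map_mx.
have dE0 : \det E0 != 0 by move: uE0; rewrite unitmxE unitfE.
have dA' : \det A' = 'X^N * ((\det E0)%:P * u).
  have dX : 'X * \det A' = (\det E0)%:P * ('X^(N.+1) * u).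
    by rewrite -{1}dd -det_mulmx -EA det_mulmx dE dA.
  have X0 : 'X != 0 :> {poly K} by rewrite polyX_eq0.
  by apply: (mulfI X0); rewrite dX exprS; ring.
have dA'_neq0 : \det A' != 0.
  apply: contraNneq dA_neq0 => dA'0.
  have : \det (E *m A) = 0 by rewrite EA det_mulmx dA'0 mulr0.
  by move=> /eqP; rewrite det_mulmx mulf_eq0 dE polyC_eq0 (negPf dE0).
have u'0 : ((\det E0)%:P * u).[0] != 0 by rewrite hornerM hornerC mulf_neq0.
have [w [_ wfree wspan]] := IH A' _ u'0 dA'.
apply: (@lattice_eq _ _ (E *m A)); first exact: lattice_unitmx.
pose a' := row ord_max A'.
have cL := lattice_kclosed A'; have cLE := lattice_kclosed (E *m A).
have sub v : lattice (E *m A) v -> lattice A' v.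
  by move=> [u1 u10 [s us]]; exists u1 => //; exists (s *m diag_mx d);
     rewrite us EA mulmxA.
have La' : lattice A' a'.
  exists 1; first by rewrite hornerC oner_neq0.
  by exists (delta_mx 0 ord_max); rewrite scale1r -rowE.
(* The divided row [a'] spans the new lattice modulo the old one: subtracting [c] times it makes the
   last coordinate vanish at [0], hence divisible by [x]. *)
have step z : lattice A' z -> exists c : K, lattice (E *m A) (z - c%:P *: a').
  move=> [u1 u10 [s us]]; exists ((s 0 ord_max).[0] / u1.[0]).
  set c := _ / _.
  have [t tE] : exists t, s 0 ord_max - c%:P * u1 = 'X * t.
    by apply: horner0_dvd; rewrite !hornerE /c divfK ?subrr.
  exists u1 => //.
  exists (\row_i if i == ord_max then t else s 0 i).
  rewrite EA mulmxA scalerBr us scalerA /a' rowE scalemxAl -mulmxBl.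
  congr (_ *m A'); apply/matrixP => i j; rewrite mul_mx_diag !mxE !ord1 eqxx /=.
  case: eqP => [->|/eqP nj]; last by rewrite mulr0 subr0 mulr1.
  by rewrite mulr1 [u1 * _]mulrC tE mulrC.
have a'free (c : K) : lattice (E *m A) (c%:P *: a') -> c = 0.
  move=> [u1 u10 [s]]; rewrite EA mulmxA scalerA /a' rowE scalemxAl.
  move=> /(det_mulmx_inj dA'_neq0) /matrixP /(_ 0 ord_max).
  rewrite mul_mx_diag !mxE !eqxx mulr1 => /(congr1 (horner^~ 0)) /eqP.
  rewrite !hornerE /= mulf_eq0 (negPf u10) /=.
  by move=> /eqP.
rewrite -[N.+1]addn1; apply: (qdim_trans cL sub) => //; first by exists w.
exists (fun=> a'); split=> // [c|z /step[c Lc]].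
  rewrite /lcomb big_ord1 => /a'free c0.
  by apply/matrixP => i j; rewrite !ord1 mxE.
by exists c%:M; rewrite /lcomb big_ord1 mxE eqxx mulr1n.
Qed.

End LatticeDim.

(** * Ideals generated by a monic polynomial and its conjugate *)

Section Companion.
Variables (m : nat).

(* [companionmx] with a size that does not depend on the polynomial. *)
Definition compm (S : nzRingType) (p : {poly S}) : 'M[S]_m.+1 :=
  \matrix_(i, j) if (i == m :> nat) then - p`_j else (i.+1 == j :> nat)%:R.

Lemma char_poly_compm (S : comNzRingType) (p : {poly S}) :
  p \is monic -> size p = m.+2 -> char_poly (compm p) = p.
Proof.
move=> pm sp; rewrite -[RHS](companionmxK pm) /compm /companionmx.
have : (size p).-1 = m.+1 by rewrite sp.
by move: (size p).-1 => d ->.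
Qed.

Lemma map_compm (S S' : nzRingType) (f : {rmorphism S -> S'}) (p : {poly S}) :
  map_mx f (compm p) = compm (map_poly f p).
Proof.
apply/matrixP => i j; rewrite !mxE coef_map; case: ifP => _.
  by rewrite rmorphN.
by rewrite rmorph_nat.
Qed.

Lemma rVpoly_compm (S : comNzRingType) (p : {poly S}) (v : 'rV[S]_m.+1) :
  p \is monic -> size p = m.+2 ->
  rVpoly (v *m compm p) = 'X * rVpoly v - (v 0 ord_max)%:P * p.
Proof.
move=> pm sp; apply/polyP => j; rewrite coefB coefXM coefCM.
have lead : p`_m.+1 = 1 by move/monicP: pm; rewrite /lead_coef sp.
have [jm|jm] := ltnP j m.+1; last first.
  rewrite nth_default; last exact: leq_trans (size_poly _ _) jm.
  case: j jm => [//|j]; rewrite ltnS /= => jm.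
  have [->|njm] := eqVneq j m.
    by rewrite lead mulr1 (coef_rVpoly_ord v ord_max) subrr.
  rewrite nth_default; last first.
    by apply: leq_trans (size_poly _ _) _; rewrite ltn_neqAle eq_sym njm.
  by rewrite nth_default ?mulr0 ?subrr // sp ltnS ltn_neqAle eq_sym njm.
rewrite (coef_rVpoly_ord _ (Ordinal jm)) mxE big_ord_recr /=.
rewrite [compm p ord_max _]mxE eqxx mulrN; congr (_ - _).
case: j jm => [|j] jm /=.
  by rewrite big1 // => i _; rewrite mxE /= ltn_eqF ?mulr0.
rewrite (coef_rVpoly_ord v (Ordinal (ltnW jm))).
rewrite (bigD1 (Ordinal (jm : (j < m)%N))) //= mxE /= ltn_eqF ?eqxx ?mulr1 //.
rewrite big1 ?addr0; first by congr (v _ _); apply: val_inj.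
move=> i /eqP ni; rewrite mxE /= ltn_eqF //.
case: eqP => [[ij]|_]; last by rewrite mulr0.
by case: ni; apply: val_inj.
Qed.

(** On coefficient vectors of remainders, [compm m p] is multiplication by [y] modulo [p], so
    [horner_mx (compm m p) G] is multiplication by [G]. The row lattice of the latter is therefore
    the ideal [(p, G)] read on remainders. *)
Lemma rVpoly_horner_compm (S : comNzRingType) (p G : {poly S}) (v : 'rV[S]_m.+1) :
  p \is monic -> size p = m.+2 ->
  exists k, rVpoly v * G = rVpoly (v *m horner_mx (compm p) G) + k * p.
Proof.
move=> pm sp; elim/poly_ind: G v => [|G c IH] v.
  by exists 0; rewrite rmorph0 mulmx0 linear0 mulr0 mul0r addr0.
have [k Gk] := IH v.
set w := v *m horner_mx (compm p) G in Gk.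
exists (k * 'X + (w 0 ord_max)%:P).
rewrite rmorphD rmorphM /= horner_mx_X horner_mx_C mulmxDr mul_mx_scalar.
rewrite -mulmxE mulmxA -/w linearD linearZ /= rVpoly_compm //.
rewrite -mul_polyC; rewrite mulrDr mulrA Gk.
by ring.
Qed.

(** The characteristic polynomial of [compm m p] at [g] is [p.[g]], and up to sign it is the
    determinant of the factor [y - g]. This yields the resultant while splitting only the second
    polynomial. *)
Lemma det_horner_compm (S : comNzRingType) (p : {poly S}) (gs : seq S) :
  p \is monic -> size p = m.+2 ->
  \det (horner_mx (compm p) (\prod_(g <- gs) ('X - g%:P)))
   = \prod_(g <- gs) ((-1) ^+ m.+1 * p.[g]).
Proof.
move=> pm sp; elim: gs => [|g gs IH].
  by rewrite !big_nil rmorph1 det1.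
rewrite !big_cons rmorphM /= -mulmxE det_mulmx IH; congr (_ * _).
rewrite rmorphB /= horner_mx_X horner_mx_C -[p in RHS](char_poly_compm pm sp).
rewrite -horner_evalE /char_poly -det_map_mx -detZ; congr (\det _).
move: (compm p) => B; apply/matrixP => i j; rewrite !mxE /= horner_evalE.
by rewrite hornerD hornerN hornerC hornerMn hornerX mulN1r opprB.
Qed.

End Companion.

Section LocalIdeal.
Variable K : fieldType.
Local Notation E := {poly {poly K}}.

(* The ideal [(F, G)] of [K[x, y]] after inverting the [u(x)], [u(0) <> 0]. *)
Definition xlocal_ideal (F G p : E) : Prop :=
  exists2 u : {poly K}, u.[0] != 0 & exists a b, u%:P * p = a * F + b * G.

Lemma xlocal_ideal_kclosed F G : kclosed (xlocal_ideal F G).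
Proof.
split; first by exists 1; [rewrite hornerC oner_neq0|exists 0, 0; ring].
move=> a v w [u u0 [s [t us]]] [u' u'0 [s' [t' us']]].
exists (u * u'); first by rewrite hornerM mulf_neq0.
exists (a%:P%:P * u'%:P * s + u%:P * s'), (a%:P%:P * u'%:P * t + u%:P * t').
rewrite -mul_polyC polyCM.
transitivity (a%:P%:P * u'%:P * (u%:P * v) + u%:P * (u'%:P * w)); first by ring.
by rewrite us us'; ring.
Qed.

Lemma xlocal_idealM F G r p : xlocal_ideal F G p -> xlocal_ideal F G (r * p).
Proof.
move=> [u u0 [a [b ub]]]; exists u => //; exists (r * a), (r * b).
by rewrite mulrCA ub; ring.
Qed.

Lemma xlocal_idealD F G p q : xlocal_ideal F G p -> xlocal_ideal F G q ->
  xlocal_ideal F G (p + q).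
Proof. by apply: kclosedD; apply: xlocal_ideal_kclosed. Qed.

Lemma xlocal_ideal_in F G a b : xlocal_ideal F G (a * F + b * G).
Proof.
by exists 1; [rewrite hornerC oner_neq0|exists a, b; rewrite mul1r].
Qed.

Variables (m N : nat) (W G : E) (u0 : {poly K}).
Hypotheses (Wm : W \is monic) (sW : size W = m.+2) (u00 : u0.[0] != 0).
Hypothesis dA : \det (horner_mx (compm m W) G) = 'X^N * u0.
Let A := horner_mx (compm m W) G.

Lemma monic_division (p : E) : exists (v : 'rV_m.+1) k, p = rVpoly v + k * W.
Proof.
exists (poly_rV (Pdiv.Ring.rmodp p W)), (Pdiv.Ring.rdivp p W).
rewrite addrC poly_rV_K; first exact: Pdiv.RingMonic.rdivp_eq.
by rewrite -ltnS -sW; apply: Pdiv.Ring.ltn_rmodpN0; apply: monic_neq0.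
Qed.

Lemma lattice_xlocal_ideal (v : 'rV_m.+1) :
  lattice A v <-> xlocal_ideal W G (rVpoly v).
Proof.
split=> [[u uN [s us]]|[u uN [a [b uab]]]].
  have [k sk] := rVpoly_horner_compm G s Wm sW.
  exists u => //; exists (- k), (rVpoly s).
  by rewrite sk -/A -us linearZ /= -mul_polyC; ring.
have [s [b1 bE]] := monic_division b.
have [k sk] := rVpoly_horner_compm G s Wm sW.
exists u => //; exists s; apply/eqP; rewrite -subr_eq0; apply/eqP.
apply: (can_inj rVpolyK); rewrite linear0.
have rE : rVpoly (u *: v - s *m A) = W * (a + b1 * G + k).
  rewrite linearB /= linearZ /= -mul_polyC uab bE mulrDl sk -/A; ring.
(* The difference has degree at most [m], while [W] is monic of degree [m.+1]: a multiple of [W]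
   this small is zero. *)
apply/eqP; apply: contraT => r0.
have k0 : a + b1 * G + k != 0 by apply: contraNneq r0 => k0; rewrite rE k0 mulr0.
have : (size (rVpoly (u *: v - s *m A)) <= m.+1)%N by exact: size_poly.
rewrite rE size_monicM // sW /= leqNgt.
by rewrite -[X in (X < _)%N]addn0 ltn_add2l lt0n size_poly_eq0 k0.
Qed.

Lemma qdim_xlocal_ideal : qdim (fun=> True) (xlocal_ideal W G) N.
Proof.
have [w [_ wfree wspan]] := qdim_lattice u00 dA.
have lc (c : 'rV[K]_N) : lcomb c (fun k => rVpoly (w k)) = rVpoly (lcomb c w).
  by rewrite /lcomb linear_sum; apply: eq_bigr => k _; rewrite linearZ.
exists (fun k => rVpoly (w k)); split=> //.
  by move=> c; rewrite lc => /lattice_xlocal_ideal /wfree.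
move=> p _; have [v [k ->]] := monic_division p.
have [c Lc] := wspan v Logic.I; exists c; rewrite lc addrAC -linearB.
apply: xlocal_idealD; first exact/lattice_xlocal_ideal.
by have := xlocal_ideal_in W G k 0; rewrite mul0r addr0.
Qed.

(** Cramer's rule: the adjugate shows that the determinant kills the cokernel, and the determinant
    is ['X^N] up to a unit at [0]. *)
Lemma Xn_xlocal_ideal : xlocal_ideal W G (('X^N)%:P).
Proof.
have [v [k E1]] := monic_division 1.
have L : lattice A ('X^N *: v).
  exists u0 => //; exists (v *m \adj A).
  by rewrite -mulmxA mul_adj_mx dA mul_mx_scalar scalerA mulrC.
have -> : ('X^N)%:P = rVpoly ('X^N *: v) + ('X^N)%:P * k * W + 0 * G.
  by rewrite linearZ /= -mul_polyC mul0r addr0 -mulrA -mulrDr -E1 mulr1.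
rewrite -addrA; apply: xlocal_idealD; first exact/lattice_xlocal_ideal.
exact: xlocal_ideal_in.
Qed.

(** Modulo [W], the power [y^M] is a multiple of [x]; its [N]-th power is then a multiple of
    [x^N]. *)
Lemma Yn_xlocal_ideal (H : E) M : W = 'X^M + 'X%:P * H ->
  xlocal_ideal W G ('X^(M * N)).
Proof.
move=> WE.
have sub_exp n : exists k, (W - 'X%:P * H) ^+ n = k * W + ('X^n)%:P * (- H) ^+ n.
  elim: n => [|n [k IH]]; first by exists 0; rewrite !expr0; ring.
  exists (k * (W - 'X%:P * H) + ('X^n)%:P * (- H) ^+ n).
  by rewrite exprSr IH !exprSr polyCM; ring.
have [k kE] := sub_exp N.
rewrite exprM -(addrK ('X%:P * H) 'X^M) -WE kE.
apply: xlocal_idealD; last by rewrite mulrC; apply/xlocal_idealM/Xn_xlocal_ideal.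
by have := xlocal_ideal_in W G k 0; rewrite mul0r addr0.
Qed.

End LocalIdeal.

Notation slice x := (map_poly (horner_eval x)).

(** * Hensel lifting *)

Section Hensel.
Variable K : fieldType.
Local Notation E := {poly {poly K}}.

Lemma slice_polyC (x : K) (c : {poly K}) : slice x c%:P = (c.[x])%:P.
Proof. exact: map_polyC. Qed.

Lemma slice_X (x : K) : slice x ('X : E) = 'X.
Proof. exact: map_polyX. Qed.

Lemma slice_lift (x : K) (v : {poly K}) : slice x (map_poly polyC v) = v.
Proof.
apply/polyP => i; rewrite !coef_map /=; exact: hornerC.
Qed.

Lemma slice0_dvd (p : E) : slice 0 p = 0 -> exists q, p = 'X%:P * q.
Proof.
move=> p0; exists (\poly_(i < size p) (p`_i %/ 'X)); apply/polyP => i.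
rewrite coefCM coef_poly; case: ltnP => [_|ip]; last by rewrite nth_default ?mulr0.
have /horner0_dvd[q ->] : (p`_i).[0] = 0.
  by have /polyP/(_ i) := p0; rewrite coef_map coef0.
by rewrite mulKp ?polyX_eq0.
Qed.

(** The lifting gains one order in [x] at a time and stops at a finite order, so that the factors
    remain polynomials. The price is the term with [E0], which later estimates absorb. *)
Lemma hensel_factor (P : E) M (v : {poly K}) : slice 0 P = 'X^M * v ->
  v.[0] != 0 -> forall T, exists W U E0 : E, [/\ W \is monic, size W = M.+1,
    slice 0 W = 'X^M, slice 0 U = v & P = W * U + ('X^(T.+1))%:P * E0].
Proof.
move=> P0 v0; elim=> [|T [W [U [E0 [Wm sW W0 U0 PE]]]]].
  have /slice0_dvd[E0 E0P] : slice 0 (P - 'X^M * map_poly polyC v) = 0.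
    by rewrite rmorphB rmorphM rmorphXn /= slice_X slice_lift P0 subrr.
  exists 'X^M, (map_poly polyC v), E0; split=> //.
  - exact: monicXn.
  - exact: size_polyXn.
  - by rewrite rmorphXn /= slice_X.
  - exact: slice_lift.
  - by rewrite expr1 -E0P addrC subrK.
have cop : coprimep v 'X^M.
  apply: coprimep_expr; rewrite -['X]subr0 -polyC0.
  by rewrite coprimep_XsubC /root.
have [b1 [b2 b12]] : exists b1 b2, b1 * v + b2 * 'X^M = 1.
  have /Bezout_eq1_coprimepP[[b1 b2] b12] := cop.
  by exists b1, b2.
pose e := slice 0 E0.
(* The Bezout cofactor is reduced modulo ['X^M] so that the correction to [W] has degree below [M]
   and [W] stays monic; the quotient goes into the correction [u] of [U]. *)
pose w := (e * b1) %% 'X^M.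
pose u := (e * b1) %/ 'X^M * v + e * b2.
have euw : e = w * v + u * 'X^M.
  have eb : e * b1 = (e * b1) %/ 'X^M * 'X^M + w by exact: divp_eq.
  have : e = e * b1 * v + e * b2 * 'X^M by rewrite -!mulrA -mulrDr b12 mulr1.
  by rewrite eb /u => e2; rewrite [LHS]e2; ring.
have sw : (size w < M.+1)%N.
  by rewrite -(size_polyXn K M) ltn_modp -size_poly_eq0 size_polyXn.
pose lw : E := ('X^(T.+1))%:P * map_poly polyC w.
have slw : (size lw < size W)%N.
  rewrite sW ltnS.
  rewrite /lw mul_polyC; apply: leq_trans (size_scale_leq _ _) _.
  by apply: leq_trans (size_poly _ _) _; rewrite -ltnS.
have X0 : slice 0 ('X^(T.+1))%:P = 0 :> {poly K} by rewrite slice_polyC !hornerE expr0n polyC0.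
have /slice0_dvd[E1 E1P] : slice 0 (E0 - map_poly polyC w * U
    - W * map_poly polyC u - lw * map_poly polyC u) = 0.
  rewrite !rmorphB !rmorphM /= !slice_lift X0 W0 U0 -/e euw; ring.
exists (W + lw), (U + ('X^(T.+1))%:P * map_poly polyC u), E1; split.
- by rewrite monicE lead_coefDl // -monicE.
- by rewrite size_polyDl.
- by rewrite rmorphD rmorphM /= W0 X0 mul0r addr0.
- by rewrite rmorphD rmorphM /= U0 X0 mul0r addr0.
- have -> : ('X^(T.+2))%:P * E1 = ('X^(T.+1))%:P * ('X%:P * E1).
    by rewrite [in LHS]exprSr polyCM mulrA.
  by rewrite -E1P PE /lw; ring.
Qed.

End Hensel.

(** * Estimates for complex polynomials *)

Section ComplexNorm.
Variable R : realType.
Local Notation C := R[i].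
Local Open Scope complex_scope.
Implicit Types z w : C.

Lemma cnormE z : cnorm z = ComplexField.Normc.normc z.
Proof. by case: z. Qed.

Lemma cnorm_ge0 z : 0 <= cnorm z.
Proof. exact: sqrtr_ge0. Qed.

Lemma cnormM z w : cnorm (z * w) = cnorm z * cnorm w.
Proof. by rewrite !cnormE ComplexField.Normc.normcM. Qed.

Lemma cnorm0 : cnorm (0 : C) = 0.
Proof. by rewrite cnormE ComplexField.Normc.normc0. Qed.

Lemma cnorm1 : cnorm (1 : C) = 1.
Proof. by rewrite cnormE ComplexField.Normc.normc1. Qed.

Lemma cnorm_eq0 z : (cnorm z == 0) = (z == 0).
Proof.
apply/eqP/eqP => [|->]; last exact: cnorm0.
by rewrite cnormE; apply: ComplexField.Normc.eq0_normc.
Qed.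

Lemma cnorm_gt0 z : (0 < cnorm z) = (z != 0).
Proof. by rewrite lt_def cnorm_ge0 andbT cnorm_eq0. Qed.

Lemma cnormD z w : cnorm (z + w) <= cnorm z + cnorm w.
Proof. by rewrite !cnormE; apply: le_normcD. Qed.

Lemma cnormN z : cnorm (- z) = cnorm z.
Proof. by rewrite !cnormE normcN. Qed.

Lemma cnormBC z w : cnorm (z - w) = cnorm (w - z).
Proof. by rewrite -cnormN opprB. Qed.

Lemma cnormB z w : cnorm z - cnorm w <= cnorm (z + w).
Proof.
by rewrite lerBlDr; have := cnormD (z + w) (- w); rewrite addrK cnormN.
Qed.

Lemma cnormV z : cnorm z^-1 = (cnorm z)^-1.
Proof. by rewrite !cnormE ComplexField.Normc.normcV. Qed.

Lemma cnormX z n : cnorm (z ^+ n) = cnorm z ^+ n.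
Proof. by elim: n => [|n IH]; rewrite ?cnorm1 // !exprS cnormM IH. Qed.

Lemma cnorm_prod (I : Type) (r : seq I) (F : I -> C) :
  cnorm (\prod_(i <- r) F i) = \prod_(i <- r) cnorm (F i).
Proof.
by elim: r => [|i r IH]; rewrite ?big_nil ?cnorm1 // !big_cons cnormM IH.
Qed.

Lemma cnorm_sum (I : Type) (r : seq I) (F : I -> C) :
  cnorm (\sum_(i <- r) F i) <= \sum_(i <- r) cnorm (F i).
Proof.
elim: r => [|i r IH]; first by rewrite !big_nil cnorm0.
by rewrite !big_cons; apply: le_trans (cnormD _ _) _; rewrite lerD2l.
Qed.

Lemma cnorm_real (x : R) : cnorm x%:C = `|x|.
Proof. by rewrite /cnorm /csq /= expr0n addr0 sqrtr_sqr. Qed.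

Lemma cnorm_conj z : cnorm z^*%C = cnorm z.
Proof. by case: z => a b; rewrite /cnorm /csq /= sqrrN. Qed.

Lemma csqE z : csq z = cnorm z ^+ 2.
Proof. by rewrite sqr_sqrtr // addr_ge0 ?sqr_ge0. Qed.

Lemma cnorm_ge_Im z : `|complex.Im z| <= cnorm z.
Proof.
by rewrite -sqrtr_sqr ler_wsqrtr // lerDr sqr_ge0.
Qed.

Lemma cnorm_ge_Re z : `|complex.Re z| <= cnorm z.
Proof.
by rewrite -sqrtr_sqr ler_wsqrtr // lerDl sqr_ge0.
Qed.

Lemma cnorm_le_ReIm z : cnorm z <= `|complex.Re z| + `|complex.Im z|.
Proof.
rewrite -[leRHS]ger0_norm ?addr_ge0 // -sqrtr_sqr ler_wsqrtr // /csq.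
rewrite sqrrD !real_normK ?num_real // -addrA lerD2l lerDr.
by rewrite mulrn_wge0 // mulr_ge0.
Qed.

End ComplexNorm.

Section Estimates.
Variable R : realType.
Local Notation C := R[i].
Local Open Scope complex_scope.
Implicit Types (z w : C) (f p : {poly C}).

Lemma ReB z w : complex.Re (z - w) = complex.Re z - complex.Re w.
Proof. by case: z; case: w. Qed.

Lemma ImB z w : complex.Im (z - w) = complex.Im z - complex.Im w.
Proof. by case: z; case: w. Qed.

Lemma poly_bound f (r : R) :
  exists2 K, 0 < K & forall z, cnorm z <= r -> cnorm f.[z] <= K.
Proof.
elim/poly_ind: f => [|f c [K K0 IH]].
  by exists 1 => // z _; rewrite horner0 cnorm0.
have r0 : 0 <= Num.max r 0 by rewrite le_max lexx orbT.
exists (K * Num.max r 0 + cnorm c + 1).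
  by rewrite ltr_wpDl // addr_ge0 ?cnorm_ge0 // mulr_ge0 // ltW.
move=> z zr; rewrite hornerMXaddC; apply: le_trans (cnormD _ _) _.
rewrite -addrA lerD ?lerDl // cnormM ler_pM ?cnorm_ge0 ?IH //.
by rewrite le_max zr.
Qed.

Lemma poly0_decomp f : exists g, f = f.[0]%:P + 'X * g.
Proof.
have [|g gE] := @horner0_dvd _ (f - f.[0]%:P); first by rewrite !hornerE subrr.
by exists g; rewrite -gE addrC subrK.
Qed.

Lemma peval_slice (P : {poly {poly C}}) (x y : C) : peval P x y = (slice x P).[y].
Proof. by []. Qed.

Lemma pevalD P Q (x y : C) : peval (P + Q) x y = peval P x y + peval Q x y.
Proof. by rewrite !peval_slice rmorphD hornerD. Qed.

Lemma pevalB P Q (x y : C) : peval (P - Q) x y = peval P x y - peval Q x y.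
Proof. by rewrite !peval_slice rmorphB hornerD hornerN. Qed.

Lemma pevalM P Q (x y : C) : peval (P * Q) x y = peval P x y * peval Q x y.
Proof. by rewrite !peval_slice rmorphM hornerM. Qed.

Lemma pevalC (c : {poly C}) (x y : C) : peval c%:P x y = c.[x].
Proof. by rewrite !peval_slice slice_polyC hornerC. Qed.

Lemma pevalX (x y : C) : peval 'X x y = y.
Proof. by rewrite !peval_slice slice_X hornerX. Qed.

Lemma peval1 (x y : C) : peval 1 x y = 1.
Proof. by rewrite pevalC hornerC. Qed.

Lemma pevalXn P n (x y : C) : peval (P ^+ n) x y = peval P x y ^+ n.
Proof.
elim: n => [|n IH]; first by rewrite !expr0 peval1.
by rewrite !exprS pevalM IH.
Qed.

Lemma peval_bound (P : {poly {poly C}}) (r : R) : exists2 K, 0 < K &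
  forall x y, cnorm x <= r -> cnorm y <= r -> cnorm (peval P x y) <= K.
Proof.
elim/poly_ind: P => [|P c [K K0 IH]].
  by exists 1 => // x y _ _; rewrite pevalC horner0 cnorm0.
have r0 : 0 <= Num.max r 0 by rewrite le_max lexx orbT.
have [K' K'0 cK] := poly_bound c r.
exists (K * Num.max r 0 + K').
  by rewrite ltr_wpDl // mulr_ge0 // ltW.
move=> x y xr yr; rewrite pevalD pevalM pevalX pevalC.
apply: le_trans (cnormD _ _) _; rewrite lerD ?cK // cnormM.
by rewrite ler_pM ?cnorm_ge0 ?IH // le_max yr.
Qed.

Lemma peval_lip0 (P : {poly {poly C}}) : exists2 K, 0 < K & forall x y,
  cnorm x <= 1 -> cnorm y <= 1 ->
  cnorm (peval P x y - peval P 0 0) <= K * (cnorm x + cnorm y).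
Proof.
have /slice0_dvd[Q QE] : slice 0 (P - map_poly polyC (slice 0 P)) = 0.
  by rewrite rmorphB /= slice_lift subrr.
have [g gE] := poly0_decomp (slice 0 P).
have [K K0 QK] := peval_bound Q 1; have [K' K'0 gK] := poly_bound g 1.
exists (K + K'); first exact: addr_gt0.
move=> x y x1 y1.
have PE : peval P x y - peval P 0 0 = x * peval Q x y + y * g.[y].
  have -> : P = 'X%:P * Q + map_poly polyC (slice 0 P) by rewrite -QE subrK.
  rewrite !pevalD !pevalM !pevalC !hornerX mul0r add0r !peval_slice !slice_lift.
  have -> : (slice 0 P).[y] = (slice 0 P).[0] + y * g.[y].
    by rewrite {1}gE hornerD hornerC hornerM hornerX.
  by ring.
rewrite PE; apply: le_trans (cnormD _ _) _; rewrite !cnormM.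
have xQ : cnorm x * cnorm (peval Q x y) <= cnorm x * K.
  by rewrite ler_wpM2l ?cnorm_ge0 ?QK.
have yg : cnorm y * cnorm g.[y] <= cnorm y * K'.
  by rewrite ler_wpM2l ?cnorm_ge0 ?gK.
have := mulr_ge0 (cnorm_ge0 x) (ltW K'0); have := mulr_ge0 (cnorm_ge0 y) (ltW K0).
lra.
Qed.

Lemma peval_near0 (P : {poly {poly C}}) : peval P 0 0 != 0 ->
  exists d c K : R, [/\ 0 < d, 0 < c, 0 < K & forall x y, cnorm x < d ->
    cnorm y < d -> c <= cnorm (peval P x y) <= K].
Proof.
move=> P0; have [K K0 PK] := peval_lip0 P.
have n0 : 0 < cnorm (peval P 0 0) by rewrite cnorm_gt0.
set n := cnorm _ in n0.
pose d := Num.min 1 (n / (4 * K)).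
have d0 : 0 < d by rewrite lt_min ltr01 divr_gt0 // mulr_gt0.
exists d, (n / 2), (2 * n); split=> //; rewrite ?divr_gt0 ?mulr_gt0 //.
move=> x y xd yd.
have x1 : cnorm x <= 1 by apply: ltW; apply: lt_le_trans xd _; rewrite ge_min lexx.
have y1 : cnorm y <= 1 by apply: ltW; apply: lt_le_trans yd _; rewrite ge_min lexx.
have := PK x y x1 y1.
have dn : d * (4 * K) <= n by rewrite -ler_pdivlMr ?mulr_gt0 // ge_min lexx orbT.
have B : K * (cnorm x + cnorm y) <= n / 2 by nra.
have := cnormD (peval P x y - peval P 0 0) (peval P 0 0); rewrite subrK -/n.
have := cnormB (peval P 0 0) (peval P x y - peval P 0 0); rewrite [_ + (_ - _)]addrC subrK -/n.
move=> *; apply/andP; split; lra.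
Qed.

Lemma poly_near0 f : f.[0] != 0 -> exists d c K : R,
  [/\ 0 < d, 0 < c, 0 < K & forall z, cnorm z < d -> c <= cnorm f.[z] <= K].
Proof.
move=> f0; have [|d [c [K [d0 c0 K0 fP]]]] := @peval_near0 f%:P.
  by rewrite pevalC.
by exists d, c, K; split=> // z zd; have := fP z z zd zd; rewrite pevalC.
Qed.

Lemma polyX_factor f : f != 0 -> exists k u, f = 'X^k * u /\ u.[0] != 0.
Proof.
move=> f0; have [k [u /implyP/(_ f0) u0 fE]] := multiplicity_XsubC f 0.
by exists k, u; split => //; rewrite fE polyC0 subr0 mulrC.
Qed.

Lemma exp_le_exp (a b d : R) (k n : nat) : 0 < a -> 0 < b -> 0 < d ->
  (forall x, 0 < x -> x < d -> a * x ^+ k <= b * x ^+ n) -> (n <= k)%N.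
Proof.
move=> a0 b0 d0 ab; rewrite leqNgt; apply/negP => kn.
pose x := Num.min (d / 2) (Num.min (1 / 2) (a / (2 * b))).
have x0 : 0 < x by rewrite !lt_min !divr_gt0 ?mulr_gt0.
have xd : x < d.
  by apply: (@le_lt_trans _ _ (d / 2)); [rewrite ge_min lexx|lra].
have x1 : x <= 1.
  by apply: (@le_trans _ _ (1 / 2)); [rewrite !ge_min lexx orbT|lra].
have xab : x * (2 * b) <= a.
  by rewrite -ler_pdivlMr ?mulr_gt0 // !ge_min lexx !orbT.
have := ab x x0 xd; rewrite -(subnKC (ltnW kn)) exprD mulrCA [leLHS]mulrC.
rewrite ler_pM2l ?exprn_gt0 //; apply/negP; rewrite -ltNge.
have : x ^+ (n - k) <= x.
  by rewrite -subn_gt0 in kn; case: (n - k)%N kn => // j _;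
     rewrite exprS ler_piMr ?exprn_ile1 // ltW.
nra.
Qed.

(** With [f] written as [x^k] times a unit at [0], the lower bound forces [k <= n] and the upper
    bound [n <= k], both by [exp_le_exp]. *)
Lemma polyX_order f n (c K d : R) : 0 < c -> 0 < d ->
  (forall x : R, 0 < x -> x < d -> c * x ^+ n <= cnorm f.[x%:C] <= K * x ^+ n) ->
  exists2 u, f = 'X^n * u & u.[0] != 0.
Proof.
move=> c0 d0 fP.
have f0 : f != 0.
  apply/eqP => f0; have /andP[] := fP (d / 2) ltac:(lra) ltac:(lra).
  rewrite f0 horner0 cnorm0 => /le_lt_trans; move/(_ (c * (d / 2) ^+ n)).
  by rewrite ltxx mulr_gt0 ?exprn_gt0 ?divr_gt0 // => /(_ isT).
have [k [u [fE u0]]] := polyX_factor f0.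
have [d' [c' [K' [d'0 c'0 K'0 uP]]]] := poly_near0 u0.
have dd0 : 0 < Num.min d d' by rewrite lt_min d0.
have fE' (x : R) : 0 < x -> cnorm f.[x%:C] = x ^+ k * cnorm u.[x%:C].
  by move=> x0; rewrite fE hornerM hornerXn cnormM cnormX cnorm_real gtr0_norm.
have K0 : 0 < K.
  have /andP[h1 h2] := fP (d / 2) ltac:(lra) ltac:(lra).
  have dn : 0 < (d / 2) ^+ n by rewrite exprn_gt0 // divr_gt0.
  by rewrite -(pmulr_lgt0 _ dn); apply: lt_le_trans (le_trans h1 h2); rewrite mulr_gt0.
have kn : (k <= n)%N.
  apply: (@exp_le_exp c K' (Num.min d d')) => // x x0; rewrite lt_min => /andP[xd xd'].
  have /andP[+ _] := fP x x0 xd; move/le_trans; apply; rewrite fE' // mulrC.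
  have /andP[_ h] : c' <= cnorm u.[x%:C] <= K' by apply: uP; rewrite cnorm_real gtr0_norm.
  by rewrite ler_wpM2r ?exprn_ge0 // ltW.
have nk : (n <= k)%N.
  apply: (@exp_le_exp c' K (Num.min d d')) => // x x0; rewrite lt_min => /andP[xd xd'].
  have /andP[_] := fP x x0 xd; apply: le_trans; rewrite fE' // mulrC.
  have /andP[h _] : c' <= cnorm u.[x%:C] <= K' by apply: uP; rewrite cnorm_real gtr0_norm.
  by rewrite ler_wpM2l ?exprn_ge0 // ltW.
by exists u => //; rewrite fE; have /eqP -> : n == k by rewrite eqn_leq nk kn.
Qed.

(** For each root one keeps the first or the last quarter of the interval, whichever lies across the
    midpoint from [complex.Re r]; every point kept is at least a quarter of the length away from the
    root. Hence the loss of a factor [4] per root. *)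
Lemma good_interval (rs : seq C) (a l : R) : 0 < l ->
  exists a', [/\ a <= a', a' + l / 4 ^+ size rs <= a + l &
    forall s, a' <= s <= a' + l / 4 ^+ size rs ->
    forall r, r \in rs -> l / 4 ^+ size rs <= cnorm (s%:C - r)].
Proof.
elim: rs a l => [|r rs IH] a l l0.
  by exists a; split=> //; rewrite expr0 divr1.
have l40 : 0 < l / 4 by rewrite divr_gt0.
pose a1 := if complex.Re r < a + l / 2 then a + 3 * (l / 4) else a.
have [a' [aa' a'l sP]] := IH a1 (l / 4) l40.
have lE : l / 4 / 4 ^+ size rs = l / 4 ^+ (size rs).+1.
  by rewrite exprS invfM mulrA.
rewrite lE in a'l sP.
have a1a : a <= a1 /\ a1 + l / 4 <= a + l by rewrite /a1; case: ifP => _; split; lra.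
have le4 : l / 4 ^+ (size rs).+1 <= l / 4.
  by rewrite -lE ler_pdivrMr ?exprn_gt0 // ler_peMr ?exprn_ege1 ?ler1n // ltW.
exists a'; split; [lra|rewrite /=; lra|].
move=> s /andP[s1 s2] r'; rewrite inE => /predU1P[->|]; last first.
  by apply: sP; rewrite s1.
apply: le_trans (le_trans le4 _) (cnorm_ge_Re _) => {sP}.
rewrite ReB /= in s2 *; move: aa' a'l a1a; rewrite ler_normr /a1.
by case: ltP => rl *; apply/orP; [left|right]; lra.
Qed.

Lemma poly_roots_le n p : (size p <= n)%N -> exists rs : seq C,
  p = lead_coef p *: \prod_(r <- rs) ('X - r%:P) /\ (size rs <= n)%N.
Proof.
move=> pn; have [->|p0] := eqVneq p 0.
  by exists [::]; rewrite lead_coef0 scale0r.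
have [rs pE] := closed_field_poly_normal p; exists rs; split=> //.
apply: leq_trans (leq_trans _ pn) => //; rewrite pE size_scale ?lead_coef_eq0 //.
by rewrite size_prod_XsubC.
Qed.

(* The interval avoids the zeros of [p], so each factor [z - r] is bounded by a
   constant times [s - r].  This replaces both the maximum principle and the
   point evaluation estimate of the Hardy space. *)
Lemma halfplane_interval n p z : (size p <= n)%N -> complex.Im z != 0 ->
  exists a', [/\ complex.Re z <= a',
     a' + `|complex.Im z| / 4 ^+ n <= complex.Re z + `|complex.Im z| &
    forall s, a' <= s <= a' + `|complex.Im z| / 4 ^+ n ->
    cnorm p.[z] <= (1 + 2 * 4 ^+ n) ^+ n * cnorm p.[s%:C]].
Proof.
move=> pn z0; set h := `|complex.Im z|; have h0 : 0 < h by rewrite normr_gt0.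
have [rs [pE srs]] := poly_roots_le pn.
(* Padding with zeros makes the number of avoided points exactly [n], so that the length of the
   interval depends on [n] and [z] only. *)
pose rs' := rs ++ nseq (n - size rs) 0.
have srs' : size rs' = n by rewrite size_cat size_nseq subnKC.
have [a' [aa' a'h sP]] := good_interval rs' (complex.Re z) h0.
rewrite srs' in a'h sP.
exists a'; split=> // s sI; rewrite pE !hornerZ !cnormM mulrCA.
rewrite ler_wpM2l ?cnorm_ge0 // !horner_prod !cnorm_prod.
(* For a root [r] this gives [cnorm (z - r) <= 2 * h + cnorm (s%:C - r)], where [h] is at most
   [4 ^+ n] times the last term: whence [1 + 2 * 4 ^+ n]. *)
have zs : cnorm (z - s%:C) <= 2 * h.
  apply: le_trans (cnorm_le_ReIm _) _.
  rewrite ReB ImB /= subr0 -/h mulr2n mulrDl mul1r lerD2r ler_norml.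
  have : 0 < h / 4 ^+ n by rewrite divr_gt0 ?exprn_gt0.
  by move/andP: sI => [*]; apply/andP; split; lra.
have n4 : 0 < (4 : R) ^+ n by rewrite exprn_gt0.
have q1 : 1 <= 1 + 2 * (4 : R) ^+ n by rewrite lerDl mulr_ge0 // ltW.
apply: (@le_trans _ _ ((1 + 2 * 4 ^+ n) ^+ size rs *
    \prod_(i <- rs) cnorm ('X - i%:P).[s%:C])); last first.
  rewrite ler_wpM2r ?prodr_ge0 //; first by move=> i _; apply: cnorm_ge0.
  by rewrite ler_weXn2l.
have {}sP r : r \in rs -> h / 4 ^+ n <= cnorm (s%:C - r).
  by move=> rrs; apply: sP => //; rewrite mem_cat rrs.
elim: rs sP {pE srs rs' srs'} => [|r rs IH] sP.
  by rewrite !big_nil expr0 mul1r.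
rewrite !big_cons exprS mulrACA ler_pM ?cnorm_ge0 //.
- by rewrite prodr_ge0 // => i _; apply: cnorm_ge0.
- rewrite !hornerE; have := cnormD (z - s%:C) (s%:C - r); rewrite addrA subrK.
  have := sP r (mem_head _ _); rewrite ler_pdivrMr // => h1.
  by move=> /le_trans; apply; rewrite mulrDl mul1r addrC lerD2l; nra.
- by apply: IH => r' r'rs; apply: sP; rewrite inE r'rs orbT.
Qed.

End Estimates.

(** * Polynomials whose zeros lie in a half plane *)

Section HalfPlane.
Variable R : realType.
Local Notation C := R[i].
Local Open Scope complex_scope.
Implicit Types (z w : C) (f p : {poly C}) (l : seq C).

Lemma ler_prod_cst (I : Type) (r : seq I) (P : pred I) (F G : I -> R) (K : R) :
  0 <= K -> (forall i, P i -> 0 <= F i /\ F i <= K * G i) -> all P r ->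
  \prod_(i <- r) F i <= K ^+ size r * \prod_(i <- r) G i.
Proof.
move=> K0 FG; elim: r => [_|i r IH /= /andP[Pi Pr]].
  by rewrite !big_nil expr0 mul1r.
have [F0 FK] := FG i Pi.
rewrite !big_cons exprS mulrACA ler_pM ?IH //.
by elim: r Pr {IH} => [_|j r IH /= /andP[/FG[Fj _] /IH h]];
   rewrite ?big_nil // big_cons mulr_ge0.
Qed.

Lemma prod_cnorm_ge0 (I : Type) (r : seq I) (F : I -> C) :
  0 <= \prod_(i <- r) cnorm (F i).
Proof. by rewrite prodr_ge0 // => i _; apply: cnorm_ge0. Qed.

Lemma horner_prod_XsubC l z :
  (\prod_(a <- l) ('X - a%:P)).[z] = \prod_(a <- l) (z - a).
Proof. by rewrite horner_prod; apply: eq_bigr => a _; rewrite !hornerE. Qed.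

(** Descend from [z] to a real point [a] by [halfplane_interval], use the hypothesis there, and
    climb back: [a] is within twice [complex.Im z] of [z], while each [b] is at least [complex.Im z]
    away from [z], so that each factor costs at most [3]. *)
Lemma halfplane_le n p l z (K : R) : (size p <= n)%N -> 0 <= K ->
  all (fun b => complex.Im b <= 0) l -> 0 < complex.Im z ->
  (forall s : R, cnorm p.[s%:C] <= K * \prod_(b <- l) cnorm (s%:C - b)) ->
  cnorm p.[z] <= (1 + 2 * 4 ^+ n) ^+ n * K * 3 ^+ size l *
    \prod_(b <- l) cnorm (z - b).
Proof.
move=> pn K0 lP z0 pK.
have [a [za az sP]] := halfplane_interval pn (lt0r_neq0 z0).
rewrite (gtr0_norm z0) in az sP; set h := complex.Im z in z0 az sP.
have h4 : 0 < h / 4 ^+ n by rewrite divr_gt0 ?exprn_gt0.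
have aI : a <= a <= a + h / 4 ^+ n by rewrite lexx lerDl ltW.
apply: le_trans (sP a aI) _; rewrite -!mulrA ler_wpM2l //.
apply: le_trans (pK a) _; rewrite ler_wpM2l //.
apply: ler_prod_cst lP => // b b0; split; first exact: cnorm_ge0.
have hz : h <= cnorm (z - b).
  by apply: le_trans (cnorm_ge_Im _); rewrite ImB -/h ler_normr lerBrDr; apply/orP; left; lra.
have az2 : cnorm (a%:C - z) <= 2 * h.
  apply: le_trans (cnorm_le_ReIm _) _.
  rewrite ReB ImB /= sub0r normrN (gtr0_norm z0) -/h mulr2n mulrDl mul1r lerD2r.
  by rewrite ger0_norm ?subr_ge0 //; lra.
have := cnormD (a%:C - z) (z - b); rewrite addrA subrK; lra.
Qed.

(** Modulus of the resultant of the monic polynomial with zeros [l] and its conjugate. When [l] lies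
    in the lower half plane, the points [a^*%C] lie in the upper one, where [halfplane_le]
    applies. *)
Definition conj_res l : R := \prod_(a <- l) \prod_(b <- l) cnorm (a^*%C - b).

Lemma cross_res_sym l l' :
  \prod_(a <- l) \prod_(b <- l') cnorm (a^*%C - b)
  = \prod_(b <- l') \prod_(a <- l) cnorm (b^*%C - a).
Proof.
rewrite exchange_big /=; apply: eq_bigr => b _; apply: eq_bigr => a _.
by rewrite -cnorm_conj rmorphB /= conjcK cnormBC.
Qed.

(** One copy of [l] is exchanged for [l'] at a time: first in the inner product, then, after
    [cross_res_sym], in the other one. This is why the constant is squared. *)
Lemma conj_res_le l l' (K : R) : 0 <= K -> size l = size l' ->
  all (fun b => complex.Im b < 0) l -> all (fun b => complex.Im b < 0) l' ->
  (forall s : R, \prod_(a <- l) cnorm (s%:C - a) <= K * \prod_(b <- l') cnorm (s%:C - b)) ->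
  conj_res l <= (((1 + 2 * 4 ^+ (size l).+1) ^+ (size l).+1 * K * 3 ^+ size l) ^+ size l)
     ^+ 2 * conj_res l'.
Proof.
move=> K0 ll' lP l'P lK; set c := _ * _ * _.
have c0 : 0 <= c.
  by rewrite !mulr_ge0 // exprn_ge0 // addr_ge0 // mulr_ge0 // exprn_ge0.
have cmp z : complex.Im z < 0 ->
    \prod_(a <- l) cnorm (z^*%C - a) <= c * \prod_(b <- l') cnorm (z^*%C - b).
  move=> z0; have -> : \prod_(a <- l) cnorm (z^*%C - a)
      = cnorm (\prod_(a <- l) ('X - a%:P)).[z^*%C].
    by rewrite horner_prod_XsubC cnorm_prod.
  rewrite /c [X in 3 ^+ X]ll'; apply: halfplane_le => //.
  - by rewrite size_prod_XsubC.
  - by apply: sub_all l'P => b /ltW.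
  - by case: (z) z0 => a b /=; rewrite oppr_gt0.
  - by move=> s; rewrite horner_prod_XsubC cnorm_prod.
rewrite expr2 -mulrA.
have le1 : conj_res l <= c ^+ size l * \prod_(a <- l) \prod_(b <- l') cnorm (a^*%C - b).
  by apply: ler_prod_cst lP => // z z0; split; [exact: prod_cnorm_ge0|exact: cmp].
apply: le_trans le1 _; rewrite ler_wpM2l ?exprn_ge0 // cross_res_sym ll'.
by apply: ler_prod_cst l'P => // z z0; split; [exact: prod_cnorm_ge0|exact: cmp].
Qed.

(** Moving [w] straight down to the real axis does not increase its distance to any zero, since none
    lies above the axis. *)
Lemma uhp_min p w : (forall r, 0 < complex.Im r -> p.[r] != 0) ->
  0 <= complex.Im w -> cnorm p.[(complex.Re w)%:C] <= cnorm p.[w].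
Proof.
move=> pr w0; have [->|p0] := eqVneq p 0; first by rewrite !horner0.
have [rs pE] := closed_field_poly_normal p.
have rsP : all (fun r => complex.Im r <= 0) rs.
  apply/allP => r rrs; rewrite leNgt; apply/negP => /pr /negP; apply.
  by rewrite pE hornerZ mulf_eq0 -[_.[r] == 0]/(root _ _) root_prod_XsubC rrs orbT.
rewrite pE !hornerZ !cnormM ler_wpM2l ?cnorm_ge0 // !horner_prod_XsubC !cnorm_prod.
have := @ler_prod_cst _ rs _ (fun r => cnorm ((complex.Re w)%:C - r))
  (fun r => cnorm (w - r)) 1 ler01 _ rsP; rewrite expr1n mul1r; apply.
move=> r r0; split; first exact: cnorm_ge0.
rewrite mul1r ler_wsqrtr // /csq !ReB !ImB lerD2l /=; nra.
Qed.

Lemma poly_ex_real p (d : R) : 0 < d -> p != 0 ->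
  exists x : R, [/\ 0 < x, x < d & p.[x%:C] != 0].
Proof.
move=> d0 /polyX_factor[k [u [-> /poly_near0[e [c [K [e0 c0 _ uP]]]]]]].
pose x := Num.min d e / 2.
have x0 : 0 < x by rewrite divr_gt0 // lt_min d0.
have [xd xe] : x < d /\ x < e.
  have m1 : Num.min d e <= d by rewrite ge_min lexx.
  have m2 : Num.min d e <= e by rewrite ge_min lexx orbT.
  by rewrite /x in x0 *; split; lra.
exists x; split=> //; rewrite hornerM hornerXn mulf_neq0 //.
  by rewrite expf_neq0 // -cnorm_eq0 cnorm_real normr_eq0 gt_eqF.
rewrite -cnorm_gt0; apply: lt_le_trans c0 _.
have x1 : cnorm x%:C < e by rewrite cnorm_real gtr0_norm.
by have /andP[] := uP _ x1.
Qed.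

Lemma peval_hornerC (P : {poly {poly C}}) (x y : C) : peval P x y = (P.[y%:P]).[x].
Proof.
elim/poly_ind: P => [|P c IH]; first by rewrite pevalC !horner0.
by rewrite pevalD pevalM pevalX pevalC IH hornerMXaddC !hornerE.
Qed.

(* Hurwitz: since all zeros of [P(x0 + i e, y)] in [y] lie in the lower half
   plane, its value at any point is bounded by its value at [w], uniformly as
   [e] tends to [0]; a zero at [w] would make the limit vanish identically. *)
Lemma lhp_slice (P : {poly {poly C}}) (x0 : R) (w : C) :
  (forall x y : C, 0 < complex.Im x -> 0 < complex.Im y -> peval P x y != 0) ->
  slice x0%:C P != 0 -> 0 < complex.Im w -> (slice x0%:C P).[w] != 0.
Proof.
move=> noH2 Px0 w0; apply/eqP => Pw; case/eqP: (Px0).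
apply/eqP; apply: contraT => p0; have [x [_ _ /eqP]] := poly_ex_real ltr01 p0.
case; move: (x%:C) => s {p0 x}.
have lip (y : C) : exists2 K, 0 < K & forall e : R, 0 < e -> e < 1 ->
    cnorm (peval P (Complex x0 e) y - peval P x0%:C y) <= K * e.
  have [g gE] := poly0_decomp (P.[y%:P] \Po ('X + x0%:C%:P)).
  have [K K0 gK] := poly_bound g 1; exists K => // e e0 e1.
  have eC : cnorm (Complex 0 e) = e.
    by rewrite /cnorm /csq /= expr0n add0r sqrtr_sqr gtr0_norm.
  have xE : Complex x0 e = (Complex 0 e + x0%:C)%C.
    by apply/eqP; rewrite eq_complex /= add0r addr0 !eqxx.
  rewrite !peval_hornerC xE.
  have := congr1 (horner^~ (Complex 0 e)) gE; rewrite !horner_comp !hornerE => ->.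
  rewrite addrAC subrr add0r cnormM eC mulrC ler_wpM2r ?(ltW e0) //.
  by apply: gK; rewrite eC ltW.
have [K K0 sK] := lip s; have [K' K'0 wK] := lip w.
pose h := complex.Im w.
(* A zero [r] outside the upper half plane is at least [h] away from [w], so
   [cnorm (s - r) <= q * cnorm (w - r)], with [q] independent of [e]. *)
pose q := 1 + cnorm (s - w) / h.
have q1 : 1 <= q by rewrite lerDl divr_ge0 ?cnorm_ge0 // ltW.
have sw (e : R) : 0 < e -> cnorm (peval P (Complex x0 e) s)
    <= q ^+ size P * cnorm (peval P (Complex x0 e) w).
  move=> e0; rewrite !peval_slice; set p := slice _ P.
  have pn : (size p <= size P)%N by exact: size_poly.
  have [rs [pE srs]] := poly_roots_le pn.
  have p0 : lead_coef p != 0.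
    rewrite lead_coef_eq0; apply/eqP => p0.
    by have := noH2 (Complex x0 e) w e0 w0; rewrite peval_slice -/p p0 horner0 eqxx.
  have rsP : all (fun r => complex.Im r <= 0) rs.
    apply/allP => r rrs; rewrite leNgt; apply/negP => r0.
    have := noH2 (Complex x0 e) r e0 r0; rewrite peval_slice -/p pE hornerZ.
    by rewrite mulf_eq0 -[_.[r] == 0]/(root _ _) root_prod_XsubC rrs orbT.
  rewrite pE !hornerZ !cnormM mulrCA ler_wpM2l ?cnorm_ge0 //.
  rewrite !horner_prod_XsubC !cnorm_prod.
  apply: (@le_trans _ _ (q ^+ size rs * \prod_(r <- rs) cnorm (w - r))).
    apply: ler_prod_cst rsP => [|r r0]; first by apply: le_trans q1.
    split; first exact: cnorm_ge0.
    have hz : h <= cnorm (w - r).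
      by apply: le_trans (cnorm_ge_Im _); rewrite ImB -/h ler_normr; apply/orP; left; lra.
    have := cnormD (s - w) (w - r); rewrite addrA subrK => /le_trans; apply.
    rewrite mulrDl mul1r addrC lerD2l mulrAC -mulrA ler_peMr ?cnorm_ge0 //.
    by rewrite ler_pdivlMr // mul1r.
  by rewrite ler_wpM2r ?prod_cnorm_ge0 // ler_weXn2l.
apply/eqP; rewrite -peval_slice -cnorm_eq0 eq_le cnorm_ge0 andbT leNgt; apply/negP => n0.
set n := cnorm _ in n0.
pose B := K + q ^+ size P * K'.
have B0 : 0 < B by rewrite addr_gt0 // mulr_gt0 // exprn_gt0 // (lt_le_trans ltr01).
pose e := Num.min (1 / 2) (n / (2 * B)).
have e0 : 0 < e by rewrite lt_min !divr_gt0 // mulr_gt0.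
have e1 : e < 1.
  by apply: (@le_lt_trans _ _ (1 / 2)); [rewrite ge_min lexx|lra].
have eB : e * (2 * B) <= n by rewrite -ler_pdivlMr ?mulr_gt0 // ge_min lexx orbT.
have h1 := sK e e0 e1; have h2 := wK e e0 e1.
rewrite peval_slice [peval P x0%:C w]peval_slice Pw subr0 in h2.
have h3 := sw e e0.
have h4 : q ^+ size P * cnorm (peval P (Complex x0 e) w) <= q ^+ size P * (K' * e).
  by rewrite ler_wpM2l // exprn_ge0 // (le_trans _ q1).
have := cnormB (peval P x0%:C s) (peval P (Complex x0 e) s - peval P x0%:C s).
rewrite [_ + (_ - _)]addrC subrK -/n; move: h1 h3 h4 eB; rewrite /B.
by rewrite (mulrA (q ^+ _)); clear - n0; nra.
Qed.

End HalfPlane.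

(** * Comparison of the resultants *)

Section LocalFactor.
Variable R : realType.
Local Notation C := R[i].
Local Notation E := {poly {poly C}}.
Local Notation factor := ({poly R} * nat)%type.
Local Open Scope complex_scope.
Implicit Types (t : factor) (s : seq factor).

Definition broot t : {poly C} :=
  - (map_poly (fun r : R => r%:C) t.1 + 'i *: 'X^(2 * t.2)).

Definition prodB s : E := \prod_(t <- s) bkps_factor t.1 t.2.

Definition roots_at s (x : C) : seq C := [seq (broot t).[x] | t <- s].

Definition good_factor t := t.1.[0] = 0 /\ (0 < t.2)%N.

Lemma bkps_factorE t : bkps_factor t.1 t.2 = 'X - (broot t)%:P.
Proof. by rewrite /bkps_factor /broot polyCN opprK. Qed.

Lemma broot_real t (x : R) :
  (broot t).[x%:C] = Complex (- t.1.[x]) (- x ^+ (2 * t.2)).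
Proof.
rewrite /broot hornerN hornerD hornerZ hornerXn.
rewrite (horner_map (real_complex R) t.1 x) -rmorphXn /=.
by apply/eqP; rewrite eq_complex /= !(mul0r, mul1r, mulr0, subr0, addr0, add0r) !eqxx.
Qed.

Lemma evenX_ge0 (x : R) k : 0 <= x ^+ (2 * k).
Proof. by rewrite exprM exprn_ge0 ?sqr_ge0. Qed.

Lemma broot0 t : good_factor t -> (broot t).[0] = 0.
Proof.
move=> [q0 L0]; rewrite -[X in _.[X]](rmorph0 (real_complex R)) broot_real q0.
by apply/eqP; rewrite eq_complex /= expr0n muln_eq0 /= eqn0Ngt L0 /= !oppr0 eqxx.
Qed.

Lemma slice_prodB (x : C) s :
  slice x (prodB s) = \prod_(b <- roots_at s x) ('X - b%:P).
Proof.
rewrite /prodB rmorph_prod big_map; apply: eq_bigr => t _.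
by rewrite bkps_factorE rmorphB /= slice_X slice_polyC.
Qed.

Lemma prodBE s : prodB s = \prod_(b <- [seq broot t | t <- s]) ('X - b%:P).
Proof. by rewrite /prodB big_map; apply: eq_bigr => t _; rewrite bkps_factorE. Qed.

Lemma prodB_monic s : prodB s \is monic.
Proof. by rewrite prodBE monic_prod_XsubC. Qed.

Lemma size_prodB s : size (prodB s) = (size s).+1.
Proof. by rewrite prodBE size_prod_XsubC size_map. Qed.

Lemma slice0_prodB s : (forall t, t \in s -> good_factor t) ->
  slice 0 (prodB s) = 'X^(size s).
Proof.
rewrite slice_prodB big_map; elim: s => [|t s IH] sP.
  by rewrite big_nil expr0.
rewrite big_cons exprS IH; last by move=> t' t's; apply: sP; rewrite inE t's orbT.
by rewrite broot0 ?subr0 //; apply: sP; rewrite mem_head.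
Qed.

Lemma cnorm_prodB s (x y : C) :
  cnorm (peval (prodB s) x y) = \prod_(b <- roots_at s x) cnorm (y - b).
Proof. by rewrite peval_slice slice_prodB horner_prod_XsubC cnorm_prod. Qed.

(** For real [x] and [y] each factor [y - b] has imaginary part [x ^+ (2 * t.2)]. This is the
    reserve against which errors of high order in [x] are compared. *)
Lemma prodB_lower s (x y : R) :
  `|x| ^+ (\sum_(t <- s) 2 * t.2)%N <= cnorm (peval (prodB s) x%:C y%:C).
Proof.
rewrite cnorm_prodB big_map; elim: s => [|t s IH].
  by rewrite !big_nil expr0.
rewrite !big_cons exprD ler_pM ?exprn_ge0 //.
apply: le_trans (cnorm_ge_Im _); rewrite ImB broot_real /= sub0r opprK.
by rewrite normrX.
Qed.

Lemma prodB_neq0 s (x y : R) : (forall t, t \in s -> good_factor t) ->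
  (x, y) != (0, 0) -> peval (prodB s) x%:C y%:C != 0.
Proof.
move=> sP; have [->|x0] := eqVneq x 0.
  rewrite xpair_eqE eqxx /= => y0; rewrite peval_slice slice0_prodB // hornerXn.
  by rewrite expf_neq0 // -cnorm_eq0 cnorm_real normr_eq0.
move=> _; rewrite -cnorm_gt0; apply: lt_le_trans (prodB_lower _ _ _).
by rewrite exprn_gt0 // normr_gt0.
Qed.

Lemma line_poly (P : E) (a b al be : C) : exists f : {poly C},
  forall z, f.[z] = peval P (a + z * al) (b + z * be).
Proof.
elim/poly_ind: P => [|P c [f fP]].
  by exists 0 => z; rewrite pevalC !horner0.
exists (f * (b%:P + 'X * be%:P) + (c \Po (a%:P + 'X * al%:P))) => z.
by rewrite pevalD pevalM pevalX pevalC hornerD hornerM fP horner_comp !hornerE.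
Qed.

Lemma ex_real_neq0 (P : E) : P != 0 -> exists x y : R, peval P x%:C y%:C != 0.
Proof.
move=> P0; have lP : lead_coef P != 0 by rewrite lead_coef_eq0.
have [x [_ _ Px]] := poly_ex_real ltr01 lP.
have sP : slice x%:C P != 0.
  apply: contraNneq Px => sP; have /polyP/(_ (size P).-1) := sP.
  by rewrite coef_map coef0 /lead_coef => <-.
by have [y [_ _ Py]] := poly_ex_real ltr01 sP; exists x, y.
Qed.

(* Quotients by [0] being [0], [comparable_near0] does not by itself exclude
   zeros of [P]; approaching such a zero along a line does. *)
Lemma comparable_strict (P B : E) : P != 0 ->
  (forall x y : R, (x, y) != (0, 0) -> peval B x%:C y%:C != 0) ->
  comparable_near0 P B ->
  exists e K : R, [/\ 0 < e, e <= 1, 0 < K & forall x y : R, (x, y) != (0, 0) ->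
    `|x| < e -> `|y| < e ->
    cnorm (peval P x%:C y%:C) <= K * cnorm (peval B x%:C y%:C) /\
    cnorm (peval B x%:C y%:C) <= K * cnorm (peval P x%:C y%:C)].
Proof.
move=> P0 B0 [e [K [e0 PB]]].
pose K1 := Num.max K 1.
have K10 : 0 < K1 by rewrite lt_max ltr01 orbT.
have KK1 : K <= K1 by rewrite le_max lexx.
have half (x y : R) : (x, y) != (0, 0) -> `|x| < e -> `|y| < e ->
    peval P x%:C y%:C != 0 ->
    cnorm (peval B x%:C y%:C) <= K1 * cnorm (peval P x%:C y%:C).
  move=> xy xe ye Pxy; have [_] := PB x y xy xe ye.
  rewrite cnormM cnormV ler_pdivrMr ?cnorm_gt0 // => /le_trans; apply.
  by rewrite ler_wpM2r ?cnorm_ge0.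
have Pn0 (x y : R) : (x, y) != (0, 0) -> `|x| < e -> `|y| < e ->
    peval P x%:C y%:C != 0.
  move=> xy xe ye; apply/eqP => Pxy.
  have [x1 [y1 P1]] := ex_real_neq0 P0.
  have [f fE] := line_poly P x%:C y%:C (x1 - x)%:C (y1 - y)%:C.
  have [g gE] := line_poly B x%:C y%:C (x1 - x)%:C (y1 - y)%:C.
  have f0 : f != 0.
    apply: contraNneq P1 => f0; have := fE 1; rewrite f0 horner0 !mul1r.
    by rewrite -!rmorphD /= ![_ + (_ - _)]addrC !subrK => <-.
  have g0 : g.[0] != 0 by rewrite gE !mul0r !addr0 B0.
  have [d1 [c1 [k1 [d10 c10 _ gP]]]] := poly_near0 g0.
  have [k [u [fku u0]]] := polyX_factor f0.
  have [d2 [c2 [k2 [d20 c20 k20 uP]]]] := poly_near0 u0.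
  (* Along the line, [P] vanishes to order [k] at the supposed zero while [B] stays away from [0];
     as [B] is bounded by [K1] times [P] at nearby non-zeros of [P], this order must be [0]. *)
  have k0 : (k <= 0)%N.
    pose D := 1 + `|x1 - x| + `|y1 - y|.
    have D0 : 0 < D by rewrite /D -addrA ltr_pwDl // addr_ge0.
    pose d3 := Num.min (e - `|x|) (e - `|y|) / D.
    have d30 : 0 < d3 by rewrite divr_gt0 // lt_min !subr_gt0 xe.
    (* Keeps the moving point off the origin, which the comparison excludes. *)
    pose d4 := if x == 0 then `|y| / D else `|x| / D.
    have d40 : 0 < d4.
      rewrite /d4; case: eqP => x0; last by rewrite divr_gt0 ?normr_gt0 //; apply/eqP.
      by move: xy; rewrite x0 xpair_eqE eqxx /= => y0; rewrite divr_gt0 ?normr_gt0.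
    apply: (@exp_le_exp _ c1 (K1 * k2) (Num.min (Num.min d1 d2) (Num.min d3 d4))) => //.
    - by rewrite mulr_gt0.
    - by rewrite !lt_min d10 d20 d30.
    move=> t t0; rewrite !lt_min => /andP[/andP[td1 td2] /andP[td3 td4]].
    have tC : cnorm t%:C = t by rewrite cnorm_real gtr0_norm.
    pose xt := x + t * (x1 - x); pose yt := y + t * (y1 - y).
    have tD : t * D < Num.min (e - `|x|) (e - `|y|) by rewrite -ltr_pdivlMr.
    have [tx ty] : `|t * (x1 - x)| <= t * D /\ `|t * (y1 - y)| <= t * D.
      rewrite !normrM (gtr0_norm t0) !ler_pM2l // /D.
      by move: (normr_ge0 (x1 - x)) (normr_ge0 (y1 - y)); clear; split; lra.
    move: tD; rewrite lt_min => /andP[tDx tDy].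
    have xte : `|xt| < e by have := ler_normD x (t * (x1 - x)); rewrite -/xt; clear - tx tDx; lra.
    have yte : `|yt| < e by have := ler_normD y (t * (y1 - y)); rewrite -/yt; clear - ty tDy; lra.
    have xyt : (xt, yt) != (0, 0).
      apply/eqP => -[xt0 yt0]; move: td4; rewrite /d4.
      case: eqP => x0; rewrite ltr_pdivlMr //.
        have -> : `|y| = `|t * (y1 - y)|.
          by rewrite -normrN; congr `|_|; move: yt0; rewrite /yt; clear; lra.
        by rewrite ltNge ty.
      have -> : `|x| = `|t * (x1 - x)|.
        by rewrite -normrN; congr `|_|; move: xt0; rewrite /xt; clear; lra.
      by rewrite ltNge tx.
    have fxt : f.[t%:C] = peval P xt%:C yt%:C by rewrite fE -!rmorphM -!rmorphD.
    have gxt : g.[t%:C] = peval B xt%:C yt%:C by rewrite gE -!rmorphM -!rmorphD.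
    have /andP[gt _] := gP t%:C ltac:(by rewrite tC).
    have /andP[uc ut] := uP t%:C ltac:(by rewrite tC).
    have un0 := lt_le_trans c20 uc.
    rewrite expr0 mulr1; apply: le_trans gt _; rewrite gxt.
    apply: le_trans (half _ _ xyt xte yte _) _.
      by rewrite -fxt fku hornerM hornerXn mulf_neq0 ?expf_neq0 -?cnorm_gt0 // tC.
    rewrite -fxt fku hornerM hornerXn cnormM cnormX tC -mulrA ler_pM2l //.
    by rewrite mulrC ler_pM2r ?exprn_gt0.
  have := fE 0; rewrite !mul0r !addr0 Pxy fku hornerM hornerXn.
  case: k {fku} k0 => // _; rewrite expr0 mul1r => /eqP.
  by rewrite (negPf u0).
exists (Num.min e 1), K1; split=> //.
- by rewrite lt_min e0 ltr01.
- by rewrite ge_min lexx orbT.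
move=> x y xy; rewrite !lt_min => /andP[xe _] /andP[ye _]; split.
  have [+ _] := PB x y xy xe ye.
  rewrite cnormM cnormV ler_pdivrMr ?cnorm_gt0 ?B0 // => /le_trans; apply.
  by rewrite ler_wpM2r ?cnorm_ge0.
by apply: half => //; apply: Pn0.
Qed.

End LocalFactor.

Section LocalFactorisation.
Variable R : realType.
Local Notation C := R[i].
Local Notation E := {poly {poly C}}.
Local Notation factor := ({poly R} * nat)%type.
Local Open Scope complex_scope.
Implicit Types (t : factor) (s : seq factor).

Lemma peval_growth (P : E) n : (size P <= n.+1)%N -> exists2 K, 0 < K &
  forall x y : C, cnorm x <= 1 -> 1 <= cnorm y -> cnorm (peval P x y) <= K * cnorm y ^+ n.
Proof.
elim/poly_ind: P n => [|P c IH] n sP.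
  exists 1 => // x y _ y1; rewrite pevalC horner0 cnorm0 mul1r exprn_ge0 ?cnorm_ge0 //.
have [K' K'0 cK] := poly_bound c 1.
have [P0|P0] := eqVneq P 0.
  exists K' => // x y x1 y1; rewrite P0 mul0r add0r pevalC.
  apply: le_trans (cK x x1) _; rewrite ler_peMr ?exprn_ege1 // ltW //.
move: sP; rewrite size_MXaddC (negPf P0) /= ltnS => sP.
case: n sP => [|n sP]; first by rewrite leqn0 size_poly_eq0 (negPf P0).
have [K K0 PK] := IH n sP.
exists (K + K'); first exact: addr_gt0.
move=> x y x1 y1; rewrite pevalD pevalM pevalX pevalC.
apply: le_trans (cnormD _ _) _; rewrite cnormM mulrDl lerD //.
  by rewrite exprSr mulrA ler_wpM2r ?cnorm_ge0 ?PK.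
by apply: le_trans (cK x x1) _; rewrite ler_peMr ?exprn_ege1 // ltW.
Qed.

(** Continuity of the zeros at [x = 0]. Write [W] as [y^(m+1) + x H] with [H] of degree at most [m]
    in [y]: growth excludes zeros with [1 <= cnorm y] for small [x], and the equation then makes the
    remaining ones small. *)
Lemma roots_small (W : E) m : W \is monic -> size W = m.+2 ->
  slice 0 W = 'X^(m.+1) -> forall eta : R, 0 < eta -> exists2 d, 0 < d &
  forall x y : C, cnorm x < d -> peval W x y = 0 -> cnorm y < eta.
Proof.
move=> Wm sW W0 eta eta0.
have /slice0_dvd[H HE] : slice 0 (W - 'X^(m.+1)) = 0.
  by rewrite rmorphB rmorphXn /= slice_X W0 subrr.
have sH : (size H <= m.+1)%N.
  have <- : size (W - 'X^(m.+1)) = size H by rewrite HE size_Cmul ?polyX_eq0.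
  apply/leq_sizeP => j; rewrite leq_eqVlt => /predU1P[<-|mj].
    by rewrite coefB coefXn eqxx; have /monicP := Wm; rewrite /lead_coef sW /= => ->;
       rewrite subrr.
  by rewrite coefB coefXn gtn_eqF // nth_default ?subrr // sW.
have [K K0 HK] := peval_growth sH; have [K' K'0 HK'] := peval_bound H 1.
pose e := Num.min eta 1.
have e0 : 0 < e by rewrite lt_min eta0 ltr01.
exists (Num.min 1 (Num.min K^-1 (e ^+ m.+1 / K'))).
  by rewrite !lt_min ltr01 invr_gt0 K0 divr_gt0 ?exprn_gt0.
move=> x y; rewrite !lt_min => /and3P[x1 xK xK'] Wxy.
have yE : cnorm y ^+ m.+1 = cnorm x * cnorm (peval H x y).
  have : peval (W - 'X^(m.+1)) x y = x * peval H x y.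
    by rewrite HE pevalM pevalC hornerX.
  rewrite pevalB Wxy pevalXn pevalX sub0r => /(congr1 (@cnorm R)).
  by rewrite cnormN cnormX cnormM.
have y1 : cnorm y < 1.
  rewrite ltNge; apply/negP => y1.
  have yn : 0 < cnorm y ^+ m by rewrite exprn_gt0 // (lt_le_trans ltr01).
  have := HK x y (ltW x1) y1 => h.
  have : cnorm y ^+ m.+1 <= cnorm x * (K * cnorm y ^+ m).
    by rewrite yE ler_wpM2l ?cnorm_ge0.
  rewrite exprS mulrA ler_pM2r // => h2.
  have : cnorm x * K < 1 by rewrite -ltr_pdivlMr // mul1r.
  by move=> h3; have := le_lt_trans (le_trans y1 h2) h3; rewrite ltxx.
suff : cnorm y < e by rewrite lt_min => /andP[].
rewrite -(@ltr_pXn2r _ m.+1) ?nnegrE ?cnorm_ge0 ?(ltW e0) // yE.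
apply: (@le_lt_trans _ _ (cnorm x * K')).
  by rewrite ler_wpM2l ?cnorm_ge0 ?HK' // ltW.
by rewrite -ltr_pdivlMr.
Qed.

Lemma slice_pconj (W : E) (x : R) :
  slice x%:C (pconj W) = map_poly (@conjc R) (slice x%:C W).
Proof.
apply/polyP => i; rewrite !coef_map /= !horner_evalE.
by rewrite -{1}[x%:C]conjc_real horner_map.
Qed.

Lemma slice_monic (W : E) (x : C) : W \is monic -> slice x W \is monic.
Proof. by move=> Wm; apply: monic_map. Qed.

Lemma monic_roots (p : {poly C}) n : p \is monic -> size p = n.+1 ->
  exists2 l : seq C, p = \prod_(a <- l) ('X - a%:P) & size l = n.
Proof.
move=> pm sp; have [l pE] := closed_field_poly_normal p; exists l.
  by rewrite {1}pE (monicP pm) scale1r.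
by apply/eqP; rewrite -eqSS -sp pE (monicP pm) scale1r size_prod_XsubC.
Qed.

Lemma cnorm_det (W : E) m (x : R) (l : seq C) : W \is monic -> size W = m.+2 ->
  slice x%:C W = \prod_(a <- l) ('X - a%:P) ->
  cnorm (\det (horner_mx (compm m W) (pconj W))).[x%:C] = conj_res l.
Proof.
move=> Wm sW WE.
rewrite -horner_evalE -det_map_mx map_horner_mx map_compm /= slice_pconj WE.
have -> : map_poly (@conjc R) (\prod_(a <- l) ('X - a%:P))
    = \prod_(a <- [seq a^*%C | a <- l]) ('X - a%:P).
  by rewrite rmorph_prod big_map; apply: eq_bigr => a _; rewrite rmorphB /= map_polyX map_polyC.
rewrite det_horner_compm -?WE; first last.
- by rewrite size_map_poly_id0 ?sW // (monicP Wm) horner_evalE hornerC oner_neq0.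
- exact: slice_monic.
rewrite cnorm_prod big_map; apply: eq_bigr => a _.
rewrite cnormM cnormX cnormN cnorm1 expr1n mul1r WE horner_prod_XsubC.
by rewrite cnorm_prod.
Qed.

Lemma roots_at_lhp s (x : R) : x != 0 ->
  all (fun b => complex.Im b < 0) (roots_at s x%:C).
Proof.
move=> x0; rewrite all_map; apply/allP => t _ /=.
by rewrite broot_real /= oppr_lt0 exprM exprn_gt0 // exprn_even_gt0.
Qed.

(** Each [cnorm (y%:C - a)] is at most [3/2 |y|] and each [cnorm (y%:C - b)] at least [1/2 |y|];
    hence the factor [3]. *)
Lemma prod_far (l l' : seq C) (y eta : R) : size l = size l' -> 0 < eta ->
  all (fun a => cnorm a < eta / 2) l -> all (fun a => cnorm a < eta / 2) l' ->
  eta <= `|y| ->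
  \prod_(a <- l) cnorm (y%:C - a) <= 3 ^+ size l * \prod_(b <- l') cnorm (y%:C - b).
Proof.
move=> + eta0 + + ye.
elim: l l' => [|a l IH] [|b l'] //= => [_ _ _|[ll'] /andP[la ll] /andP[lb lb']].
  by rewrite !big_nil expr0 mul1r.
rewrite !big_cons exprS mulrACA ler_pM ?cnorm_ge0 ?prod_cnorm_ge0 ?IH //.
have := cnormD y%:C (- a); have := cnormB y%:C (- b).
rewrite !cnormN !cnorm_real; lra.
Qed.

(** Here [w], [u], [b], [p], [r] stand for the moduli of [W], [U], [B], [P] and of the Hensel error.
    The error is at most [b / (2 K)], hence at most half of [p], and can be absorbed. *)
Lemma compare_factors (w u b p r K cU KU : R) :
  0 < K -> 0 < cU -> 0 <= w -> 0 <= b -> 0 <= r ->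
  w * u - r <= p -> p <= w * u + r -> cU <= u -> u <= KU -> r * (2 * K) <= b ->
  p <= K * b -> b <= K * p ->
  w <= (K + K^-1) / cU * b /\ b <= 2 * K * KU * w.
Proof.
move=> K0 cU0 w0 b0 r0 wup pwu cu uk rb pb bp.
have wu1 : w * cU <= w * u by rewrite ler_wpM2l.
have wu2 : w * u <= w * KU by rewrite ler_wpM2l.
have rb2 : r <= K^-1 * b by rewrite ler_pdivlMl // mulrC; apply: le_trans rb; nra.
split; first by rewrite mulrAC ler_pdivlMr // mulrDl; lra.
have : K * p <= K * (w * KU + r) by rewrite ler_pM2l //; lra.
nra.
Qed.

Lemma local_factor (P : E) s m n (c K d : R) :
  (forall t, t \in s -> good_factor t) -> size s = m.+1 -> P != 0 ->
  (forall x y : C, 0 < complex.Im x -> 0 < complex.Im y -> peval P x y != 0) ->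
  comparable_near0 P (prodB s) -> 0 < c -> 0 < d ->
  (forall x : R, 0 < x -> x < d ->
    c * x ^+ n <= conj_res (roots_at s x%:C) <= K * x ^+ n) ->
  exists W U E0 : E, exists u0 : {poly C}, exists T : nat,
  [/\ W \is monic, size W = m.+2, slice 0 W = 'X^(m.+1), peval U 0 0 != 0 &
     P = W * U + ('X^((n + T).+1))%:P * E0] /\
  (u0.[0] != 0 /\ \det (horner_mx (compm m W) (pconj W)) = 'X^n * u0).
Proof.
move=> sP ss P0 noH2 PB c0 d0 resP.
set ka := (\sum_(t <- s) 2 * t.2)%N.
have Bn0 x y : (x, y) != (0, 0) -> peval (prodB s) x%:C y%:C != 0 by exact: prodB_neq0.
have [e [K1 [e0 e1 K10 PBs]]] := comparable_strict P0 Bn0 PB.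
have [v P0E v0] : exists2 v, slice 0 P = 'X^(m.+1) * v & v.[0] != 0.
  apply: (@polyX_order _ _ _ K1^-1 K1 e); rewrite ?invr_gt0 // => y y0 ye.
  have [] := PBs 0 y; rewrite ?xpair_eqE ?eqxx ?gt_eqF ?normr0 ?gtr0_norm //.
  have -> : cnorm (peval (prodB s) 0%:C y%:C) = y ^+ m.+1.
    by rewrite peval_slice slice0_prodB // ss hornerXn cnormX cnorm_real gtr0_norm.
  rewrite peval_slice => -> h; rewrite andbT mulrC ler_pdivrMr // mulrC.
  exact: h.
(* The exponent has two tasks: [ka] makes the error small against [prodB_lower], and [n] puts it
   into the ideal of [W] and its conjugate, which will contain [x^n]. *)
have [W [U [E0 [Wm sW W0 U0 PE]]]] := hensel_factor P0E v0 (n + ka)%N.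
have U00 : peval U 0 0 != 0 by rewrite peval_slice U0.
have [dU [cU [KU [dU0 cU0 KU0 UP]]]] := peval_near0 U00.
have [KE KE0 EP] := peval_bound E0 1.
have [e2 [e20 e2e e2U]] : exists e2, [/\ 0 < e2, e2 <= e & e2 <= dU].
  by exists (Num.min e dU); rewrite lt_min e0 dU0 !ge_min !lexx orbT.
have e22 : 0 < e2 / 2 by rewrite divr_gt0.
have [dW dW0 WP] := roots_small Wm sW W0 e22.
have sB : size (prodB s) = m.+2 by rewrite size_prodB ss.
have B0 : slice 0 (prodB s) = 'X^(m.+1) by rewrite slice0_prodB ?ss.
have [dB dB0 BP] := roots_small (prodB_monic s) sB B0 e22.
pose del := Num.min e2 (Num.min d (Num.min dW (Num.min dB (2 * K1 * KE)^-1))).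
have delP x : x < del -> [/\ x < e2, x < d, x < dW, x < dB & x < (2 * K1 * KE)^-1].
  by rewrite !lt_min => /and5P[].
have del0 : 0 < del.
  by rewrite !lt_min e20 d0 dW0 dB0 invr_gt0 !mulr_gt0.
pose K2 := (K1 + K1^-1) / cU + 2 * K1 * KU + 3 ^+ m.+1.
have K20 : 0 < K2.
  by rewrite !addr_gt0 ?divr_gt0 ?addr_gt0 ?mulr_gt0 ?invr_gt0 ?exprn_gt0.
have err (x : R) (y : C) : 0 < x -> x < del -> cnorm y <= 1 ->
    cnorm (peval (('X^((n + ka).+1))%:P * E0) x%:C y) <= x ^+ ka / (2 * K1).
  move=> x0 /delP[xe _ _ _ xK] y1.
  have x1 : x <= 1 := ltW (lt_le_trans xe (le_trans e2e e1)).
  have xC : cnorm x%:C = x by rewrite cnorm_real gtr0_norm.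
  rewrite pevalM pevalC hornerXn cnormM cnormX xC.
  apply: (@le_trans _ _ (x ^+ ka * x * KE)).
    rewrite ler_pM ?exprn_ge0 ?cnorm_ge0 ?EP ?xC ?(ltW x0) // -exprSr.
    by rewrite -addnS addnC ler_wiXn2l ?(ltW x0) // leq_addr.
  rewrite -mulrA ler_pM2l ?exprn_gt0 // ltW // -ltr_pdivlMr // -invfM.
  exact: xK.
have Wnear (x y : R) : 0 < x -> x < del -> `|y| < e2 ->
    cnorm (peval W x%:C y%:C) <= K2 * cnorm (peval (prodB s) x%:C y%:C) /\
    cnorm (peval (prodB s) x%:C y%:C) <= K2 * cnorm (peval W x%:C y%:C).
  move=> x0 xd ye; have [xe _ _ _ _] := delP x xd.
  have xn0 : (x, y) != (0, 0) by rewrite xpair_eqE (gt_eqF x0).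
  have xC : cnorm x%:C = x by rewrite cnorm_real gtr0_norm.
  have yC : cnorm y%:C = `|y| by rewrite cnorm_real.
  have xe' : `|x| < e by rewrite gtr0_norm // (lt_le_trans xe).
  have [] := PBs x y xn0 xe' (lt_le_trans ye e2e).
  have := err x y%:C x0 xd; rewrite yC => /(_ (ltW (lt_le_trans ye (le_trans e2e e1)))).
  have := prodB_lower s x y; rewrite -/ka gtr0_norm //.
  have /andP[] := UP x%:C y%:C ltac:(by rewrite xC (lt_le_trans xe))
    ltac:(by rewrite yC (lt_le_trans ye)).
  have := cnormD (peval W x%:C y%:C * peval U x%:C y%:C)
    (peval (('X^((n + ka).+1))%:P * E0) x%:C y%:C).
  have := cnormB (peval W x%:C y%:C * peval U x%:C y%:C)
    (peval (('X^((n + ka).+1))%:P * E0) x%:C y%:C).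
  rewrite -pevalM -pevalD -PE pevalM cnormM.
  have := cnorm_ge0 (peval W x%:C y%:C).
  set w := cnorm (peval W _ _); set u := cnorm (peval U _ _).
  set b := cnorm (peval (prodB s) _ _); set p := cnorm (peval P _ _).
  set r := cnorm (peval _ _ _) => w0 h1 h2 h3 h4 h5 h6 h7 h8.
  have b0 : 0 <= b by apply: cnorm_ge0.
  have rb : r * (2 * K1) <= b by apply: le_trans h5; rewrite -ler_pdivlMr ?mulr_gt0.
  have r0 : 0 <= r by apply: cnorm_ge0.
  have [wb bw] := compare_factors K10 cU0 w0 b0 r0 h1 h2 h3 h4 rb h7 h8.
  split; [apply: le_trans wb _|apply: le_trans bw _]; rewrite ler_wpM2r //.
    by rewrite /K2 -addrA lerDl ltW // addr_gt0 ?mulr_gt0 ?exprn_gt0.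
  by rewrite /K2 addrAC lerDr ltW // addr_gt0 ?divr_gt0 ?addr_gt0 ?invr_gt0 ?exprn_gt0.
(* The half-plane comparison needs all real [y]: near the origin it comes from [P], and far away
   from the smallness of all zeros. *)
have Wreal (x : R) (l : seq C) : 0 < x -> x < del ->
    slice x%:C W = \prod_(a <- l) ('X - a%:P) -> size l = m.+1 -> forall y : R,
    \prod_(a <- l) cnorm (y%:C - a) <= K2 * \prod_(b <- roots_at s x%:C) cnorm (y%:C - b) /\
    \prod_(b <- roots_at s x%:C) cnorm (y%:C - b) <= K2 * \prod_(a <- l) cnorm (y%:C - a).
  move=> x0 xd lE sl y; have [ye|ye] := ltP `|y| e2.
    have [] := Wnear x y x0 xd ye; rewrite cnorm_prodB.
    by rewrite peval_slice lE horner_prod_XsubC cnorm_prod.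
  have [xe _ xW xB _] := delP x xd.
  have xC : cnorm x%:C = x by rewrite cnorm_real gtr0_norm.
  have lsm : all (fun a => cnorm a < e2 / 2) l.
    apply/allP => a al; apply: (WP x%:C); rewrite ?xC // peval_slice lE.
    by apply/eqP; rewrite -[_ == 0]/(root _ _) root_prod_XsubC.
  have bsm : all (fun a => cnorm a < e2 / 2) (roots_at s x%:C).
    apply/allP => a al; apply: (BP x%:C); rewrite ?xC // peval_slice slice_prodB.
    by apply/eqP; rewrite -[_ == 0]/(root _ _) root_prod_XsubC.
  have sr : size (roots_at s x%:C) = m.+1 by rewrite size_map ss.
  have K23 : 3 ^+ m.+1 <= K2.
    by rewrite lerDr ltW // !addr_gt0 ?divr_gt0 ?addr_gt0 ?mulr_gt0 ?invr_gt0.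
  split.
    apply: le_trans (prod_far _ e20 lsm bsm ye) _; rewrite ?sl ?sr //.
    by rewrite ler_wpM2r ?prod_cnorm_ge0.
  apply: le_trans (prod_far _ e20 bsm lsm ye) _; rewrite ?sl ?sr //.
  by rewrite ler_wpM2r ?prod_cnorm_ge0.
(* Zeros of [W] need not be zeros of [P]. At a zero [a] of [W] with non-negative imaginary part, [P]
   reduces to the Hensel error; but by [uhp_min] its modulus there is at least that at
   [complex.Re a], hence at least [x ^+ ka / K1], which is twice the bound on the error. *)
have Wlhp (x : R) (l : seq C) : 0 < x -> x < del ->
    slice x%:C W = \prod_(a <- l) ('X - a%:P) ->
    all (fun a => complex.Im a < 0) l.
  move=> x0 xd lE; apply/allP => a al; rewrite ltNge; apply/negP => a0.
  have [xe _ xW _ _] := delP x xd.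
  have xC : cnorm x%:C = x by rewrite cnorm_real gtr0_norm.
  have Wa : peval W x%:C a = 0.
    by rewrite peval_slice lE; apply/eqP; rewrite -[_ == 0]/(root _ _) root_prod_XsubC.
  have ae : cnorm a < e2 / 2 by apply: (WP x%:C); rewrite ?xC.
  have Pre (y : R) : `|y| < e2 ->
      x ^+ ka <= K1 * cnorm (peval P x%:C y%:C).
    move=> ye; have xn0 : (x, y) != (0, 0) by rewrite xpair_eqE (gt_eqF x0).
    have [_] := PBs x y xn0 ltac:(by rewrite gtr0_norm ?(lt_le_trans xe))
      ltac:(by rewrite (lt_le_trans ye)).
    by apply: le_trans; have := prodB_lower s x y; rewrite -/ka gtr0_norm.
  have xk0 : 0 < x ^+ ka by rewrite exprn_gt0.
  have Px0 : slice x%:C P != 0.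
    apply/eqP => Px0; have := Pre 0; rewrite normr0 => /(_ e20).
    by rewrite peval_slice Px0 horner0 cnorm0 mulr0 leNgt xk0.
  have := uhp_min (fun r r0 => lhp_slice noH2 Px0 r0) a0.
  have ae2 : cnorm a < e2 by move: ae; clear - e20; lra.
  have := Pre (complex.Re a) (le_lt_trans (cnorm_ge_Re a) ae2).
  have := err x a x0 xd (ltW (lt_le_trans ae2 (le_trans e2e e1))).
  have -> : peval (('X^((n + ka).+1))%:P * E0) x%:C a = peval P x%:C a.
    by rewrite PE [RHS]pevalD [X in _ = X + _]pevalM Wa mul0r add0r.
  rewrite !peval_slice ler_pdivlMr ?mulr_gt0 //.
  set p1 := cnorm _; set p2 := cnorm _ => h1 h2 h3.
  have : K1 * p2 <= K1 * p1 by rewrite ler_pM2l.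
  by clear - h1 h2 xk0; lra.
pose cM := (((1 + 2 * 4 ^+ m.+2) ^+ m.+2 * K2 * 3 ^+ m.+1) ^+ m.+1) ^+ 2 : R.
have cM0 : 0 < cM.
  have q0 : 0 < 1 + 2 * (4 : R) ^+ m.+2 by rewrite addr_gt0 // mulr_gt0 // exprn_gt0.
  apply: exprn_gt0; apply: exprn_gt0; apply: mulr_gt0; last exact: exprn_gt0.
  by apply: mulr_gt0 => //; apply: exprn_gt0.
have [u0 uE u00] : exists2 u0, \det (horner_mx (compm m W) (pconj W)) = 'X^n * u0
    & u0.[0] != 0.
  apply: (@polyX_order _ _ _ (c / cM) (cM * K) del); rewrite ?divr_gt0 // => x x0 xd.
  have sWx : size (slice x%:C W) = m.+2.
    by rewrite size_map_poly_id0 ?sW // (monicP Wm) horner_evalE hornerC oner_neq0.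
  have [l lE sl] := monic_roots (slice_monic x%:C Wm) sWx.
  have sr : size (roots_at s x%:C) = m.+1 by rewrite size_map ss.
  rewrite (cnorm_det Wm sW lE).
  have [_ xd' _ _ _] := delP x xd.
  have /andP[r1 r2] := resP x x0 xd'.
  have rl := roots_at_lhp s (lt0r_neq0 x0).
  have ll := Wlhp x l x0 xd lE.
  have h1 := @conj_res_le _ l (roots_at s x%:C) K2 (ltW K20) _ ll rl
    (fun y => (Wreal x l x0 xd lE sl y).1).
  have h2 := @conj_res_le _ (roots_at s x%:C) l K2 (ltW K20) _ rl ll
    (fun y => (Wreal x l x0 xd lE sl y).2).
  rewrite sl sr in h1 h2; apply/andP; split.
    rewrite mulrAC ler_pdivrMr // mulrC [leRHS]mulrC; apply: le_trans (h2 erefl).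
    by rewrite mulrC.
  apply: le_trans (h1 erefl) _.
  by rewrite -/cM -[leRHS]mulrA ler_pM2l.
by exists W, U, E0, u0, ka.
Qed.

End LocalFactorisation.

Local Open Scope classical_set_scope.

(** * Local square integrability *)

Section L2loc.
Variable R : realType.
Local Notation C := R[i].
Local Notation E := {poly {poly C}}.
Local Notation mu := (@lebesgue_measure R).
Local Open Scope complex_scope.

Local Notation oo_itv a b := [set` Interval (BRight a) (BLeft b)].
Local Notation cc_itv a b := [set` Interval (BLeft a) (BRight b)].

Definition quo (p F : E) (z : R * R) : R :=
  csq (peval p z.1%:C z.2%:C / peval F z.1%:C z.2%:C).

Definition Lloc (F p : E) : Prop := exists2 e : R, 0 < e &
  (@leb2 R).-integrable (square e) (fun z => (quo p F z)%:E).

Lemma csq_ge0 (z : C) : 0 <= csq z.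
Proof. by rewrite csqE sqr_ge0. Qed.

Lemma csqM (z w : C) : csq (z * w) = csq z * csq w.
Proof. by rewrite !csqE cnormM exprMn. Qed.

Lemma csqV (z : C) : csq z^-1 = (csq z)^-1.
Proof. by rewrite !csqE cnormV exprVn. Qed.

Lemma csqD (z w : C) : csq (z + w) <= 2 * csq z + 2 * csq w.
Proof.
rewrite !csqE; have := cnormD z w; have := cnorm_ge0 (z + w).
have := cnorm_ge0 z; have := cnorm_ge0 w.
set a := cnorm _; set b := cnorm _; set c := cnorm _ => a0 b0 c0 cab.
have : c ^+ 2 <= (b + a) ^+ 2 by rewrite ler_pXn2r ?nnegrE ?addr_ge0.
have := sqr_ge0 (a - b); rewrite !expr2; nra.
Qed.

Lemma quo_ge0 p F z : 0 <= quo p F z.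
Proof. exact: csq_ge0. Qed.

Lemma quoE p F z : quo p F z =
  csq (peval p z.1%:C z.2%:C) * (csq (peval F z.1%:C z.2%:C))^-1.
Proof. by rewrite /quo csqM csqV. Qed.

Lemma ReD (z w : C) : complex.Re (z + w) = complex.Re z + complex.Re w.
Proof. by case: z; case: w. Qed.
Lemma ImD (z w : C) : complex.Im (z + w) = complex.Im z + complex.Im w.
Proof. by case: z; case: w. Qed.
Lemma ReM (z w : C) :
  complex.Re (z * w) = complex.Re z * complex.Re w - complex.Im z * complex.Im w.
Proof. by case: z; case: w. Qed.
Lemma ImM (z w : C) :
  complex.Im (z * w) = complex.Re z * complex.Im w + complex.Im z * complex.Re w.
Proof. by case: z; case: w. Qed.

Lemma measurable_horner (c : {poly C}) :
  measurable_fun [set: R * R] (fun z => complex.Re c.[z.1%:C]) /\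
  measurable_fun [set: R * R] (fun z => complex.Im c.[z.1%:C]).
Proof.
elim/poly_ind: c => [|c a [mr mi]].
  by split; under eq_fun do rewrite horner0; exact: measurable_cst.
split; under eq_fun do rewrite hornerMXaddC ?ReD ?ImD ?ReM ?ImM /= mulr0 ?subr0 ?add0r.
  by apply: measurable_funD => //; apply: measurable_funM => //; apply: measurable_fst.
by apply: measurable_funD => //; apply: measurable_funM => //; apply: measurable_fst.
Qed.

Lemma measurable_peval (p : E) :
  measurable_fun [set: R * R] (fun z => complex.Re (peval p z.1%:C z.2%:C)) /\
  measurable_fun [set: R * R] (fun z => complex.Im (peval p z.1%:C z.2%:C)).
Proof.
elim/poly_ind: p => [|p c [mr mi]].
  by split; under eq_fun do rewrite pevalC horner0; exact: measurable_cst.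
have [cr ci] := measurable_horner c.
split; under eq_fun do rewrite pevalD pevalM pevalX pevalC ?ReD ?ImD ?ReM ?ImM /= mulr0
  ?subr0 ?add0r.
  by apply: measurable_funD => //; apply: measurable_funM => //; apply: measurable_snd.
by apply: measurable_funD => //; apply: measurable_funM => //; apply: measurable_snd.
Qed.

Lemma measurable_quo p F : measurable_fun [set: R * R] (quo p F).
Proof.
have mc (q : E) : measurable_fun [set: R * R] (fun z => csq (peval q z.1%:C z.2%:C)).
  by have [mr mi] := measurable_peval q; apply: measurable_funD; apply: measurable_funX.
rewrite (_ : quo p F = fun z => csq (peval p z.1%:C z.2%:C)
    * (csq (peval F z.1%:C z.2%:C)) `^ (-1)); last first.
  by apply/funext => z; rewrite quoE powR_inv1 ?csq_ge0.
apply: measurable_funM => //.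
exact: (@measurableT_comp _ _ _ _ _ _ (@powR R ^~ (-1))).
Qed.

Lemma squareE (e : R) : square e = `]-e, e[ `*` `]-e, e[.
Proof.
by apply/seteqP; split=> z /=; rewrite !in_itv /= -!ltr_norml.
Qed.

Lemma measurable_square (e : R) : measurable (square e).
Proof. by rewrite squareE; apply: measurableX; exact: measurable_itv. Qed.

Lemma leb2_square (e : R) : (@leb2 R (square e) < +oo)%E.
Proof.
rewrite squareE /leb2 product_measure1E; try exact: measurable_itv.
have := lebesgue_measure_itv (`](- e), e[%R : interval R) => /= ->; case: ifP => _; last by rewrite mul0e.
by rewrite -EFinB -EFinM ltry.
Qed.

Lemma square_sub (e e' : R) : e <= e' -> square e `<=` square e'.
Proof. by move=> ee' z [z1 z2]; split; apply: lt_le_trans ee'. Qed.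

Lemma integrable_dominated (D : set (R * R)) (f g : R * R -> R) (a b : R) :
  measurable D -> (@leb2 R D < +oo)%E -> measurable_fun setT f ->
  (forall z, D z -> 0 <= f z <= a * g z + b) ->
  (@leb2 R).-integrable D (fun z => (g z)%:E) ->
  (@leb2 R).-integrable D (fun z => (f z)%:E).
Proof.
move=> mD Doo mf fg ig.
have ic : (@leb2 R).-integrable D (fun z => (a * g z + b)%:E).
  have -> : (fun z => (a * g z + b)%:E)
      = ((fun z => a%:E * (g z)%:E) \+ (fun=> b%:E))%E.
    by apply/funext => z /=; rewrite EFinD EFinM.
  apply: integrableD => //; first exact: integrableZl.
  apply/integrableP; split; first exact: measurable_cst.
  rewrite [X in (X < _)%E](_ : _ = (`|b%:E| * leb2 D)%E); last exact: integral_cst.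
  by rewrite lte_mul_pinfty.
apply: le_integrable ic => //.
  by apply/measurable_EFinP; apply: measurable_funTS.
move=> z /fg /andP[f0 fgz]; rewrite !gee0_abs ?lee_fin //.
exact: le_trans fgz.
Qed.

Lemma Lloc_dominated (F1 p1 F2 p2 G q : E) (e a b : R) : 0 < e ->
  Lloc F1 p1 -> Lloc F2 p2 ->
  (forall z, square e z -> quo q G z <= a * (quo p1 F1 z + quo p2 F2 z) + b) ->
  Lloc G q.
Proof.
move=> e0 [e1 e10 i1] [e2 e20 i2] H.
have [e' [e'0 ee e'1 e'2]] : exists e', [/\ 0 < e', e' <= e, e' <= e1 & e' <= e2].
  exists (Num.min e (Num.min e1 e2)).
  by rewrite !lt_min e0 e10 e20 !ge_min !lexx !orbT.
exists e' => //.
apply: (@integrable_dominated _ _ (fun z => quo p1 F1 z + quo p2 F2 z) a b).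
- exact: measurable_square.
- exact: leb2_square.
- exact: measurable_quo.
- by move=> z zs; rewrite quo_ge0 H //; apply: square_sub zs.
have -> : (fun z => (quo p1 F1 z + quo p2 F2 z)%:E)
    = ((fun z => (quo p1 F1 z)%:E) \+ (fun z => (quo p2 F2 z)%:E))%E by [].
by apply: integrableD; [exact: measurable_square|apply: integrableS i1|apply: integrableS i2];
   try exact: measurable_square; apply: square_sub.
Qed.

Lemma tonelli_square (e : R) (f : R * R -> R) : measurable_fun setT f ->
  (forall z, 0 <= f z) ->
  (\int[@leb2 R]_(z in square e) (f z)%:E =
   \int[mu]_(x in oo_itv (- e)%R e) \int[mu]_(y in oo_itv (- e)%R e) (f (x, y))%:E)%E.
Proof.
move=> mf f0; rewrite integral_mkcond fubini_tonelli1; last 2 first.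
- apply/(measurable_restrictT _ (measurable_square e)).
  by apply/measurable_EFinP; apply: measurable_funTS.
- by move=> z; apply: erestrict_ge0 => w _; rewrite lee_fin.
rewrite [RHS]integral_mkcond; apply: eq_integral => x _.
rewrite /fubini_F [RHS]patchE; case: ifPn => xe.
  rewrite [RHS]integral_mkcond; apply: eq_integral => y _.
  rewrite !patchE squareE; congr (if _ then _ else _).
  by rewrite in_setX xe.
rewrite integral0_eq // => y _; rewrite patchE squareE.
by rewrite in_setX (negPf xe).
Qed.

Lemma integral_cst_itv (b0 b1 : bool) (a b c : R) : a < b ->
  (\int[mu]_(x in [set` Interval (BSide b0 a) (BSide b1 b)]) cst c%:E x
   = (c * (b - a))%:E)%E.
Proof.
move=> ab; rewrite integral_cst //.
have := lebesgue_measure_itv (Interval (BSide b0 a) (BSide b1 b)) => /= ->.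
by rewrite lte_fin ab -EFinB -EFinM.
Qed.

Lemma measurable_inner (e : R) (f : R * R -> R) : measurable_fun setT f ->
  (forall z, 0 <= f z) ->
  measurable_fun setT (fun x => \int[mu]_(y in oo_itv (- e)%R e) (f (x, y))%:E)%E.
Proof.
move=> mf f0.
pose g := (fun z => (f z)%:E) \_ ([set: R] `*` oo_itv (- e) e).
have mD : measurable ([set: R] `*` oo_itv (- e) e).
  by apply: measurableX => //; exact: measurable_itv.
have mg : measurable_fun setT g.
  apply/(measurable_restrictT _ mD).
  by apply/measurable_EFinP; apply: measurable_funTS.
have g0 z : (0 <= g z)%E by apply: erestrict_ge0 => w _; rewrite lee_fin.
have := @measurable_fun_fubini_tonelli_F _ _ _ _ _ mu g mg g0.
rewrite (_ : fubini_F _ _ = fun x =>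
  (\int[mu]_(y in oo_itv (- e)%R e) (f (x, y))%:E)%E) //.
apply/funext => x; rewrite /fubini_F [RHS]integral_mkcond.
by apply: eq_integral => y _; rewrite /g !patchE in_setX in_setT.
Qed.

(** For small [x] the inner integral is at least [ka * eta / x ^+ 2]. On [(0, eps)] this is at least
    the constant [ka * eta / eps ^+ 2], so the double integral is at least [ka * eta / eps] for
    every small [eps]. *)
Lemma not_integrable (e d ka eta : R) (f : R * R -> R) (l : nat) :
  measurable_fun setT f -> (forall z, 0 <= f z) -> 0 < d -> d <= e ->
  0 < ka -> 0 < eta ->
  (forall x, 0 < x -> x < d -> exists a, [/\ - e < a, a + eta * x ^+ l < e &
     forall y, a <= y <= a + eta * x ^+ l -> ka <= f (x, y) * (x ^+ l * x ^+ 2)]) ->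
  ~ (@leb2 R).-integrable (square e) (fun z => (f z)%:E).
Proof.
move=> mf f0 d0 de ka0 eta0 fP /integrableP[_].
under eq_integral do rewrite gee0_abs ?lee_fin //.
rewrite tonelli_square // => Ioo.
have mF : measurable_fun setT (fun x => \int[mu]_(y in oo_itv (- e)%R e) (f (x, y))%:E)%E.
  exact: measurable_inner.
have F0 x : (0 <= \int[mu]_(y in oo_itv (- e)%R e) (f (x, y))%:E)%E.
  by apply: integral_ge0 => y _; rewrite lee_fin.
have inner x eps : 0 < x -> x < eps -> eps <= d ->
    ((ka * eta / eps ^+ 2)%:E <= \int[mu]_(y in oo_itv (- e)%R e) (f (x, y))%:E)%E.
  move=> x0 xe ed; have [a [ae aw yP]] := fP x x0 (lt_le_trans xe ed).
  have w0 : 0 < eta * x ^+ l by rewrite mulr_gt0 ?exprn_gt0.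
  have x2 : 0 < x ^+ l * x ^+ 2 by rewrite mulr_gt0 ?exprn_gt0.
  have sub : cc_itv a (a + eta * x ^+ l) `<=` oo_itv (- e) e.
    by move=> y /=; rewrite !in_itv /= => /andP[y1 y2]; apply/andP; split; lra.
  have mfx : measurable_fun setT (fun y => (f (x, y))%:E).
    by apply/measurable_EFinP; exact: measurable_fun_pair2.
  apply: (@le_trans _ _ (\int[mu]_(y in cc_itv a (a + eta * x ^+ l)%R) (f (x, y))%:E)%E); last first.
    apply: ge0_subset_integral => //; first exact: measurable_funTS.
    by move=> y _; rewrite lee_fin.
  apply: (@le_trans _ _ (\int[mu]_(y in cc_itv a (a + eta * x ^+ l)%R)
      cst (ka / (x ^+ l * x ^+ 2))%:E y)%E).
    rewrite integral_cst_itv ?ltrDl // lee_fin addrAC subrr add0r.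
    have -> : ka / (x ^+ l * x ^+ 2) * (eta * x ^+ l) = ka * eta / x ^+ 2.
      by field; rewrite !expf_neq0 // gt_eqF.
    rewrite ler_pM2l ?mulr_gt0 // lef_pV2 ?posrE ?exprn_gt0 //; last exact: lt_trans xe.
    by rewrite ler_pXn2r ?nnegrE ?ltW // (lt_trans x0).
  apply: ge0_le_integral => //.
  - by move=> y _; rewrite lee_fin divr_ge0 // ltW.
  - exact: measurable_funTS.
  - move=> y /=; rewrite in_itv /= lee_fin => /yP h.
    by rewrite ler_pdivrMr.
have outer eps : 0 < eps -> eps <= d -> ((ka * eta / eps)%:E <=
    \int[mu]_(x in oo_itv (- e)%R e) \int[mu]_(y in oo_itv (- e)%R e) (f (x, y))%:E)%E.
  move=> eps0 ed.
  apply: (@le_trans _ _ (\int[mu]_(x in oo_itv 0%R eps)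
    \int[mu]_(y in oo_itv (- e)%R e) (f (x, y))%:E)%E); last first.
    apply: ge0_subset_integral => //; first exact: measurable_funTS.
    by move=> y /=; rewrite !in_itv /= => /andP[y1 y2]; apply/andP; split; lra.
  apply: (@le_trans _ _ (\int[mu]_(x in oo_itv 0%R eps)
      cst (ka * eta / eps ^+ 2)%:E x)%E).
    rewrite integral_cst_itv //.
    by rewrite lee_fin subr0 expr2 invfM mulrA mulfVK ?gt_eqF.
  apply: ge0_le_integral => //.
  - by move=> y _; rewrite lee_fin divr_ge0 ?exprn_ge0 ?ltW // mulr_gt0.
  - exact: measurable_funTS.
  - by move=> x /=; rewrite in_itv /= => /andP[x0 xe]; apply: inner.
move: Ioo outer; set I := (\int[_]_(_ in _) _)%E.
have I0 : (0 <= I)%E by apply: integral_ge0 => x _; exact: F0.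
case: I I0 => [r| |] //; rewrite lee_fin => r0 _ outer.
pose eps := Num.min d (ka * eta / (r + 1)).
have r1 : 0 < r + 1 by lra.
have eps0 : 0 < eps by rewrite lt_min d0 divr_gt0 // mulr_gt0.
have := outer eps eps0; rewrite ge_min lexx => /(_ isT).
rewrite lee_fin ler_pdivrMr //.
have : eps * (r + 1) <= ka * eta by rewrite -ler_pdivlMr // ge_min lexx orbT.
nra.
Qed.

End L2loc.

Section Poisson.
Variable R : realType.
Local Notation mu := (@lebesgue_measure R).

(** The integrand is a Poisson kernel, with primitive [atan ((y - c) / h)]. What matters is that the
    bound depends on neither [c] nor [h], both of which will vary with [x]. *)
Lemma poisson_le (c h e : R) : 0 < h -> 0 < e ->
  (\int[mu]_(y in [set` Interval (BRight (- e)%R) (BLeft e)])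
     (h / ((y - c) ^+ 2 + h ^+ 2))%:E <= pi%:E)%E.
Proof.
move=> h0 e0.
pose f (y : R) := h / ((y - c) ^+ 2 + h ^+ 2).
have den0 y : 0 < (y - c) ^+ 2 + h ^+ 2.
  by rewrite ltr_wpDl ?sqr_ge0 // exprn_gt0.
have f0 y : 0 <= f y by rewrite divr_ge0 // ltW.
have cf : continuous f.
  move=> y; apply: (@continuousM _ _ (cst h) (fun y => ((y - c) ^+ 2 + h ^+ 2)^-1)).
    exact: cst_continuous.
  apply: (@continuousV _ _ (fun y => (y - c) ^+ 2 + h ^+ 2)).
    by rewrite gt_eqF.
  apply: continuousD; last exact: cst_continuous.
  apply: (@continuous_comp _ _ _ (fun y => y - c) (fun z => z ^+ 2)).
    by apply: continuousB; [by move=> A|exact: cst_continuous].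
  exact: exprn_continuous.
pose F (y : R) := atan ((y - c) / h).
have dF (y : R) : is_derive y 1 F (f y).
  have -> : f y = (1 + ((y - c) / h) ^+ 2)^-1 * h^-1.
    have n1 : (y - c) ^+ 2 + h ^+ 2 != 0 by rewrite gt_eqF.
    have n2 : h != 0 by rewrite gt_eqF.
    by rewrite /f; field; rewrite ?n1 ?n2 ?[h ^+ 2 + _]addrC ?n1.
  apply: (@is_derive1_comp _ atan (fun y => (y - c) / h)).
  apply: is_derive_eq.
  by rewrite /= scaler0 subr0 scaler1 add0r.
have mf : measurable_fun setT (fun y => (f y)%:E).
  by apply/measurable_EFinP; apply: continuous_measurable_fun.
apply: (@le_trans _ _ (\int[mu]_(y in [set` Interval (BLeft (- e)%R) (BRight e)]) (f y)%:E)%E).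
  apply: ge0_subset_integral => //; first exact: measurable_funTS.
  - by move=> y _; rewrite lee_fin; exact: f0.
  - by move=> y /=; rewrite !in_itv /= => /andP[y1 y2]; rewrite !ltW.
have FC y : {for y, continuous F}.
  by apply: differentiable_continuous; apply/derivable1_diffP.
rewrite (@continuous_FTC2 _ f F); first last.
- by move=> y _; rewrite derive1E; apply: derive_val.
- split; first by move=> y _.
  + exact/cvg_at_right_filter/FC.
  + exact/cvg_at_left_filter/FC.
- exact: continuous_subspaceT.
- by lra.
rewrite -EFinB lee_fin /F.
have := atan_ltpi2 ((e - c) / h); have := atan_gtNpi2 ((- e - c) / h).
lra.
Qed.

End Poisson.

(** * Square integrability of polynomials over a product of linear factors *)

Section Membership.
Variable R : realType.
Local Notation C := R[i].
Local Notation E := {poly {poly C}}.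
Local Notation mu := (@lebesgue_measure R).
Local Notation factor := ({poly R} * nat)%type.
Local Open Scope complex_scope.
Implicit Types (t : factor) (s : seq factor).

Lemma peval_pconj (G : E) (x y : R) :
  peval (pconj G) x%:C y%:C = (peval G x%:C y%:C)^*%C.
Proof.
by rewrite !peval_slice slice_pconj -{1}[y%:C]conjc_real horner_map.
Qed.

Lemma Lloc_bounded (F p : E) (e K : R) : 0 < e ->
  (forall z, square e z -> quo p F z <= K) -> Lloc F p.
Proof.
move=> e0 pK; exists e => //.
apply: (@integrable_dominated _ _ _ (cst 0) 0 K).
- exact: measurable_square.
- exact: leb2_square.
- exact: measurable_quo.
- by move=> z /pK; rewrite quo_ge0 mul0r add0r.
- exact: integrable0.
Qed.

(** The exponent [t.2] is chosen so that the squared modulus is exactly a Poisson kernel in [y], of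
    height [x ^+ (2 * t.2)]. *)
Lemma quo_poisson t (x y : R) :
  quo ('X^(t.2))%:P (bkps_factor t.1 t.2) (x, y)
  = x ^+ (2 * t.2) / ((y - - t.1.[x]) ^+ 2 + (x ^+ (2 * t.2)) ^+ 2).
Proof.
rewrite quoE bkps_factorE pevalB pevalC pevalX pevalC hornerXn broot_real /=.
rewrite csqE cnormX cnorm_real -exprM mulnC exprM real_normK ?num_real //.
by rewrite (exprM x 2 t.2) /csq ReB ImB /= !opprK add0r.
Qed.

Lemma Lloc_poisson t : (0 < t.2)%N -> Lloc (bkps_factor t.1 t.2) ('X^(t.2))%:P.
Proof.
move=> L0; exists 1 => //; set k := quo _ _.
have mk : measurable_fun setT k by exact: measurable_quo.
have k0 z : 0 <= k z by exact: quo_ge0.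
apply/integrableP; split; first by apply/measurable_EFinP; apply: measurable_funTS.
under eq_integral do rewrite gee0_abs ?lee_fin ?k0 //.
rewrite tonelli_square //.
apply: (@le_lt_trans _ _ (\int[mu]_(x in [set` Interval (BRight (- 1)%R) (BLeft 1%R)])
  cst pi%:E x)%E); last by rewrite integral_cst_itv ?ltry //; lra.
apply: ge0_le_integral => //.
- by move=> x _; apply: integral_ge0 => y _; rewrite lee_fin k0.
- by apply: measurable_funTS; apply: measurable_inner.
move=> x _; have [x0|x0] := eqVneq x 0.
  rewrite integral0_eq ?lee_fin ?pi_ge0 // => y _.
  by rewrite /k quo_poisson x0 expr0n muln_eq0 /= eqn0Ngt L0 mul0r.
under eq_integral do rewrite /k quo_poisson.
by apply: poisson_le => //; rewrite exprM exprn_gt0 // exprn_even_gt0.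
Qed.

(** On the real plane [prodB s] and its conjugate have the same modulus, so the quotient reduces to
    that of [Lloc_poisson]. The value of this element at [y = broot t] has the least order that
    [Lloc_order] permits. *)
Lemma Lloc_top t s : (0 < t.2)%N ->
  Lloc (prodB (t :: s)) (('X^(t.2))%:P * pconj (prodB s)).
Proof.
move=> L0; have k := Lloc_poisson L0.
apply: (@Lloc_dominated _ _ _ _ _ _ _ 1 1 0 _ k k) => //.
move=> z _; rewrite mul1r addr0.
apply: (@le_trans _ _ (quo ('X^(t.2))%:P (bkps_factor t.1 t.2) z)); last first.
  by rewrite lerDl quo_ge0.
rewrite !quoE /prodB big_cons !pevalM peval_pconj !csqM.
set B := peval (\prod_(_ <- _) _) _ _; set a := csq (peval _ _ _); set b := csq (peval _ _ _).
have -> : csq B^*%C = csq B by rewrite !csqE cnorm_conj.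
have a0 : 0 <= a / b by rewrite divr_ge0 ?csq_ge0.
rewrite invfM mulrACA; have [->|B0] := eqVneq (csq B) 0; first by rewrite mul0r mulr0.
by rewrite mulfV // mulr1.
Qed.

Lemma peval_horner (p : E) (b : {poly C}) (x : C) : (p.[b]).[x] = peval p x b.[x].
Proof.
elim/poly_ind: p => [|p c IH]; first by rewrite pevalC !horner0.
by rewrite hornerMXaddC hornerD hornerM IH pevalD pevalM pevalX pevalC.
Qed.

(* At [y = b(x)], the value of [p] is bounded by its values on a real interval of
   length comparable to [x^(2L)], on which [prodB (t :: s)] is comparable to
   [x^(2L) * pconj (prodB s)] evaluated at [b(x)]; if the order were smaller, the
   integral over this interval would be at least a constant times [x^-2]. *)
Lemma Lloc_order t s (p : E) k (u : {poly C}) : good_factor t ->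
  (pconj (prodB s)).[broot t] = 'X^k * u -> u.[0] != 0 ->
  Lloc (prodB (t :: s)) p -> exists r, p.[broot t] = 'X^(t.2 + k) * r.
Proof.
move=> gt Fs u0 [e e0 ip].
have [pb0|pb0] := eqVneq p.[broot t] 0; first by exists 0; rewrite pb0 mulr0.
have [j [w [pE w0]]] := polyX_factor pb0.
have [Lkj|jLk] := leqP (t.2 + k) j.
  by exists ('X^(j - (t.2 + k)) * w); rewrite mulrA -exprD subnKC.
exfalso.
have [q0 L0] := gt; set L := t.2 in L0 jLk.
have [d1 [c1 [K1 [d10 c10 K10 uP]]]] := poly_near0 u0.
have [d2 [c2 [K2 [d20 c20 K20 wP]]]] := poly_near0 w0.
have [g gE] := poly0_decomp (broot t).
have [Kg Kg0 gP] := poly_bound g 1.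
pose n := size p.
pose Cn : R := (1 + 2 * 4 ^+ n) ^+ n.
have Cn0 : 0 < Cn by rewrite exprn_gt0 // addr_gt0 // mulr_gt0 // exprn_gt0.
(* Collects the losses: [Cn] from [halfplane_interval], [2] from [y - z], a [3] for each remaining
   factor, and [K1] from the unit [u]. *)
pose D : R := Cn * (2 * (3 ^+ size s * K1)).
have D0 : 0 < D by rewrite !mulr_gt0 // exprn_gt0.
have [d [d0 de dd1 dd2 [d_1 dg]]] : exists d, [/\ 0 < d, d <= e, d <= d1, d <= d2 &
    d <= 1 /\ d * (Kg + 1) <= e / 2].
  exists (Num.min e (Num.min d1 (Num.min d2 (Num.min 1 (e / 2 / (Kg + 1)))))).
  have kg : 0 < Kg + 1 by exact: addr_gt0.
  rewrite !lt_min e0 d10 d20 ltr01 !divr_gt0 // !ge_min !lexx !orbT; split=> //.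
  by split=> //; rewrite -ler_pdivlMr // !ge_min lexx !orbT.
apply: (@not_integrable _ e d ((c2 / D) ^+ 2) (1 / 4 ^+ n) (quo p (prodB (t :: s)))
  (2 * L)) => //.
- exact: measurable_quo.
- by move=> z; exact: quo_ge0.
- by rewrite exprn_gt0 // divr_gt0.
move=> x x0 xd; pose h := x ^+ (2 * L); pose z := (broot t).[x%:C].
have h0 : 0 < h by rewrite exprn_gt0.
have xC : cnorm x%:C = x by rewrite cnorm_real gtr0_norm.
have zE : z = Complex (- t.1.[x]) (- h) by rewrite /z broot_real.
have zI : complex.Im z != 0 by rewrite zE /= oppr_eq0 gt_eqF.
have sp : (size (slice x%:C p) <= n)%N by exact: size_poly.
have [a [za az yP]] := halfplane_interval sp zI.
have hI : `|complex.Im z| = h by rewrite zE /= normrN gtr0_norm.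
rewrite hI zE /= in za az yP.
have zsmall : cnorm z <= x * Kg.
  rewrite /z gE hornerD hornerC hornerM hornerX broot0 // add0r cnormM xC.
  by rewrite ler_pM2l // gP // xC ltW // (lt_le_trans xd).
have x1 : x < 1 by apply: lt_le_trans d_1.
have hx : h <= x.
  by rewrite /h -(prednK L0) mulnS exprS ler_piMr ?exprn_ile1 // ltW.
have qx : `|t.1.[x]| <= x * Kg.
  by apply: le_trans zsmall; have := cnorm_ge_Re z; rewrite zE /= normrN.
have xe : x * Kg + x < e / 2 by clear - xd dg Kg0; nra.
move: qx; rewrite ler_norml => /andP[qx1 qx2].
exists a; split.
- by clear - za qx2 xe e0 x0; lra.
- by rewrite -/h mul1r mulrC; clear - az qx1 hx xe e0 x0; lra.
move=> y; rewrite -/h mul1r [_^-1 * h]mulrC => yI.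
have := yP y yI; rewrite -/Cn -/h -zE -!peval_slice => py.
have xx : cnorm x%:C < d by rewrite xC.
have pz : x ^+ j * c2 <= cnorm (peval p x%:C z).
  rewrite -peval_horner pE hornerM hornerXn cnormM cnormX xC ler_pM2l ?exprn_gt0 //.
  by have /andP[] := wP _ (lt_le_trans xx dd2).
have Fz : \prod_(b <- roots_at s x%:C) cnorm (z - b^*%C) <= x ^+ k * K1.
  have -> : \prod_(b <- roots_at s x%:C) cnorm (z - b^*%C)
      = cnorm (peval (pconj (prodB s)) x%:C z).
    rewrite peval_slice slice_pconj slice_prodB rmorph_prod horner_prod cnorm_prod.
    apply: eq_bigr => b _.
    by rewrite rmorphB /= map_polyX map_polyC hornerD hornerN hornerX hornerC.
  rewrite -peval_horner Fs hornerM hornerXn cnormM cnormX xC ler_pM2l ?exprn_gt0 //.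
  by have /andP[] := uP _ (lt_le_trans xx dd1).
have h4 : 0 < h / 4 ^+ n by rewrite divr_gt0 ?exprn_gt0.
have yz : cnorm (y%:C - z) <= 2 * h.
  apply: le_trans (cnorm_le_ReIm _) _.
  rewrite ReB ImB zE /= sub0r !opprK (gtr0_norm h0) mulr2n mulrDl mul1r lerD2r.
  by move/andP: yI => [y1 y2]; clear - za az y1 y2; rewrite ger0_norm; lra.
(* For real [y], replacing [b] by [b^*%C] does not change the distance; and [b^*%C] is above the
   real axis while [z] is at depth [h] below it, so passing from [y] to [z] costs a factor [3]. *)
have ys : \prod_(b <- roots_at s x%:C) cnorm (y%:C - b)
    <= 3 ^+ size s * \prod_(b <- roots_at s x%:C) cnorm (z - b^*%C).
  have -> : size s = size (roots_at s x%:C) by rewrite size_map.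
  apply: ler_prod_cst (roots_at_lhp s (lt0r_neq0 x0)) => // b b0.
  split; first exact: cnorm_ge0.
  have -> : cnorm (y%:C - b) = cnorm (y%:C - b^*%C).
    by case: (b) => b1 b2; rewrite /cnorm /csq !ReB !ImB /= !sub0r opprK sqrrN.
  have hb : h <= cnorm (z - b^*%C).
    apply: le_trans (cnorm_ge_Im _); rewrite ImB zE /= -normrN opprB opprK.
    by case: (b) b0 => b1 b2 /= b20; rewrite ler_normr; apply/orP; left; clear - b20; lra.
  by have := cnormD (y%:C - z) (z - b^*%C); rewrite addrA subrK; clear - hb yz; lra.
set pn := cnorm (peval p x%:C y%:C) in py.
pose b := cnorm (peval (prodB (t :: s)) x%:C y%:C).
have b0 : 0 < b.
  by apply: lt_le_trans (prodB_lower _ _ _); rewrite gtr0_norm // exprn_gt0.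
have bD : b <= 2 * h * (3 ^+ size s * (x ^+ k * K1)).
  rewrite /b cnorm_prodB /roots_at /= big_cons -/z.
  apply: ler_pM; rewrite ?cnorm_ge0 ?prod_cnorm_ge0 //.
  by apply: le_trans ys _; rewrite ler_pM2l ?exprn_gt0.
(* Here [j < L + k] enters: the missing order gives the spare factor [x], whose square is the
   [x ^+ 2] required by [not_integrable]. *)
have hxk : h * x ^+ k <= x ^+ L * x * x ^+ j.
  rewrite /h mul2n -addnn !exprD -!mulrA ler_pM2l ?exprn_gt0 // -exprD -exprS.
  by rewrite ler_wiXn2l // ltW.
have pn0 : 0 <= pn by exact: cnorm_ge0.
have main : c2 * b <= D * pn * (x ^+ L * x).
  have xj0 : 0 < x ^+ j by rewrite exprn_gt0.
  rewrite -(ler_pM2r xj0).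
  have e1 : x ^+ j * c2 * b <= Cn * pn * b.
    by rewrite ler_pM2r //; apply: le_trans pz py.
  have e2 : Cn * pn * b <= Cn * pn * (2 * h * (3 ^+ size s * (x ^+ k * K1))).
    by rewrite ler_wpM2l // mulr_ge0 // ltW.
  have e3 : D * pn * (h * x ^+ k) <= D * pn * (x ^+ L * x * x ^+ j).
    by rewrite ler_wpM2l // mulr_ge0 // ltW.
  have <- : x ^+ j * c2 * b = c2 * b * x ^+ j by ring.
  rewrite -[leRHS]mulrA; apply: le_trans (le_trans e1 e2) (le_trans _ e3).
  by rewrite le_eqVlt; apply/orP; left; apply/eqP; rewrite /D; ring.
have -> : quo p (prodB (t :: s)) (x, y) * (h * x ^+ 2) = (pn * (x ^+ L * x) / b) ^+ 2.
  rewrite /quo csqE cnormM cnormV /= -/pn -/b /h mul2n -addnn exprD.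
  by field; rewrite gt_eqF.
rewrite ler_pXn2r ?nnegrE //; last 2 first.
- by rewrite divr_ge0 // ltW.
- by rewrite divr_ge0 ?mulr_ge0 ?exprn_ge0 // ltW.
by rewrite ler_pdivrMr // mulrAC ler_pdivlMr // [leRHS]mulrC mulrA.
Qed.

End Membership.

(** * Codimension of the locally square integrable numerators *)

Section Recursion.
Variable R : realType.
Local Notation C := R[i].
Local Notation E := {poly {poly C}}.
Local Notation factor := ({poly R} * nat)%type.
Local Open Scope complex_scope.
Implicit Types (t : factor) (s : seq factor).

Lemma Lloc_mul (F r p : E) : Lloc F p -> Lloc F (r * p).
Proof.
move=> Fp; have [K K0 rK] := peval_bound r 1.
apply: (@Lloc_dominated _ _ _ _ _ _ _ 1 (K ^+ 2) 0 _ Fp Fp) => //.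
move=> z [z1 z2]; rewrite addr0 mulrDr ler_wpDr ?(mulr_ge0 (sqr_ge0 K)) ?quo_ge0 //.
rewrite !quoE pevalM csqM -mulrA ler_wpM2r //.
  by rewrite divr_ge0 ?csq_ge0.
rewrite csqE ler_pXn2r ?nnegrE ?cnorm_ge0 ?(ltW K0) //.
by rewrite rK // cnorm_real ltW.
Qed.

Lemma Lloc_add (F p q : E) : Lloc F p -> Lloc F q -> Lloc F (p + q).
Proof.
move=> Fp Fq.
apply: (@Lloc_dominated _ _ _ _ _ _ _ 1 2 0 _ Fp Fq) => //.
by move=> z _; rewrite addr0 mulrDr /quo pevalD mulrDl csqD.
Qed.

Lemma Lloc_kclosed (F : E) : kclosed (Lloc F).
Proof.
split.
  apply: (@Lloc_bounded _ _ _ 1 0) => // z _.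
  by rewrite quoE pevalC horner0 csqE cnorm0 expr0n mul0r.
by move=> a u v Fu Fv; rewrite -mul_polyC; apply: Lloc_add => //; apply: Lloc_mul.
Qed.

Lemma Lloc_factor t s (p : E) : (forall t', t' \in t :: s -> good_factor t') ->
  Lloc (prodB (t :: s)) (('X - (broot t)%:P) * p) <-> Lloc (prodB s) p.
Proof.
move=> sP.
have qE z : quo (('X - (broot t)%:P) * p) (prodB (t :: s)) z =
    (csq (peval ('X - (broot t)%:P) z.1%:C z.2%:C) /
     csq (peval ('X - (broot t)%:P) z.1%:C z.2%:C)) * quo p (prodB s) z.
  by rewrite !quoE /prodB big_cons bkps_factorE !pevalM !csqM invfM mulrACA.
(* The factor cancels at every real point but the origin, where it vanishes and division by [0]
   gives [0]. The constant [quo p (prodB s) (0, 0)] repairs the pointwise bound there. *)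
split=> H; apply: (@Lloc_dominated _ _ _ _ _ _ _ 1 1 (quo p (prodB s) (0, 0)) _ H H) => // z _;
   rewrite mul1r.
  have [->|z0] := eqVneq z (0, 0); first by rewrite lerDr addr_ge0 ?quo_ge0.
  rewrite qE mulfV ?mul1r; last first.
    rewrite csqE sqrf_eq0 cnorm_eq0.
    have -> : 'X - (broot t)%:P = prodB [:: t].
      by rewrite /prodB big_cons big_nil mulr1 bkps_factorE.
    case: z z0 => x y /= z0; apply: prodB_neq0 => // t'; rewrite inE => /eqP ->.
    by apply: sP; rewrite mem_head.
  by rewrite -addrA lerDl addr_ge0 ?quo_ge0.
rewrite qE -addrA ler_wpDr ?(addr_ge0 (quo_ge0 _ _ _) (quo_ge0 _ _ _)) //.
have [->|z0] := eqVneq (csq (peval ('X - (broot t)%:P) z.1%:C z.2%:C)) 0.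
  by rewrite mul0r mul0r quo_ge0.
by rewrite mulfV // mul1r.
Qed.

Lemma Lloc_Xn s : Lloc (prodB s) ('X^(\sum_(t <- s) 2 * t.2)%N)%:P.
Proof.
apply: (@Lloc_bounded _ _ _ 1 1) => // -[x y] _.
rewrite quoE pevalC hornerXn !csqE cnormX cnorm_real /=.
set b := cnorm _; have [->|b0] := eqVneq b 0; first by rewrite expr0n invr0 mulr0.
have b0' : 0 < b by rewrite lt_def b0 cnorm_ge0.
rewrite ler_pdivrMr ?exprn_gt0 // mul1r ler_pXn2r ?nnegrE ?exprn_ge0 ?(ltW b0') //.
exact: prodB_lower.
Qed.

(** The ordered pairs [(a, b)] and [(b, a)] contribute equally, so the cross terms occur squared;
    only the diagonal term is single, and at [b = broot t] its order [2 * t.2] is even as well. *)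
Lemma conj_res_cons (b : C) (l : seq C) : conj_res (b :: l) =
  cnorm (b^*%C - b) * (\prod_(a <- l) cnorm (b - a^*%C)) ^+ 2 * conj_res l.
Proof.
rewrite /conj_res !big_cons; under [X in _ * X]eq_bigr do rewrite big_cons.
rewrite big_split /=.
have -> : \prod_(a <- l) cnorm (b^*%C - a) = \prod_(a <- l) cnorm (b - a^*%C).
  apply: eq_bigr => a _.
  by rewrite -[in LHS]cnorm_conj rmorphB /= conjcK.
have -> : \prod_(a <- l) cnorm (a^*%C - b) = \prod_(a <- l) cnorm (b - a^*%C).
  by apply: eq_bigr => a _; rewrite cnormBC.
by rewrite expr2; ring.
Qed.

Lemma cnorm_pconj_broot t s (x : R) :
  cnorm ((pconj (prodB s)).[broot t]).[x%:C] =
  \prod_(b <- roots_at s x%:C) cnorm ((broot t).[x%:C] - b^*%C).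
Proof.
rewrite peval_horner peval_slice slice_pconj slice_prodB rmorph_prod horner_prod cnorm_prod.
apply: eq_bigr => b _; move: (broot t).[x%:C] => z.
by rewrite rmorphB /= map_polyX map_polyC hornerD hornerN hornerX hornerC.
Qed.

(** At [x = 1] all values of [broot] lie in the open lower half plane, so none is the conjugate of
    another. *)
Lemma pconj_broot_neq0 t s : (pconj (prodB s)).[broot t] != 0.
Proof.
apply/eqP => F0; have := cnorm_pconj_broot t s 1; rewrite F0 horner0 cnorm0 => /esym/eqP.
rewrite prodf_seq_eq0 => /hasP[b bs] /=; rewrite cnorm_eq0 subr_eq0 => /eqP zb.
have := roots_at_lhp s (oner_neq0 R) => /allP /(_ _ bs).
have := congr1 (@complex.Im R) zb; rewrite broot_real /= expr1n.
by case: (b) => b1 b2 /=; lra.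
Qed.

Lemma qdim_order (b : {poly C}) d :
  qdim (fun=> True) (fun p : E => exists r, p.[b] = 'X^d * r) d.
Proof.
have lE (c : 'rV[C]_d) :
    (lcomb c (fun i : 'I_d => ('X^i)%:P : E)).[b] = \sum_i c 0 i *: 'X^i.
  rewrite /lcomb horner_sum; apply: eq_bigr => i _.
  by rewrite hornerZ hornerC mul_polyC.
have lc (c : 'rV[C]_d) (j : 'I_d) : (\sum_i c 0 i *: 'X^i)`_j = c 0 j.
  rewrite coef_sum (bigD1 j) //= coefZ coefXn eqxx mulr1 big1 ?addr0 // => i ij.
  by rewrite coefZ coefXn (inj_eq val_inj) eq_sym (negPf ij) mulr0.
exists (fun i : 'I_d => ('X^i)%:P); split=> //.
  move=> c [r]; rewrite lE => cr; apply/matrixP => i j; rewrite mxE ord1.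
  by rewrite -lc cr coefXnM ltn_ord.
move=> p _; exists (\row_j (p.[b])`_j).
exists (drop_poly d p.[b]); rewrite hornerD hornerN lE.
rewrite -{1}(poly_take_drop d p.[b]) [_ * 'X^d]mulrC addrAC.
have -> : take_poly d p.[b] = \sum_(i < d) (\row_j (p.[b])`_j : 'rV_d) 0 i *: 'X^i.
  rewrite /take_poly poly_def; apply: eq_bigr => i _; by rewrite mxE.
by rewrite subrr add0r.
Qed.

Lemma coprime_inverse (u : {poly C}) T : u.[0] != 0 ->
  exists g h, g * u + h * 'X^T = 1.
Proof.
move=> u0; have cop : coprimep u 'X^T.
  apply: coprimep_expr; rewrite -['X]subr0 -polyC0.
  by rewrite coprimep_XsubC /root.
by have /Bezout_eq1_coprimepP[[g h] gh] := cop; exists g, h.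
Qed.

(* Evaluation at [y = b(x)] maps [Lloc (prodB (t :: s))] onto [x^(L + k) C[x]],
   and its kernel is [(y - b(x)) * Lloc (prodB s)]. *)
Lemma qdim_Lloc s : (forall t, t \in s -> good_factor t) -> exists n : nat,
  qdim (fun=> True) (Lloc (prodB s)) n /\
  exists c K d : R, [/\ 0 < c, 0 < d & forall x : R, 0 < x -> x < d ->
    c * x ^+ (2 * n) <= conj_res (roots_at s x%:C) <= K * x ^+ (2 * n)].
Proof.
elim: s => [|t s IH] sP.
  exists 0%N; split.
    exists (fun=> 0); split=> //; first by move=> c _; apply/matrixP => i [].
    move=> p _; exists 0; rewrite /lcomb big_ord0 subr0.
    have [K K0 pK] := peval_bound p 1.
    apply: (@Lloc_bounded _ _ _ 1 (K ^+ 2)) => // -[x y] [x1 y1].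
    rewrite quoE /prodB big_nil peval1 [csq 1]csqE cnorm1 expr1n invr1 mulr1 csqE.
    by rewrite ler_pXn2r ?nnegrE ?cnorm_ge0 ?(ltW K0) // pK // cnorm_real ltW.
  exists 1, 1, 1; split=> // x _ _.
  by rewrite muln0 expr0 mulr1 /conj_res big_nil lexx.
have sP' t' : t' \in s -> good_factor t' by move=> h; apply: sP; rewrite inE h orbT.
have [n [[v [_ vfree vspan]] [c [K [d [c0 d0 resP]]]]]] := IH sP'.
have gt : good_factor t by apply: sP; rewrite mem_head.
have [q0 L0] := gt.
have [k [u [Fs u0]]] := polyX_factor (pconj_broot_neq0 t s).
set L := t.2 in L0; pose b := broot t.
exists (L + k + n)%N; split; last first.
  have [d1 [c1 [K1 [d10 c10 K10 uP]]]] := poly_near0 u0.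
  exists (2 * c1 ^+ 2 * c), (2 * K1 ^+ 2 * K), (Num.min d d1); split.
  - by rewrite !mulr_gt0 ?exprn_gt0.
  - by rewrite lt_min d0.
  move=> x x0; rewrite lt_min => /andP[xd xd1].
  rewrite /roots_at /= -/(roots_at s _) conj_res_cons -cnorm_pconj_broot Fs.
  have xC : cnorm x%:C = x by rewrite cnorm_real gtr0_norm.
  have -> : cnorm ((broot t).[x%:C]^*%C - (broot t).[x%:C]) = 2 * x ^+ (2 * L).
    rewrite broot_real /cnorm /csq ReB ImB /= subrr expr0n add0r sqrtr_sqr -/L.
    rewrite !opprK ger0_norm ?addr_ge0 ?evenX_ge0 //; ring.
  rewrite hornerM hornerXn cnormM cnormX xC.
  have /andP[r1 r2] := resP x x0 xd.
  have /andP[u1 u2] := uP x%:C ltac:(by rewrite xC).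
  have xe : x ^+ (2 * (L + k + n)) = x ^+ (2 * L) * (x ^+ k) ^+ 2 * x ^+ (2 * n).
    have -> : (2 * (L + k + n) = 2 * L + k * 2 + 2 * n)%N.
      by rewrite !mulnDr [(k * 2)%N]mulnC.
    by rewrite 2!exprD (exprM x k 2).
  set y := x ^+ (2 * L) in xe *; set w := x ^+ k in xe *; set m := x ^+ (2 * n) in xe r1 r2.
  have [y0 w0 m0] : [/\ 0 < y, 0 < w & 0 < m] by rewrite !exprn_gt0.
  have u12 : c1 ^+ 2 <= cnorm u.[x%:C] ^+ 2 <= K1 ^+ 2.
    by rewrite !ler_pXn2r ?nnegrE ?cnorm_ge0 ?(ltW c10) ?(ltW K10) // u1 u2.
  move/andP: u12 => [u3 u4].
  have yw0 : 0 < 2 * (y * w ^+ 2) by rewrite !mulr_gt0 ?exprn_gt0.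
  rewrite xe exprMn.
  have -> : 2 * y * (w ^+ 2 * cnorm u.[x%:C] ^+ 2) * conj_res (roots_at s x%:C) =
     2 * (y * w ^+ 2) * (cnorm u.[x%:C] ^+ 2 * conj_res (roots_at s x%:C)) by ring.
  have -> : 2 * c1 ^+ 2 * c * (y * w ^+ 2 * m) = 2 * (y * w ^+ 2) * (c1 ^+ 2 * (c * m))
    by ring.
  have -> : 2 * K1 ^+ 2 * K * (y * w ^+ 2 * m) = 2 * (y * w ^+ 2) * (K1 ^+ 2 * (K * m))
    by ring.
  rewrite !ler_pM2l //; apply/andP; split; apply: ler_pM => //.
  - by rewrite exprn_ge0 // ltW.
  - by rewrite mulr_ge0 // ltW.
  - by rewrite exprn_ge0 // cnorm_ge0.
  - by apply: le_trans r1; rewrite mulr_ge0 // ltW.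
pose I (p : E) := exists r, p.[b] = 'X^(L + k) * r.
have cI : kclosed I.
  split; first by exists 0; rewrite horner0 mulr0.
  move=> a p1 p2 [r1 p1r] [r2 p2r]; exists (a%:P * r1 + r2).
  by rewrite hornerD hornerZ p1r p2r; ring.
have cJ := Lloc_kclosed (prodB (t :: s)).
have JI p : Lloc (prodB (t :: s)) p -> I p by move=> /(Lloc_order gt Fs u0).
apply: (qdim_trans cI JI) => //; first exact: qdim_order.
exists (fun i => ('X - b%:P) * v i); split.
- by move=> i; exists 0; rewrite hornerM !hornerE subrr mul0r.
- move=> cc; have -> : lcomb cc (fun i => ('X - b%:P) * v i) = ('X - b%:P) * lcomb cc v.
    by rewrite /lcomb mulr_sumr; apply: eq_bigr => i _; rewrite -!mul_polyC mulrCA.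
  by move=> /(Lloc_factor _ sP) /vfree.
move=> p [r pr].
(* [u] is invertible only modulo a power of [x]; the exponent is such that this power itself lies in
   the space, by [Lloc_Xn]. The two terms of [w] then add up to the value of [p] at [y = b]. *)
have [g [h gh]] := coprime_inverse (\sum_(t <- t :: s) 2 * t.2)%N u0.
pose w : E := (r * g)%:P * (('X^L)%:P * pconj (prodB s))
  + (r * h * 'X^(L + k))%:P * ('X^(\sum_(t <- t :: s) 2 * t.2)%N)%:P.
have Jw : Lloc (prodB (t :: s)) w.
  by apply: Lloc_add; apply: Lloc_mul; [exact: Lloc_top|exact: Lloc_Xn].
have wb : w.[b] = p.[b].
  rewrite /w hornerD !hornerM !hornerC Fs pr -[r in RHS]mulr1 -gh exprD; ring.
have [p' p'E] : exists p', p - w = ('X - b%:P) * p'.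
  have /factor_theorem[p' ->] : root (p - w) b.
    by apply/rootP; rewrite hornerD hornerN wb subrr.
  by exists p'; rewrite mulrC.
have [cc Lc] := vspan p' Logic.I; exists cc.
have -> : lcomb cc (fun i => ('X - b%:P) * v i) = ('X - b%:P) * lcomb cc v.
  by rewrite /lcomb mulr_sumr; apply: eq_bigr => i _; rewrite -!mul_polyC mulrCA.
have -> : p - ('X - b%:P) * lcomb cc v = ('X - b%:P) * (p' - lcomb cc v) + w.
  by rewrite mulrBr -p'E; ring.
by apply: Lloc_add => //; apply/Lloc_factor.
Qed.

End Recursion.

(** * Convergent power series *)

Section PowerSeries.
Variable R : realType.
Local Notation C := R[i].
Local Notation E := {poly {poly C}}.
Local Open Scope complex_scope.
Implicit Types (a b u : pseries R) (p F G P W : E).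
Local Notation ps := (@ps_of_poly R).

Definition trunc n a : E := \poly_(j < n) \poly_(i < n) a i j.

Lemma pcoef_trunc n a i j :
  pcoef (trunc n a) i j = if (i < n)%N && (j < n)%N then a i j else 0.
Proof.
rewrite /pcoef /trunc coef_poly; case: (ltnP j n) => jn; last by rewrite coef0 andbF.
by rewrite coef_poly andbT.
Qed.

Lemma pcoefD P W i j : pcoef (P + W) i j = pcoef P i j + pcoef W i j.
Proof. by rewrite /pcoef !coefD. Qed.

Lemma pcoefB P W i j : pcoef (P - W) i j = pcoef P i j - pcoef W i j.
Proof. by rewrite /pcoef !coefB. Qed.

Lemma pcoef_inj P W : (forall i j, pcoef P i j = pcoef W i j) -> P = W.
Proof. by move=> PW; apply/polyP => j; apply/polyP => i; exact: PW. Qed.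

Lemma ps_of_polyM P W : ps (P * W) = ps_mul (ps P) (ps W).
Proof.
apply/funext => i; apply/funext => j; rewrite /ps_mul /ps_of_poly /pcoef coefM coef_sum.
rewrite [RHS]exchange_big /=; apply: eq_bigr => l _; rewrite coefM.
by [].
Qed.

Lemma ps_of_polyD P W : ps (P + W) = ps_add (ps P) (ps W).
Proof. by apply/funext => i; apply/funext => j; rewrite /ps_add /ps_of_poly pcoefD. Qed.

Lemma ps_mul_congr a a' b b' i j :
  (forall k l, (k <= i)%N -> (l <= j)%N -> a k l = a' k l) ->
  (forall k l, (k <= i)%N -> (l <= j)%N -> b k l = b' k l) ->
  ps_mul a b i j = ps_mul a' b' i j.
Proof.
move=> aa bb; apply: eq_bigr => k _; apply: eq_bigr => l _.
have ki : (k <= i)%N by rewrite -ltnS.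
have lj : (l <= j)%N by rewrite -ltnS.
by rewrite aa // bb // leq_subr.
Qed.

Lemma ps_trunc_congr i j n : (maxn i j < n)%N -> forall a k l,
  (k <= i)%N -> (l <= j)%N -> a k l = ps (trunc n a) k l.
Proof.
rewrite gtn_max => /andP[ni nj] a k l ki lj.
by rewrite /ps_of_poly pcoef_trunc (leq_ltn_trans ki ni) (leq_ltn_trans lj nj).
Qed.

(** A coefficient of a product depends on finitely many coefficients of the factors, so the identity
    is imported from polynomials by truncation. *)
Lemma ps_mulA a b u : ps_mul a (ps_mul b u) = ps_mul (ps_mul a b) u.
Proof.
apply/funext => i; apply/funext => j.
have ijn : (maxn i j < (maxn i j).+1)%N by [].
have tr := ps_trunc_congr ijn.
pose ta := ps (trunc (maxn i j).+1 a); pose tb := ps (trunc (maxn i j).+1 b).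
pose tu := ps (trunc (maxn i j).+1 u).
have congr2 v w k l : (k <= i)%N -> (l <= j)%N -> ps_mul v w k l =
    ps_mul (ps (trunc (maxn i j).+1 v)) (ps (trunc (maxn i j).+1 w)) k l.
  move=> ki lj; apply: ps_mul_congr => k' l' k'k l'l; apply: tr.
  - exact: leq_trans ki.
  - exact: leq_trans lj.
  - exact: leq_trans ki.
  - exact: leq_trans lj.
transitivity (ps_mul ta (ps_mul tb tu) i j).
  by apply: ps_mul_congr => k l ki lj; [exact: tr|exact: congr2].
transitivity (ps_mul (ps_mul ta tb) tu i j).
  by rewrite /ta /tb /tu -!ps_of_polyM mulrA.
by apply: ps_mul_congr => k l ki lj; [rewrite [RHS]congr2|rewrite [RHS]tr].
Qed.

Lemma ps_mulDl a b u : ps_mul (ps_add a b) u = ps_add (ps_mul a u) (ps_mul b u).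
Proof.
apply/funext => i; apply/funext => j; rewrite /ps_mul /ps_add -big_split /=.
apply: eq_bigr => k _; rewrite -big_split /=; apply: eq_bigr => l _.
by rewrite mulrDl.
Qed.

Lemma ps_mulDr a b u : ps_mul u (ps_add a b) = ps_add (ps_mul u a) (ps_mul u b).
Proof.
apply/funext => i; apply/funext => j; rewrite /ps_mul /ps_add -big_split /=.
apply: eq_bigr => k _; rewrite -big_split /=; apply: eq_bigr => l _.
by rewrite mulrDr.
Qed.

Lemma ps_mul1 a : ps_mul (ps 1) a = a.
Proof.
apply/funext => i; apply/funext => j.
have ijn : (maxn i j < (maxn i j).+1)%N by [].
rewrite (ps_trunc_congr ijn a) //.
transitivity (ps_mul (ps 1) (ps (trunc (maxn i j).+1 a)) i j).
  by apply: ps_mul_congr => // k l ki lj; apply: (ps_trunc_congr ijn).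
by rewrite -ps_of_polyM mul1r.
Qed.

Lemma convergent_le a (r r' : R) : 0 <= r' -> r' <= r -> ps_bounded_at a r ->
  ps_bounded_at a r'.
Proof.
move=> r'0 r'r [B aB]; exists B => i j; apply: le_trans (aB i j).
by rewrite ler_wpM2l ?cnorm_ge0 // lerXn2r ?nnegrE // (le_trans r'0).
Qed.

Lemma convergent2 a b : convergent a -> convergent b ->
  exists2 r : R, 0 < r & ps_bounded_at a r /\ ps_bounded_at b r.
Proof.
move=> [r [r0 ar]] [r' [r'0 br']]; exists (Num.min r r').
  by rewrite lt_min r0.
have m0 : 0 <= Num.min r r' by rewrite le_min !ltW.
by split; [apply: convergent_le ar|apply: convergent_le br'] => //;
   rewrite ge_min lexx ?orbT.
Qed.

Lemma convergentD a b : convergent a -> convergent b -> convergent (ps_add a b).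
Proof.
move=> ca cb; have [r r0 [[B aB] [B' bB]]] := convergent2 ca cb.
exists r; split=> //; exists (B + B') => i j.
apply: le_trans (lerD (aB i j) (bB i j)); rewrite -mulrDl ler_wpM2r ?cnormD //.
by rewrite exprn_ge0 // ltW.
Qed.

Lemma succ_le_exp2 n : (n.+1%:R <= 2 ^+ n :> R).
Proof. by rewrite -natrX ler_nat ltn_expl. Qed.

Lemma convergentM a b : convergent a -> convergent b -> convergent (ps_mul a b).
Proof.
move=> ca cb; have [r r0 [[B aB] [B' bB]]] := convergent2 ca cb.
(* A coefficient of the product has [(i + 1) (j + 1)] terms, at most [2 ^ (i + j)]; halving the
   radius pays for them. *)
exists (r / 2); split; first by rewrite divr_gt0.
exists (B * B') => i j.
have B0 : 0 <= B by apply: le_trans (aB 0 0)%N; rewrite mulr1 cnorm_ge0.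
have term (k : 'I_i.+1) (l : 'I_j.+1) :
    cnorm (a k l * b (i - k)%N (j - l)%N) * r ^+ (i + j) <= B * B'.
  have -> : (i + j = (k + l) + ((i - k) + (j - l)))%N.
    have ki : (k <= i)%N by rewrite -ltnS.
    have lj : (l <= j)%N by rewrite -ltnS.
    by rewrite addnACA !subnKC.
  rewrite cnormM exprD mulrACA ler_pM ?mulr_ge0 ?cnorm_ge0 ?exprn_ge0 ?(ltW r0) //.
rewrite expr_div_n mulrA ler_pdivrMr ?exprn_gt0 //.
apply: (@le_trans _ _ (\sum_(k < i.+1) \sum_(l < j.+1) B * B')).
  rewrite /ps_mul; apply: le_trans (ler_wpM2r _ (cnorm_sum _ _)) _.
    by rewrite exprn_ge0 // ltW.
  rewrite mulr_suml; apply: ler_sum => k _.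
  apply: le_trans (ler_wpM2r _ (cnorm_sum _ _)) _; first by rewrite exprn_ge0 // ltW.
  by rewrite mulr_suml; apply: ler_sum => l _; exact: term.
rewrite !sumr_const !card_ord -mulrnA -[leLHS]mulr_natr natrM exprD.
have B'0 : 0 <= B' by apply: le_trans (bB 0 0)%N; rewrite mulr1 cnorm_ge0.
rewrite ler_wpM2l ?mulr_ge0 // mulrC ler_pM ?succ_le_exp2 //.
Qed.

Lemma poly_l1 (c : {poly C}) : exists2 S : R, 0 <= S & forall n,
  \sum_(k < n) cnorm c`_k <= S.
Proof.
elim/poly_ind: c => [|c z [S S0 cS]].
  by exists 0 => // n; rewrite big1 // => k _; rewrite coef0 cnorm0.
exists (cnorm z + S); first by rewrite addr_ge0 ?cnorm_ge0.
case=> [|n]; first by rewrite big_ord0 addr_ge0 ?cnorm_ge0.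
rewrite big_ord_recl; apply: lerD; first by rewrite coefD coefMX coefC add0r.
apply: le_trans (cS n); rewrite le_eqVlt; apply/orP; left; apply/eqP.
by apply: eq_bigr => k _; rewrite coefD coefMX coefC addr0.
Qed.

Lemma pcoef_l1 P : exists2 S : R, 0 <= S & forall i j,
  \sum_(k < i) \sum_(l < j) cnorm (pcoef P k l) <= S.
Proof.
suff [S S0 PS] : exists2 S : R, 0 <= S & forall i j,
    \sum_(l < j) \sum_(k < i) cnorm (pcoef P k l) <= S.
  by exists S => // i j; rewrite exchange_big PS.
elim/poly_ind: P => [|P c [S S0 PS]].
  exists 0 => // i j; rewrite big1 // => l _; rewrite big1 // => k _.
  by rewrite /pcoef !coef0 cnorm0.
have [S' S'0 cS] := poly_l1 c.
exists (S' + S); first exact: addr_ge0.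
move=> i [|j]; first by rewrite big_ord0 addr_ge0.
rewrite big_ord_recl; apply: lerD.
  apply: le_trans (cS i); rewrite le_eqVlt; apply/orP; left; apply/eqP.
  by apply: eq_bigr => k _; rewrite /pcoef coefD coefMX coefC add0r.
apply: le_trans (PS i j); rewrite le_eqVlt; apply/orP; left; apply/eqP.
by apply: eq_bigr => l _; apply: eq_bigr => k _; rewrite /pcoef coefD coefMX coefC addr0.
Qed.

Lemma pcoef_bounded P : exists2 S : R, 0 <= S & forall i j, cnorm (pcoef P i j) <= S.
Proof.
have [S S0 PS] := pcoef_l1 P; exists S => // i j.
apply: le_trans (PS i.+1 j.+1); rewrite (bigD1 ord_max) //= (bigD1 ord_max) //= -addrA.
by rewrite lerDl addr_ge0 // ?sumr_ge0 // => k _; rewrite ?sumr_ge0 ?cnorm_ge0 // => l _;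
   exact: cnorm_ge0.
Qed.

Lemma convergent_poly P : convergent (ps P).
Proof.
have [S S0 PS] := pcoef_bounded P; exists 1; split=> //; exists S => i j.
by rewrite expr1n mulr1 PS.
Qed.

Lemma pcoef_exp_low P n i j : pcoef P 0 0 = 0 -> (i + j < n)%N -> pcoef (P ^+ n) i j = 0.
Proof.
move=> P0; elim: n i j => // n IH i j ijn.
rewrite exprS -[LHS]/(ps (P * P ^+ n) i j) ps_of_polyM /ps_mul.
rewrite big1 // => k _; rewrite big1 // => l _; rewrite /ps_of_poly.
have [kl0|kl0] := eqVneq (k + l)%N 0%N.
  by move/eqP: kl0; rewrite addn_eq0 => /andP[/eqP -> /eqP ->]; rewrite P0 mul0r.
rewrite IH ?mulr0 //; rewrite -lt0n in kl0.
have ki : (k <= i)%N by rewrite -ltnS.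
have lj : (l <= j)%N by rewrite -ltnS.
rewrite ltnS in ijn; apply: leq_trans ijn.
have <- : (i - k + (j - l) + (k + l) = i + j)%N by rewrite addnACA !subnK.
by rewrite -[X in (X < _)%N]addn0 ltn_add2l.
Qed.

(** Geometric series in [e = 1 - g / c]. As [e] has no constant term, [e ^+ n] has no terms of
    degree below [n], so each coefficient of the inverse is a finite sum; a bound on the sum of the
    moduli of the coefficients of [e] gives a radius. *)
Lemma convergent_inverse (g : E) : pcoef g 0 0 != 0 ->
  exists2 h, convergent h & ps_mul h (ps g) = ps 1.
Proof.
move=> g0; set c := pcoef g 0 0 in g0.
pose e : E := 1 - (c^-1)%:P%:P * g.
have cC (z : C) (P : E) i j : pcoef (z%:P%:P * P) i j = z * pcoef P i j.
  by rewrite /pcoef !coefCM.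
have e0 : pcoef e 0 0 = 0.
  by rewrite pcoefB cC -/c mulVf // /pcoef coefC coefC subrr.
pose S_ N : E := (c^-1)%:P%:P * \sum_(n < N) e ^+ n.
pose h : pseries R := fun i j => pcoef (S_ (i + j).+1) i j.
have hS N i j : (i + j < N)%N -> h i j = pcoef (S_ N) i j.
  move=> ijN; rewrite /h /S_ !cC; congr (_ * _).
  rewrite -(subnKC ijN) big_split_ord /= pcoefD [X in _ = _ + X](_ : _ = 0) ?addr0 //.
  rewrite /pcoef !coef_sum big1 // => n _.
  by apply: pcoef_exp_low => //; rewrite addSn ltnS leq_addr.
have cc : (c^-1)%:P%:P * c%:P%:P = 1 :> E.
  by rewrite -[RHS]/(1%:P%:P) -(mulVf g0) !polyCM.
have gE : g = c%:P%:P * (1 - e).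
  by rewrite /e opprB addrC subrK mulrA [c%:P%:P * _]mulrC cc mul1r.
have SN N : S_ N * g = 1 - e ^+ N.
  rewrite gE /S_ -[1 - e ^+ N]opprB subrX1.
  transitivity ((c^-1)%:P%:P * c%:P%:P * (\sum_(n < N) e ^+ n * (1 - e))).
    by rewrite -mulr_suml; ring.
  by rewrite cc -mulr_suml; ring.
exists h; last first.
  apply/funext => i; apply/funext => j.
  transitivity (ps_mul (ps (S_ (i + j).+1)) (ps g) i j).
    by apply: ps_mul_congr => // k l ki lj; apply: hS; rewrite ltnS leq_add.
  rewrite -ps_of_polyM SN /ps_of_poly pcoefB pcoef_exp_low ?subr0 //.
have [S S0 eS] := pcoef_l1 e.
pose S1 := S + 1; have S11 : 1 <= S1 by rewrite lerDr.
have eN n i j : cnorm (pcoef (e ^+ n) i j) <= S1 ^+ n.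
  elim: n i j => [|n IH] i j.
    rewrite !expr0 /pcoef coefC; case: eqP => _; last by rewrite coef0 cnorm0.
    by rewrite coefC; case: eqP => _; rewrite ?cnorm1 ?cnorm0.
  rewrite exprS -[X in cnorm X]/(ps (e * e ^+ n) i j) ps_of_polyM /ps_mul.
  apply: (@le_trans _ _ (\sum_(k < i.+1) \sum_(l < j.+1) (cnorm (pcoef e k l) * S1 ^+ n))).
    apply: le_trans (cnorm_sum _ _) _; apply: ler_sum => k _.
    apply: le_trans (cnorm_sum _ _) _; apply: ler_sum => l _.
    by rewrite cnormM ler_wpM2l ?cnorm_ge0 ?IH.
  under eq_bigr do rewrite -mulr_suml.
  rewrite -mulr_suml exprS ler_wpM2r ?exprn_ge0 ?(le_trans ler01) //.
  by apply: le_trans (eS _ _) _; rewrite lerDl.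
exists (2 * S1)^-1; split; first by rewrite invr_gt0 mulr_gt0 // (lt_le_trans ltr01).
exists (cnorm c^-1) => i j.
have S1p : 0 < (2 * S1) ^+ (i + j) by rewrite exprn_gt0 // mulr_gt0 // (lt_le_trans ltr01).
rewrite exprVn ler_pdivrMr // /h cC cnormM ler_wpM2l ?cnorm_ge0 //.
rewrite /pcoef !coef_sum; apply: le_trans (cnorm_sum _ _) _.
apply: (@le_trans _ _ (\sum_(n < (i + j).+1) S1 ^+ (i + j))).
  apply: ler_sum => n _; apply: le_trans (eN n i j) _.
  by rewrite ler_weXn2l // -ltnS.
rewrite sumr_const card_ord -[leLHS]mulr_natl exprMn ler_wpM2r ?succ_le_exp2 //.
by rewrite exprn_ge0 // (le_trans ler01).
Qed.

End PowerSeries.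

(** * Ideals of convergent series and ideals of polynomials *)

Section Ideals.
Variable R : realType.
Local Notation C := R[i].
Local Notation E := {poly {poly C}}.
Local Open Scope complex_scope.
Implicit Types (u : pseries R) (p F G P W : E).
Local Notation ps := (@ps_of_poly R).

Lemma ps_addACA (a b : pseries R) u v : ps_add (ps_add a b) (ps_add u v)
  = ps_add (ps_add a u) (ps_add b v).
Proof. by apply/funext => i; apply/funext => j; rewrite /ps_add addrACA. Qed.

Lemma ideal2D (F G a b : pseries R) : ideal2 F G a -> ideal2 F G b -> ideal2 F G (ps_add a b).
Proof.
move=> [A [B [cA [cB ->]]]] [A' [B' [cA' [cB' ->]]]].
exists (ps_add A A'), (ps_add B B'); split; first exact: convergentD.
split; first exact: convergentD.
by rewrite !ps_mulDl ps_addACA.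
Qed.

Lemma ideal2M (F G a b : pseries R) : convergent a -> ideal2 F G b -> ideal2 F G (ps_mul a b).
Proof.
move=> ca [A [B [cA [cB ->]]]].
exists (ps_mul a A), (ps_mul a B); split; first exact: convergentM.
split; first exact: convergentM.
by rewrite ps_mulDr !ps_mulA.
Qed.

(* The ideal [(F, G)] of the local ring of [C[x, y]] at the origin. *)
Definition local_ideal F G p : Prop :=
  exists2 g : E, pcoef g 0 0 != 0 & exists a b, g * p = a * F + b * G.

Lemma local_ideal2 F G p : local_ideal F G p -> ideal2 (ps F) (ps G) (ps p).
Proof.
move=> [g g0 [a [b gp]]]; have [h ch hg] := convergent_inverse g0.
exists (ps_mul h (ps a)), (ps_mul h (ps b)).
split; first by apply: convergentM => //; exact: convergent_poly.
split; first by apply: convergentM => //; exact: convergent_poly.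
rewrite -!ps_mulA -ps_mulDr -!ps_of_polyM -ps_of_polyD -gp ps_of_polyM ps_mulA hg.
by rewrite ps_mul1.
Qed.

Lemma pcoef00 P : pcoef P 0 0 = peval P 0 0.
Proof.
by rewrite peval_slice horner_coef0 coef_map /= horner_evalE horner_coef0.
Qed.

Lemma local_idealD F G p q :
  local_ideal F G p -> local_ideal F G q -> local_ideal F G (p + q).
Proof.
move=> [g g0 [a [b gp]]] [h h0 [a' [b' hq]]]; exists (g * h).
  by rewrite pcoef00 pevalM -!pcoef00 mulf_neq0.
exists (h * a + g * a'), (h * b + g * b').
transitivity (h * (g * p) + g * (h * q)); first by ring.
by rewrite gp hq; ring.
Qed.

Lemma local_idealM F G r p : local_ideal F G p -> local_ideal F G (r * p).
Proof.
move=> [g g0 [a [b gp]]]; exists g => //; exists (r * a), (r * b).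
by rewrite mulrCA gp; ring.
Qed.

Lemma local_ideal_cancel F G r p : pcoef r 0 0 != 0 ->
  local_ideal F G (r * p) -> local_ideal F G p.
Proof.
move=> r0 [g g0 [a [b gp]]]; exists (g * r).
  by rewrite pcoef00 pevalM -!pcoef00 mulf_neq0.
by exists a, b; rewrite -mulrA.
Qed.

Lemma local_ideal_in F G a b : local_ideal F G (a * F + b * G).
Proof.
exists 1; first by rewrite pcoef00 peval1 oner_neq0.
by exists a, b; rewrite mul1r.
Qed.

Lemma low_coef_split (d : E) T :
  (forall i j, (i < T)%N -> (j < T)%N -> pcoef d i j = 0) ->
  exists d1 d2, d = d1 * ('X^T)%:P + d2 * 'X^T.
Proof.
move=> d0; exists (\poly_(j < T) drop_poly T d`_j), (drop_poly T d).
rewrite -{1}(poly_take_drop T d); congr (_ + _); apply/polyP => j.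
rewrite coefMC !coef_poly; case: ltnP => jT; last by rewrite mul0r.
rewrite -{1}(poly_take_drop T d`_j) [take_poly _ _](_ : _ = 0) ?add0r //.
apply/polyP => i; rewrite coef0 coef_poly; case: ltnP => // iT.
exact: d0.
Qed.

(** Truncating the cofactors leaves the coefficients with both exponents below [T] unchanged; what
    is lost is a combination of [x^T] and [y^T]. *)
Lemma ideal2_poly F G p T : ideal2 (ps F) (ps G) (ps p) ->
  exists a b d1 d2, p = a * F + b * G + (d1 * ('X^T)%:P + d2 * 'X^T).
Proof.
move=> [A [B [_ [_ pE]]]].
have [|d1 [d2 dE]] := @low_coef_split (p - (trunc T A * F + trunc T B * G)) T.
  move=> i j iT jT; rewrite pcoefB pcoefD.
  have -> : pcoef p i j = ps_mul A (ps F) i j + ps_mul B (ps G) i j.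
    by rewrite -[LHS]/(ps p i j) pE.
  rewrite -![pcoef (_ * _) i j]/(ps _ i j) !ps_of_polyM.
  have tr (D : pseries R) H : ps_mul D (ps H) i j = ps_mul (ps (trunc T D)) (ps H) i j.
    apply: ps_mul_congr => // k l ki lj; rewrite /ps_of_poly pcoef_trunc.
    by rewrite (leq_ltn_trans ki) ?(leq_ltn_trans lj).
  by rewrite -!tr subrr.
exists (trunc T A), (trunc T B), d1, d2.
by rewrite -dE addrC subrK.
Qed.

Lemma ps_mul_Xn (a : pseries R) T i j :
  ps_mul a (ps ('X^T)%:P) i j = if (i < T)%N then 0 else a (i - T)%N j.
Proof.
have ijn : (maxn i j < (maxn i j).+1)%N by [].
transitivity (ps_mul (ps (trunc (maxn i j).+1 a)) (ps ('X^T)%:P) i j).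
  by apply: ps_mul_congr => // k l ki lj; exact: (ps_trunc_congr ijn).
rewrite -ps_of_polyM /ps_of_poly /pcoef coefMC coefMXn; case: ifP => // _.
rewrite -[LHS]/(pcoef _ _ _) pcoef_trunc !ltnS leq_maxr andbT.
by rewrite (leq_trans (leq_subr _ _) (leq_maxl _ _)).
Qed.

Lemma ps_mul_Yn (a : pseries R) T i j :
  ps_mul a (ps 'X^T) i j = if (j < T)%N then 0 else a i (j - T)%N.
Proof.
have ijn : (maxn i j < (maxn i j).+1)%N by [].
transitivity (ps_mul (ps (trunc (maxn i j).+1 a)) (ps 'X^T) i j).
  by apply: ps_mul_congr => // k l ki lj; exact: (ps_trunc_congr ijn).
rewrite -ps_of_polyM /ps_of_poly /pcoef coefMXn; case: ifP => _; first by rewrite coef0.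
rewrite -[LHS]/(pcoef _ _ _) pcoef_trunc !ltnS leq_maxl /=.
by rewrite (leq_trans (leq_subr _ _) (leq_maxr _ _)).
Qed.

Lemma ps_split u T : convergent u -> exists A1 A2, [/\ convergent A1, convergent A2 &
  u = ps_add (ps (trunc T u))
        (ps_add (ps_mul A1 (ps ('X^T)%:P)) (ps_mul A2 (ps 'X^T)))].
Proof.
move=> [r [r0 [B uB]]].
have rT : 0 < r ^+ T by rewrite exprn_gt0.
exists (fun i j => u (i + T)%N j), (fun i j => if (i < T)%N then u i (j + T)%N else 0).
split.
- exists r; split=> //; exists (B / r ^+ T) => i j.
  by rewrite ler_pdivlMr // -mulrA -exprD addnAC uB.
- exists r; split=> //; exists (B / r ^+ T) => i j.
  rewrite ler_pdivlMr // -mulrA -exprD -addnA; case: ifP => _; first exact: uB.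
  rewrite cnorm0 mul0r; apply: le_trans (uB 0 0)%N; rewrite mulr1; exact: cnorm_ge0.
apply/funext => i; apply/funext => j; rewrite /ps_add ps_mul_Xn ps_mul_Yn.
rewrite /ps_of_poly pcoef_trunc.
case: (ltnP i T) => iT /=; last by rewrite subnK // add0r; case: ifP; rewrite addr0.
by case: (ltnP j T) => jT; rewrite ?addr0 ?add0r // subnK.
Qed.

Lemma pconjM P W : pconj (P * W) = pconj P * pconj W.
Proof. exact: rmorphM. Qed.

Lemma pconjD P W : pconj (P + W) = pconj P + pconj W.
Proof. exact: rmorphD. Qed.

Lemma pconj_Xn T : pconj ('X^T)%:P = ('X^T)%:P :> E.
Proof. by rewrite /pconj map_polyC /= map_polyXn. Qed.

Lemma pcoef_pconj P i j : pcoef (pconj P) i j = (pcoef P i j)^*%C.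
Proof. by rewrite /pcoef /pconj !coef_map. Qed.

Section Comparison.
Variables (P W U E0 : E) (m N T : nat) (u0 : {poly C}).
Hypotheses (Wm : W \is monic) (sW : size W = m.+2) (W0 : slice 0 W = 'X^(m.+1)).
Hypotheses (U0 : peval U 0 0 != 0) (PE : P = W * U + ('X^((N + T).+1))%:P * E0).
Hypotheses (u00 : u0.[0] != 0).
Hypothesis (dW : \det (horner_mx (compm m W) (pconj W)) = 'X^N * u0).

Lemma xlocal_Xn k : (N <= k)%N -> xlocal_ideal W (pconj W) ('X^k)%:P.
Proof.
move=> Nk; rewrite -(subnK Nk) exprD polyCM; apply: xlocal_idealM.
exact: (Xn_xlocal_ideal Wm sW u00 dW).
Qed.

Lemma xlocal_Yn k : (m.+1 * N <= k)%N -> xlocal_ideal W (pconj W) 'X^k.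
Proof.
move=> Nk; rewrite -(subnK Nk) exprD; apply: xlocal_idealM.
have /slice0_dvd[H HE] : slice 0 (W - 'X^(m.+1)) = 0.
  by rewrite rmorphB rmorphXn /= slice_X W0 subrr.
by apply: (Yn_xlocal_ideal Wm sW u00 dW (H := H)); rewrite -HE addrC subrK.
Qed.

Lemma pconj_split : pconj P = pconj W * pconj U + ('X^((N + T).+1))%:P * pconj E0.
Proof. by rewrite PE pconjD !pconjM pconj_Xn. Qed.

(** A Nakayama argument: multiply the relation for [x^N] in [(W, pconj W)] by [U * pconj U] and
    replace [W * U] by [P] minus the error. The error has a factor [x^(T+1)] beyond [x^N], so the
    total coefficient of [x^N] is still a unit at the origin. *)
Lemma local_ideal_Xn : local_ideal P (pconj P) ('X^N)%:P.
Proof.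
have [v v0 [a [b vab]]] := xlocal_Xn (leqnn N).
have XE : ('X^((N + T).+1))%:P = ('X^(T.+1))%:P * ('X^N)%:P :> E.
  by rewrite -polyCM -exprD addSn addnC.
exists (U * pconj U * v%:P + ('X^(T.+1))%:P * (a * pconj U * E0 + b * U * pconj E0)).
  have cU : peval (pconj U) 0 0 != 0 by rewrite -pcoef00 pcoef_pconj conjc_eq0 pcoef00.
  rewrite pcoef00 pevalD !pevalM !pevalC hornerXn expr0n mul0r addr0.
  by rewrite !mulf_neq0.
exists (a * pconj U), (b * U); rewrite pconj_split {1}PE XE.
transitivity (U * pconj U * (v%:P * ('X^N)%:P) + ('X^(T.+1))%:P * ('X^N)%:P
  * (a * pconj U * E0 + b * U * pconj E0)); first by ring.
by rewrite vab; ring.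
Qed.

Lemma xlocal_ideal2 p : xlocal_ideal W (pconj W) p ->
  ideal2 (ps P) (ps (pconj P)) (ps p).
Proof.
move=> [v v0 [a [b vab]]]; apply: local_ideal2.
have XE : ('X^((N + T).+1))%:P = ('X^(T.+1))%:P * ('X^N)%:P :> E.
  by rewrite -polyCM -exprD addSn addnC.
have Xin k : local_ideal P (pconj P) (k * ('X^((N + T).+1))%:P).
  by rewrite XE mulrA; apply: local_idealM; exact: local_ideal_Xn.
have Win : local_ideal P (pconj P) W.
  apply: (@local_ideal_cancel _ _ U); first by rewrite pcoef00.
  have -> : U * W = (1 * P + 0 * pconj P) + (- E0) * ('X^((N + T).+1))%:P.
    by rewrite PE; ring.
  by apply: local_idealD; [exact: local_ideal_in|exact: Xin].
have cWin : local_ideal P (pconj P) (pconj W).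
  apply: (@local_ideal_cancel _ _ (pconj U)).
    by rewrite pcoef_pconj conjc_eq0 pcoef00.
  have -> : pconj U * pconj W
      = (0 * P + 1 * pconj P) + (- pconj E0) * ('X^((N + T).+1))%:P.
    by rewrite pconj_split; ring.
  by apply: local_idealD; [exact: local_ideal_in|exact: Xin].
apply: (@local_ideal_cancel _ _ v%:P); first by rewrite pcoef00 pevalC.
by rewrite vab; apply: local_idealD; apply: local_idealM.
Qed.

(** Inverting only the [u(x)] loses nothing against the local ring at the origin: [W(0, y)] is a
    power of [y], so large powers of both [x] and [y] already lie in [xlocal_ideal W (pconj W)] and
    swallow the truncation. *)
Lemma ideal2_xlocal p : ideal2 (ps P) (ps (pconj P)) (ps p) ->
  xlocal_ideal W (pconj W) p.
Proof.
move=> /(ideal2_poly (m.+1 * N))[a [b [d1 [d2 ->]]]].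
have XN k : xlocal_ideal W (pconj W) (('X^((N + T).+1))%:P * k).
  by rewrite mulrC; apply/xlocal_idealM/xlocal_Xn; rewrite -addnS leq_addr.
apply: xlocal_idealD; last first.
  apply: xlocal_idealD; apply: xlocal_idealM; last exact: xlocal_Yn.
  by apply: xlocal_Xn; rewrite leq_pmull.
have Pin : xlocal_ideal W (pconj W) P.
  rewrite PE; apply: xlocal_idealD => //.
  by have := xlocal_ideal_in W (pconj W) U 0; rewrite mul0r addr0 mulrC.
have cPin : xlocal_ideal W (pconj W) (pconj P).
  rewrite pconj_split; apply: xlocal_idealD => //.
  by have := xlocal_ideal_in W (pconj W) 0 (pconj U); rewrite mul0r add0r mulrC.
by apply: xlocal_idealD; apply: xlocal_idealM.
Qed.

Lemma ps_lcomb n (c : 'rV[C]_n) (v : 'I_n -> E) :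
  ps (lcomb c v) = ps_comb (fun k => c 0 k) (fun k => ps (v k)).
Proof.
apply/funext => i; apply/funext => j; rewrite /ps_of_poly /ps_comb /lcomb /pcoef.
rewrite !coef_sum; apply: eq_bigr => k _.
by rewrite coefZ coefCM.
Qed.

(** [Up] is the polynomial shadow of [S]: polynomials in [Up] are series in [S], and truncation
    leads back, the discarded part lying in the ideal. The same statement serves for both sides of
    the theorem. *)
Lemma quot_dim_lift (Up : E -> Prop) (S : set (pseries R)) n :
  qdim Up (xlocal_ideal W (pconj W)) n ->
  (forall p, Up p -> S (ps p)) ->
  (forall u, S u -> convergent u /\ Up (trunc (m.+1 * N) u)) ->
  quot_dim S (ideal2 (ps P) (ps (pconj P))) n.
Proof.
move=> [v [Uv vfree vspan]] US SU.
exists (fun k => ps (v k)); split; first by move=> k; apply: US.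
split=> [c|u Su].
  have -> : ps_comb c (fun k => ps (v k)) = ps (lcomb (\row_k c k) v).
    rewrite ps_lcomb; congr ps_comb; apply/funext => k; by rewrite mxE.
  by move=> /ideal2_xlocal /vfree /matrixP ce k; have := ce 0 k; rewrite !mxE.
have [cu Utu] := SU u Su.
have [c xc] := vspan _ Utu; exists (fun k => c 0 k).
have [A1 [A2 [cA1 cA2 uE]]] := ps_split (m.+1 * N)%N cu.
have -> : ps_add u (ps_scale (-1) (ps_comb (fun k => c 0 k) (fun k => ps (v k))))
  = ps_add (ps (trunc (m.+1 * N) u - lcomb c v)) (ps_add
      (ps_mul A1 (ps ('X^(m.+1 * N))%:P)) (ps_mul A2 (ps 'X^(m.+1 * N)))).
  rewrite -ps_lcomb; apply/funext => i; apply/funext => j; rewrite {1}uE.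
  by rewrite /ps_add /ps_scale /ps_of_poly pcoefB mulN1r addrAC.
apply: ideal2D; first exact: xlocal_ideal2.
apply: ideal2D; apply: ideal2M => //; apply: xlocal_ideal2; last exact: xlocal_Yn.
by apply: xlocal_Xn; rewrite leq_pmull.
Qed.

End Comparison.
End Ideals.

(** * Evaluation of convergent series *)

Section Evaluation.
Variable R : realType.
Local Notation C := R[i].
Local Notation E := {poly {poly C}}.
Local Open Scope complex_scope.
Implicit Types (u : pseries R) (p F G P W : E).
Local Notation ps := (@ps_of_poly R).

Lemma ps_partialE u (x y : C) n : ps_partial u x y n = peval (trunc n u) x y.
Proof.
rewrite peval_slice.
have -> : slice x (trunc n u) = \poly_(j < n) ((\poly_(i < n) u i j).[x]).
  apply/polyP => j; rewrite coef_map /trunc !coef_poly; case: ifP => // _.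
  exact: horner0.
rewrite horner_poly /ps_partial exchange_big /=; apply: eq_bigr => j _.
by rewrite horner_poly mulr_suml.
Qed.

Lemma geometric_quarter n : \sum_(i < n) ((1 / 4) ^+ i : R) <= 2.
Proof.
suff -> : \sum_(i < n) ((1 / 4) ^+ i : R) = (4 / 3) * (1 - (1 / 4) ^+ n).
  have : 0 <= (1 / 4 : R) ^+ n by rewrite exprn_ge0 // divr_ge0.
  by lra.
elim: n => [|n IH]; first by rewrite big_ord0 expr0 subrr mulr0.
by rewrite big_ord_recr /= IH exprS; lra.
Qed.

Lemma trunc_trunc u T n : (T <= n)%N -> trunc n (ps (trunc T u)) = trunc T u.
Proof.
move=> Tn; apply: pcoef_inj => i j; rewrite pcoef_trunc /ps_of_poly.
case: ifP => // /negbT; rewrite negb_and -!leqNgt => ijn.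
rewrite pcoef_trunc; case: ifP => // /andP[iT jT].
by case/orP: ijn => h; [have := leq_trans iT Tn|have := leq_trans jT Tn]; rewrite ltnNge h.
Qed.

(** Each lost term has [i >= T] or [j >= T]. As [|x| <= r / 8], a factor [(1 / 4) ^+ i] can be set
    aside for a geometric sum while a power of [4 |x| / r <= 1] remains, and similarly in [y]. The
    double geometric sum is at most [4]. *)
Lemma partial_diff u (r B x y : R) T n : 0 < r ->
  (forall i j, cnorm (u i j) * r ^+ (i + j) <= B) ->
  `|x| <= r / 8 -> `|y| <= r / 8 -> (T <= n)%N ->
  cnorm (ps_partial u x%:C y%:C n - ps_partial u x%:C y%:C T)
  <= 4 * B * ((4 * `|x| / r) ^+ T + (4 * `|y| / r) ^+ T).
Proof.
move=> r0 uB xr yr Tn.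
have -> : ps_partial u x%:C y%:C T = ps_partial (ps (trunc T u)) x%:C y%:C n.
  by rewrite !ps_partialE trunc_trunc.
have [A AE] : exists A, A = 4 * `|x| / r by eexists.
have [D DE] : exists D, D = 4 * `|y| / r by eexists.
have A0 : 0 <= A by rewrite AE divr_ge0 ?mulr_ge0 // ltW.
have D0 : 0 <= D by rewrite DE divr_ge0 ?mulr_ge0 // ltW.
have A1 : A <= 1 by rewrite AE ler_pdivrMr //; lra.
have D1 : D <= 1 by rewrite DE ler_pdivrMr //; lra.
have B0 : 0 <= B by apply: le_trans (uB 0 0)%N; rewrite mulr1 cnorm_ge0.
have xA : `|x| = A * (1 / 4) * r by rewrite AE; field; rewrite gt_eqF.
have yD : `|y| = D * (1 / 4) * r by rewrite DE; field; rewrite gt_eqF.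
have term i j : cnorm (u i j - ps (trunc T u) i j) * `|x| ^+ i * `|y| ^+ j
    <= B * (A ^+ T + D ^+ T) * ((1 / 4) ^+ i * (1 / 4) ^+ j).
  have AD0 : 0 <= A ^+ T + D ^+ T by rewrite addr_ge0 ?exprn_ge0.
  have q0 k : 0 <= (1 / 4 : R) ^+ k by rewrite exprn_ge0 // divr_ge0.
  rewrite /ps_of_poly pcoef_trunc; case: ifP => [_|/negbT].
    by rewrite subrr cnorm0 !mul0r !mulr_ge0.
  rewrite negb_and -!leqNgt subr0 => ijT.
  have [q qE] : exists q : R, q = 1 / 4 by eexists.
  rewrite -qE in q0 xA yD *; rewrite xA yD !exprMn.
  have -> : cnorm (u i j) * (A ^+ i * q ^+ i * r ^+ i) * (D ^+ j * q ^+ j * r ^+ j)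
    = cnorm (u i j) * r ^+ (i + j) * (A ^+ i * D ^+ j) * (q ^+ i * q ^+ j).
    by rewrite exprD; ring.
  rewrite ler_wpM2r ?mulr_ge0 // ler_pM ?mulr_ge0 ?cnorm_ge0 ?exprn_ge0 ?(ltW r0) //.
  case/orP: ijT => h.
    apply: (@le_trans _ _ (A ^+ T)); last by rewrite lerDl exprn_ge0.
    by rewrite -[leRHS]mulr1 ler_pM ?exprn_ge0 ?exprn_ile1 // ler_wiXn2l.
  apply: (@le_trans _ _ (D ^+ T)); last by rewrite lerDr exprn_ge0.
  by rewrite -[leRHS]mul1r ler_pM ?exprn_ge0 ?exprn_ile1 // ler_wiXn2l.
rewrite -AE -DE /ps_partial -sumrB.
apply: (@le_trans _ _ (\sum_(i < n) \sum_(j < n)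
    B * (A ^+ T + D ^+ T) * ((1 / 4) ^+ i * (1 / 4) ^+ j))).
  apply: le_trans (cnorm_sum _ _) _; apply: ler_sum => i _; rewrite -sumrB.
  apply: le_trans (cnorm_sum _ _) _; apply: ler_sum => j _.
  by rewrite -!mulrBl !cnormM !cnormX !cnorm_real term.
under eq_bigr do rewrite -mulr_sumr -mulr_sumr.
rewrite -mulr_sumr -mulr_suml [leLHS]mulrC mulrA.
have gq := geometric_quarter n.
set G := \sum_(i < n) _ in gq *.
have G0 : 0 <= G by rewrite sumr_ge0 // => i _; rewrite exprn_ge0 // divr_ge0.
have GG : G * G <= 2 * 2 by rewrite ler_pM.
rewrite ler_wpM2r ?addr_ge0 ?exprn_ge0 // ler_wpM2r //.
by apply: le_trans GG _; lra.
Qed.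

(** Adding [2 K / 2^n] makes the sequence nonincreasing, so monotone convergence applies. *)
Lemma cvg_dyadic (a : nat -> R) (K : R) :
  (forall n m, (n <= m)%N -> `|a m - a n| <= K * (1 / 2) ^+ n) -> cvgn a.
Proof.
move=> aK.
pose g n := 2 * K * (1 / 2) ^+ n : R.
have cg : cvgn g.
  apply/cvg_ex; exists 0.
  apply: (@cvg_geometric _ (2 * K) (1 / 2)).
  by rewrite ger0_norm; lra.
pose c n := a n + g n.
have K0 : 0 <= K by have := aK 0%N 0%N (leqnn _); rewrite subrr normr0 expr0 mulr1.
have g0 n : 0 <= g n by rewrite !mulr_ge0 // exprn_ge0 // divr_ge0.
have cc : cvgn c.
  apply: nonincreasing_is_cvgn.
    apply/nonincreasing_seqP => n.
    have := aK n n.+1 (leqnSn n); rewrite ler_norml => /andP[_ h].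
    by rewrite /c /g exprS; lra.
  exists (a 0%N - K) => _ [n _ <-]; rewrite /c.
  have := aK 0%N n (leq0n n); rewrite expr0 mulr1 ler_norml => /andP[h _].
  by have := g0 n; lra.
have -> : a = c - g by apply/funext => n; rewrite /c !fctE addrK.
exact: is_cvgB.
Qed.

Lemma lim_near (a : nat -> R) (v e : R) T : cvgn a ->
  (forall n, (T <= n)%N -> `|a n - v| <= e) -> `|limn a - v| <= e.
Proof.
move=> ca av; rewrite ler_norml lerBrDr lerBlDr; apply/andP; split.
  apply: limr_ge => //; exists T => // n /= Tn.
  by have := av n Tn; rewrite ler_norml => /andP[h _]; lra.
apply: limr_le => //; exists T => // n /= Tn.
by have := av n Tn; rewrite ler_norml => /andP[_ h]; lra.
Qed.

Lemma ps_eval_trunc u (r : R) T : 0 < r -> ps_bounded_at u r ->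
  exists2 K, 0 <= K & forall x y : R, `|x| <= r / 8 -> `|y| <= r / 8 ->
  cnorm (ps_eval u x%:C y%:C - peval (trunc T u) x%:C y%:C) <= K * (`|x| ^+ T + `|y| ^+ T).
Proof.
move=> r0 [B uB].
have B0 : 0 <= B by apply: le_trans (uB 0 0)%N; rewrite mulr1 cnorm_ge0.
exists (2 * (4 * B * (4 / r) ^+ T)).
  by rewrite !mulr_ge0 // exprn_ge0 // divr_ge0 // ltW.
move=> x y xr yr.
have pd := partial_diff r0 uB xr yr.
have dy n m : (n <= m)%N ->
    cnorm (ps_partial u x%:C y%:C m - ps_partial u x%:C y%:C n) <= 8 * B * (1 / 2) ^+ n.
  move=> nm; apply: le_trans (pd n m nm) _.
  have h (z : R) : `|z| <= r / 8 -> (4 * `|z| / r) ^+ n <= (1 / 2) ^+ n.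
    move=> zr; apply: lerXn2r; rewrite ?nnegrE ?divr_ge0 ?mulr_ge0 ?(ltW r0) //.
    by rewrite ler_pdivrMr //; lra.
  have := h x xr; have := h y yr => h1 h2.
  have -> : 8 * B * (1 / 2) ^+ n = 4 * B * ((1 / 2) ^+ n + (1 / 2) ^+ n) by ring.
  by rewrite ler_wpM2l ?lerD // mulr_ge0.
have cR : cvgn (fun n => complex.Re (ps_partial u x%:C y%:C n)).
  apply: (@cvg_dyadic _ (8 * B)) => n m nm; rewrite -ReB.
  exact: le_trans (cnorm_ge_Re _) (dy n m nm).
have cI : cvgn (fun n => complex.Im (ps_partial u x%:C y%:C n)).
  apply: (@cvg_dyadic _ (8 * B)) => n m nm; rewrite -ImB.
  exact: le_trans (cnorm_ge_Im _) (dy n m nm).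
apply: le_trans (cnorm_le_ReIm _) _; rewrite ReB ImB /= -ps_partialE.
have bd n : (T <= n)%N -> cnorm (ps_partial u x%:C y%:C n - ps_partial u x%:C y%:C T)
    <= 4 * B * (4 / r) ^+ T * (`|x| ^+ T + `|y| ^+ T).
  move=> Tn; apply: le_trans (pd T n Tn) _.
  have ez (z : R) : (4 * z / r) ^+ T = (4 / r) ^+ T * z ^+ T.
    by rewrite -exprMn mulrAC.
  by rewrite !ez -mulrDr mulrA.
rewrite -[2 * _ * _]mulrA mulr2n mulrDl mul1r.
apply: lerD; apply: (lim_near (T := T)) => // n Tn.
  by rewrite -ReB; apply: le_trans (cnorm_ge_Re _) (bd n Tn).
by rewrite -ImB; apply: le_trans (cnorm_ge_Im _) (bd n Tn).
Qed.

Lemma pcoef_support P : exists A : nat, forall i j,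
  (A <= i)%N || (A <= j)%N -> pcoef P i j = 0.
Proof.
elim/poly_ind: P => [|P c [A PA]].
  by exists 0%N => i j _; rewrite /pcoef !coef0.
exists (maxn A.+1 (size c)) => i j ij; rewrite /pcoef coefD coefMX coefC.
case: j ij => [|j] /= ij; rewrite ?add0r ?addr0.
  by apply: nth_default; move: ij; rewrite !geq_max ltn0 orbF => /andP[].
rewrite -[LHS]/(pcoef P i j); apply: PA.
move: ij; rewrite !geq_max => /orP[] /andP[h _]; apply/orP; [left|right] => //.
exact: ltnW.
Qed.

Lemma ps_eval_poly p (x y : C) : ps_eval (ps p) x y = peval p x y.
Proof.
have [A pA] := pcoef_support p.
have tr n : (A <= n)%N -> ps_partial (ps p) x y n = peval p x y.
  move=> An; rewrite ps_partialE; congr peval; apply: pcoef_inj => i j.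
  rewrite pcoef_trunc; case: ifP => // /negbT; rewrite negb_and -!leqNgt => h.
  by rewrite pA //; apply/orP; case/orP: h => h; [left|right]; apply: leq_trans h.
rewrite /ps_eval.
have lc (f : C -> R) : limn (fun n => f (ps_partial (ps p) x y n)) = f (peval p x y).
  apply: (@lim_near_cst R) => //; exists A => // n /= An.
  by rewrite tr.
by rewrite !lc; case: (peval p x y).
Qed.

End Evaluation.

(** * Proof of the theorem *)

Section Assembly.
Variable R : realType.
Local Notation C := R[i].
Local Notation E := {poly {poly C}}.
Local Open Scope complex_scope.
Implicit Types (u : pseries R) (p F G P W B : E).
Local Notation ps := (@ps_of_poly R).

(** On the real plane [pconj B] has the modulus of [B], so both generators are controlled by [B]
    alone. *)
Lemma xlocal_bounded B p : xlocal_ideal B (pconj B) p ->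
  exists e K : R, [/\ 0 < e, 0 <= K & forall x y : R, `|x| < e -> `|y| < e ->
    cnorm (peval p x%:C y%:C) <= K * cnorm (peval B x%:C y%:C)].
Proof.
move=> [v v0 [a [b vab]]].
have [d [c [K [d0 c0 K0 vP]]]] := poly_near0 v0.
have [Ka Ka0 aP] := peval_bound a 1; have [Kb Kb0 bP] := peval_bound b 1.
exists (Num.min d 1), ((Ka + Kb) / c); split.
- by rewrite lt_min d0 ltr01.
- by rewrite divr_ge0 ?addr_ge0 // ltW.
move=> x y; rewrite !lt_min => /andP[xd x1] /andP[_ y1].
have /andP[cv _] := vP x%:C ltac:(by rewrite cnorm_real).
have a1 : cnorm (peval a x%:C y%:C) <= Ka by apply: aP; rewrite cnorm_real ltW.
have b1 : cnorm (peval b x%:C y%:C) <= Kb by apply: bP; rewrite cnorm_real ltW.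
have := congr1 (fun q => cnorm (peval q x%:C y%:C)) vab.
rewrite !(pevalD, pevalM) pevalC peval_pconj cnormM => vE.
have := cnormD (peval a x%:C y%:C * peval B x%:C y%:C)
  (peval b x%:C y%:C * (peval B x%:C y%:C)^*%C).
rewrite -vE !cnormM cnorm_conj => h.
rewrite mulrAC ler_pdivlMr // mulrC mulrDl.
apply: le_trans (ler_wpM2r (cnorm_ge0 _) cv) (le_trans h _).
by apply: lerD; rewrite ler_wpM2r ?cnorm_ge0.
Qed.

Lemma csq_div_le (z w : C) (K : R) : 0 <= K -> (w != 0 -> cnorm z <= K * cnorm w) ->
  csq (z / w) <= K ^+ 2.
Proof.
move=> K0 zw; have [->|w0] := eqVneq w 0.
  by rewrite invr0 mulr0 csqE cnorm0 expr0n sqr_ge0.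
rewrite csqE ler_pXn2r ?nnegrE ?cnorm_ge0 // cnormM cnormV.
by rewrite ler_pdivrMr ?cnorm_gt0 ?zw.
Qed.

Lemma xlocal_Lloc B p : xlocal_ideal B (pconj B) p -> Lloc B p.
Proof.
move=> /xlocal_bounded[e [K [e0 K0 pK]]].
apply: (@Lloc_bounded _ _ _ e (K ^+ 2)) => // -[x y] [xe ye].
by apply: csq_div_le => // _; apply: pK.
Qed.

Lemma Lloc_comparable (F G p : E) (e K : R) : 0 < e -> 0 <= K ->
  (forall x y : R, (x, y) != (0, 0) -> `|x| < e -> `|y| < e ->
    peval G x%:C y%:C != 0 ->
    cnorm (peval F x%:C y%:C) <= K * cnorm (peval G x%:C y%:C) /\
    peval F x%:C y%:C != 0) ->
  Lloc F p -> Lloc G p.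
Proof.
move=> e0 K0 FG Fp.
apply: (@Lloc_dominated _ _ _ _ _ _ _ e (K ^+ 2) (quo p G (0, 0)) _ Fp Fp) => //.
move=> [x y] [/= xe ye].
have q2 z : 0 <= K ^+ 2 * quo p F z := mulr_ge0 (sqr_ge0 K) (quo_ge0 p F z).
have [->|xy] := eqVneq (x, y) (0, 0).
  by rewrite mulrDr lerDr (addr_ge0 (q2 _) (q2 _)).
apply: (@le_trans _ _ (K ^+ 2 * quo p F (x, y))); last first.
  move: (q2 (x, y)) (quo_ge0 p G (0, 0)).
  by move: (quo p F (x, y)) (quo p G (0, 0)) => a b; lra.
have [G0|G0] := eqVneq (peval G x%:C y%:C) 0.
  by rewrite {1}/quo /= G0 invr0 mulr0 csqE cnorm0 expr0n.
have [FK F0] := FG x y xy xe ye G0.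
have -> : quo p G (x, y)
    = csq (peval F x%:C y%:C / peval G x%:C y%:C) * quo p F (x, y).
  by rewrite /quo /= -csqM; congr csq; field; rewrite F0 G0.
by rewrite ler_wpM2r ?quo_ge0 // csq_div_le.
Qed.

Lemma I2_poly P p : Lloc P p -> I2 P (ps p).
Proof.
move=> [e e0 ie]; split; first exact: convergent_poly.
have m0 : 0 < Num.min e 1 by rewrite lt_min e0 ltr01.
exists (Num.min e 1); split=> //; split.
  have [S S0 pS] := pcoef_bounded p; exists S => i j.
  apply: le_trans (pS i j); rewrite ler_piMr ?cnorm_ge0 // exprn_ile1 ?(ltW m0) //.
  by rewrite ge_min lexx orbT.
have -> : (fun z : R * R => (csq (ps_eval (ps p) z.1%:C z.2%:C / peval P z.1%:C z.2%:C))%:E)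
   = (fun z => (quo p P z)%:E).
  by apply/funext => z; rewrite ps_eval_poly.
apply: integrableS ie; try exact: measurable_square.
by apply: square_sub; rewrite ge_min lexx.
Qed.

(** The discarded tail is of size [|x| ^+ T + |y| ^+ T], hence bounded by a multiple of [P]; its
    quotient by [P] is bounded and does not affect square integrability. *)
Lemma I2_trunc P u T (e K : R) : 0 < e -> 0 <= K ->
  (forall x y : R, `|x| < e -> `|y| < e -> peval P x%:C y%:C != 0 ->
    `|x| ^+ T + `|y| ^+ T <= K * cnorm (peval P x%:C y%:C)) ->
  I2 P u -> Lloc P (trunc T u).
Proof.
move=> e0 K0 TP [_ [r [r0 [ur iu]]]].
have [K' K'0 uT] := ps_eval_trunc T r0 ur.
have [e' [e'0 e'e e'r]] : exists e', [/\ 0 < e', e' <= e & e' <= r / 8].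
  exists (Num.min e (r / 8)).
  by rewrite lt_min e0 divr_gt0 // !ge_min !lexx orbT.
exists e' => //.
apply: (@integrable_dominated _ _ _
  (fun z => csq (ps_eval u z.1%:C z.2%:C / peval P z.1%:C z.2%:C)) 2
  (2 * (K' * K) ^+ 2)).
- exact: measurable_square.
- exact: leb2_square.
- exact: measurable_quo.
- move=> [x y] [/= xe ye]; rewrite quo_ge0 /=.
  set w := ps_eval u _ _; set v := peval P _ _.
  have -> : quo (trunc T u) P (x, y)
      = csq (w / v + - (w - peval (trunc T u) x%:C y%:C) / v).
    by rewrite /quo /= -/v; congr csq; rewrite -mulrDl opprB addrC subrK.
  apply: le_trans (csqD _ _) _; rewrite lerD2l ler_pM2l //.
  apply: csq_div_le; first exact: mulr_ge0.
  move=> v0; rewrite cnormN.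
  have xr := ltW (lt_le_trans xe e'r); have yr := ltW (lt_le_trans ye e'r).
  apply: le_trans (uT x y xr yr) _.
  by rewrite -mulrA ler_wpM2l // TP //; exact: lt_le_trans e'e.
apply: integrableS iu; try exact: measurable_square.
apply: square_sub; apply: le_trans e'r _; lra.
Qed.

End Assembly.

Theorem theorem1p6 (R : realType) (P : {poly {poly R[i]}})
  (P_noH2 : forall x y : R[i], 0 < complex.Im x -> 0 < complex.Im y ->
     peval P x y != 0)
  (P_00 : peval P 0 0 = 0)
  (P_cop : no_common_factor P (pconj P))
  (M : nat) (hM : vanishing_order P M)
  (L : 'I_M -> nat) (q : 'I_M -> {poly R})
  (hq0 : forall j, (q j).[0] = 0)
  (hq1 : forall j, 0 < (q j)^`().[0])
  (hqdeg : forall j, (size (q j) <= 2 * L j)%N)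
  (hPP : comparable_near0 P (bkps q L)) :
  exists n : nat,
    quot_dim (I2 P)
      (ideal2 (ps_of_poly (bkps q L)) (ps_of_poly (pconj (bkps q L)))) n /\
    quot_dim (@Cxy R)
      (ideal2 (ps_of_poly P) (ps_of_poly (pconj P))) (2 * n).
Proof.
have P0 : P != 0.
  have [[i [j [_ Pij]]] _] := hM.
  by apply: contraNneq Pij => ->; rewrite /pcoef !coef0.
have [m Mm] : exists m, M = m.+1.
  case: M hM {L q hq0 hq1 hqdeg hPP} => [[[i [j [ij Pij]]] _]|m _]; last by exists m.
  move/eqP: ij Pij; rewrite addn_eq0 => /andP[/eqP -> /eqP ->].
  by rewrite pcoef00 P_00 eqxx.
pose s := [seq (q j, L j) | j <- enum 'I_M].
have BE : bkps q L = prodB s by rewrite /bkps /prodB big_map big_enum.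
have ss : size s = m.+1 by rewrite size_map size_enum_ord.
have sP t : t \in s -> good_factor t.
  (* If [L j] were [0], the degree bound would force [q j = 0], against the positive derivative. *)
  move=> /mapP[j _ ->]; split=> //=; rewrite lt0n; apply/eqP => L0.
  have := hqdeg j; rewrite L0 muln0 leqn0 size_poly_eq0 => /eqP qj0.
  by have := hq1 j; rewrite qj0 deriv0 horner0 ltxx.
rewrite BE in hPP *; set B := prodB s in hPP *.
have [n [dimL [c [K [d [c0 d0 resP]]]]]] := qdim_Lloc sP.
have [W [U [E0 [u0 [T [[Wm sW W0 U0 PE] [u00 dW]]]]]]] :=
  local_factor sP ss P0 P_noH2 hPP c0 d0 resP.
have Bm : B \is monic by exact: prodB_monic.
have sB : size B = m.+2 by rewrite size_prodB ss.
have B0 : slice 0 B = 'X^(m.+1) by rewrite slice0_prodB // ss.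
have [v vE v0] : exists2 v, \det (horner_mx (compm m B) (pconj B)) = 'X^(2 * n) * v
    & v.[0] != 0.
  apply: (@polyX_order _ _ _ c K d) => // x x0 xd.
  by rewrite (@cnorm_det _ _ _ _ (roots_at s x%:C%C) Bm sB) ?slice_prodB // resP.
(* [B] is its own Hensel factor, with cofactor [1] and no error. *)
have BB : B = B * 1 + ('X^((2 * n + 0).+1))%:P * 0 by ring.
have one0 : peval 1 0 0 != 0 :> R[i] by rewrite peval1 oner_neq0.
have Bn0 x y : (x, y) != (0, 0) -> peval B x%:C%C y%:C%C != 0 by exact: prodB_neq0.
have [e [K1 [e0 e1 K10 PBs]]] := comparable_strict P0 Bn0 hPP.
have Pn0 (x y : R) : (x, y) != (0, 0) -> `|x| < e -> `|y| < e ->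
    peval P x%:C%C y%:C%C != 0.
  move=> xy xe ye; apply: contraNneq (Bn0 x y xy) => Pxy.
  have [_] := PBs x y xy xe ye; rewrite Pxy cnorm0 mulr0 => h.
  by rewrite -cnorm_eq0 eq_le h cnorm_ge0.
have LBP p : Lloc B p -> Lloc P p.
  apply: (@Lloc_comparable _ _ _ _ e K1) => //; first exact: ltW.
  by move=> x y xy xe ye _; split; [have [] := PBs x y xy xe ye|exact: Bn0].
have LPB p : Lloc P p -> Lloc B p.
  apply: (@Lloc_comparable _ _ _ _ e K1) => //; first exact: ltW.
  by move=> x y xy xe ye _; split; [have [] := PBs x y xy xe ye|exact: Pn0].
exists n; split.
  apply: (quot_dim_lift Bm sB B0 one0 BB v0 vE (Up := Lloc B)).
  (* Codimension [2 n] of the ideal minus codimension [n] of [Lloc B]. *)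
  - have -> : n = (2 * n - n)%N by rewrite mul2n -addnn addnK.
    apply: qdim_sub => //.
    + exact: Lloc_kclosed.
    + exact: xlocal_ideal_kclosed.
    + exact: xlocal_Lloc.
    + exact: (qdim_xlocal_ideal Bm sB v0 vE).
  - by move=> p /LBP /I2_poly.
  move=> u Iu; split; first by case: Iu.
  apply: LPB.
  (* For the truncation order [T = m.+1 * (2 * n)], both [x^T] and [y^T] lie in the ideal of [B], so
     they are bounded by [B] and thus by [P], as [I2_trunc] requires. *)
  have [eX [KX [eX0 KX0 Xb]]] := xlocal_bounded (xlocal_Xn Bm sB v0 vE
    (leq_pmull (2 * n) (ltn0Sn m))).
  have [eY [KY [eY0 KY0 Yb]]] := xlocal_bounded (xlocal_Yn Bm sB B0 v0 vE (leqnn _)).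
  apply: (@I2_trunc _ _ _ _ (Num.min e (Num.min eX eY)) ((KX + KY) * K1)) => //.
  - by rewrite !lt_min e0 eX0 eY0.
  - by rewrite mulr_ge0 ?addr_ge0 // ltW.
  move=> x y; rewrite !lt_min => /and3P[xe xX xY] /and3P[ye yX yY] Pxy.
  have xy : (x, y) != (0, 0).
    by apply: contraNneq Pxy => -[-> ->]; rewrite P_00.
  have := Xb x y xX yX; have := Yb x y xY yY.
  rewrite pevalXn pevalX pevalC hornerXn !cnormX !cnorm_real => hY hX.
  have [_ hB] := PBs x y xy xe ye.
  apply: (@le_trans _ _ ((KX + KY) * cnorm (peval B x%:C%C y%:C%C))).
    by rewrite mulrDl lerD.
  by rewrite -mulrA ler_wpM2l // addr_ge0.
apply: (quot_dim_lift Wm sW W0 U0 PE u00 dW (Up := fun=> True)) => //.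
- exact: (qdim_xlocal_ideal Wm sW u00 dW).
- by move=> p _; exact: convergent_poly.
Qed.
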